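(* Let $K$ be a field and let $\mathbb{X}\subseteq\mathbb{P}^n_K$ be a $0$-dimensional locally Gorenstein scheme, with no point of $\mathrm{Supp}(\mathbb{X})$ on the hyperplane $X_0=0$, such that $\Delta_{\mathbb{X}}=1$, where $\Delta_{\mathbb{X}}=\deg(\mathbb{X})-\mathrm{HF}_{\mathbb{X}}(r_{\mathbb{X}}-1)$. Then the following conditions are equivalent: (a) $\mathbb{X}$ is an almost Gorenstein scheme. (b) $\mathbb{X}$ is a nearly Gorenstein Cayley-Bacharach scheme.
   Context: Setting. $P=K[X_0,\dots,X_n]$ has the standard grading, $I_{\mathbb{X}}\subseteq P$ is the (saturated) homogeneous vanishing ideal of $\mathbb{X}$, $R=P/I_{\mathbb{X}}$ with homogeneous maximal ideal $\mathfrak{m}$, and $\mathrm{Supp}(\mathbb{X})=\{p_1,\dots,p_s\}$ is the set of closed points. The residue class $x_0$ of $X_0$ in $R$ is a non-zerodivisor. $\mathcal{O}_{\mathbb{X},p_j}$ is the local ring at $p_j$, with residue field $\kappa(p_j)$; $\varkappa_j=\dim_K\kappa(p_j)$; $\deg(\mathbb{X})=\sum_j\dim_K\mathcal{O}_{\mathbb{X},p_j}$. $\mathrm{HF}_{\mathbb{X}}(i)=\dim_KR_i$, and $r_{\mathbb{X}}$ is the least integer such that $\mathrm{HF}_{\mathbb{X}}(i)=\deg(\mathbb{X})$ for all $i\ge r_{\mathbb{X}}$. $\mathbb{X}$ is locally Gorenstein if every $\mathcal{O}_{\mathbb{X},p_j}$ is a Gorenstein ring. $Q^h(R)$ is the localization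 of $R$ at all homogeneous non-zerodivisors; $Q^h(R)=R_{x_0}\cong\prod_{j=1}^s\mathcal{O}_{\mathbb{X},p_j}[T_j,T_j^{-1}]$ with $\deg T_j=1$, via the injection $\tilde\imath:R\to Q^h(R)$, $\tilde\imath(f)=(f_{p_1}T_1^i,\dots,f_{p_s}T_s^i)$ for $f\in R_i$, where $f_{p_j}$ is the germ of $f$ at $p_j$ (the image of $f/x_0^i$ in $\mathcal{O}_{\mathbb{X},p_j}$). Complementary module and trace. $L_0=K[x_0,x_0^{-1}]$. Fix a homogeneous trace map $\sigma$ of degree zero of $Q^h(R)/L_0$, i.e. a homogeneous element of degree $0$ of the graded module $\underline{\mathrm{Hom}}_{L_0}(Q^h(R),L_0)$ which is a $Q^h(R)$-basis of it; it exists when $\mathbb{X}$ is locally Gorenstein. The Dedekind complementary module $\mathfrak{C}^\sigma_{\mathbb{X}}\subseteq Q^h(R)$ is the image of the injection $\underline{\mathrm{Hom}}_{K[x_0]}(R,K[x_0])\to\underline{\mathrm{Hom}}_{L_0}(Q^h(R),L_0)=Q^h(R)\sigma\cong Q^h(R)$, $\varphi\mapsto\varphi\otimes\mathrm{id}_{L_0}$ (the last isomorphism sending $g\sigma$ to $g$). The trace $\mathrm{tr}(\mathfrak{C}^\sigma_{\mathbb{X}})$ is the sum of the ideals $\phi(\mathfrak{C}^\sigma_{\mathbb{X}})\subseteq R$ over all $\phi\in\underline{\mathrm{Hom}}_R(\mathfrak{C}^\sigma_{\mathbb{X}},R)$. $\mathbb{X}$ is nearly Gorenstein if $\mathfrak{m}\subseteq\mathrm{tr}(\mathfrak{C}^\sigma_{\mathbb{X}})$.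 $\mathbb{X}$ is almost Gorenstein if there is an exact sequence of graded $R$-modules $0\to R\to\mathfrak{C}^\sigma_{\mathbb{X}}(-r_{\mathbb{X}})\to C\to0$ (degree-zero maps) with $\mathfrak{m}\cdot C=\langle0\rangle$. Cayley-Bacharach. A subscheme $\mathbb{Y}\subseteq\mathbb{X}$ is a $p_j$-subscheme if $\mathcal{O}_{\mathbb{Y},p_k}=\mathcal{O}_{\mathbb{X},p_k}$ for $k\ne j$ and $\mathcal{O}_{\mathbb{X},p_j}\to\mathcal{O}_{\mathbb{Y},p_j}$ is surjective; it is maximal if $\deg(\mathbb{Y})=\deg(\mathbb{X})-\varkappa_j$. Maximal $p_j$-subschemes correspond bijectively to the ideals $\langle s_j\rangle$ of $\mathcal{O}_{\mathbb{X},p_j}$ generated by a nonzero socle element $s_j$ (with $\mathcal{O}_{\mathbb{Y},p_j}=\mathcal{O}_{\mathbb{X},p_j}/\langle s_j\rangle$). For $a\in\mathcal{O}_{\mathbb{X},p_j}$ put $\mu(a)=\min\{i\in\mathbb{N}\mid(0,\dots,0,aT_j^i,0,\dots,0)\in\tilde\imath(R)\}$ (entry in position $j$). If $e_{j1},\dots,e_{j\varkappa_j}\in\mathcal{O}_{\mathbb{X},p_j}$ have residue classes forming a $K$-basis of $\kappa(p_j)$, put $\mu_{\mathbb{Y}/\mathbb{X}}=\max_k\mu(e_{jk}s_j)$ (independent of the choices). $\deg_{\mathbb{X}}(p_j)$ is the minimum of $\mu_{\mathbb{Y}/\mathbb{X}}$ over all maximal $p_j$-subschemes $\mathbb{Y}$;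 one has $\deg_{\mathbb{X}}(p_j)\le r_{\mathbb{X}}$. $\mathbb{X}$ is a Cayley-Bacharach scheme if $\deg_{\mathbb{X}}(p_j)=r_{\mathbb{X}}$ for all $j$. *)

(* Defs.v *)
From HB Require Import structures.
From mathcomp Require Import all_boot all_order all_algebra.
From mathcomp Require Import boolp.
From mathcomp Require Import mpoly.
From mathcomp Require Import ring.

Set Implicit Arguments.
Unset Strict Implicit.
Unset Printing Implicit Defensive.

Import GRing.Theory.

Local Open Scope ring_scope.
Local Open Scope quotient_scope.

HB.mixin Record isMulAbsorbing (A : pzRingType) (I : A -> bool) := {
  mul_absorbing_subproof : forall a : A, {in I, forall u, a * u \in I}
}.

(* Unlike [idealr], an [ideal] may be the unit ideal: the empty subscheme of
   projective space has to be allowed. *)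
#[short(type="ideal")]
HB.structure Definition Ideal (A : pzRingType) :=
  {I of GRing.ZmodClosed A I & isMulAbsorbing A I}.

Section QuotientRing.
Variables (A : comPzRingType) (I : ideal A).

Definition quotring := Quotient.quot I.

HB.instance Definition _ := GRing.Zmodule.on quotring.
HB.instance Definition _ := EqQuotient.on quotring.

Definition quotmap (a : A) : quotring := \pi_(Quotient.quot I) a.

Definition quotring_mul (x y : quotring) : quotring :=
  quotmap (repr x * repr y).

Fact quotmap_repr (x : quotring) : quotmap (repr x) = x.
Proof. exact: reprK. Qed.

Fact quotmap_eqP (x y : A) : reflect (quotmap x = quotmap y) (x - y \in I).
Proof. by rewrite Quotient.idealrBE; apply: eqP. Qed.

Fact quotmap_zmod : zmod_morphism quotmap.
Proof. exact: raddfB. Qed.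
HB.instance Definition _ :=
  GRing.isZmodMorphism.Build A quotring quotmap quotmap_zmod.

Fact quotmapM (x y : A) : quotmap (x * y) = quotring_mul (quotmap x) (quotmap y).
Proof.
apply/quotmap_eqP.
set x' := repr _; set y' := repr _.
rewrite (_ : x * y - x' * y' = y * (x - x') + x' * (y - y')); last by rewrite /=; ring.
by apply: rpredD; apply: mul_absorbing_subproof;
   apply/quotmap_eqP; rewrite quotmap_repr.
Qed.

Fact quotring_mulA : associative quotring_mul.
Proof.
move=> x y z; rewrite -[x]quotmap_repr -[y]quotmap_repr -[z]quotmap_repr.
by rewrite -!quotmapM mulrA.
Qed.

Fact quotring_mulC : commutative quotring_mul.
Proof. by move=> x y; rewrite /quotring_mul mulrC. Qed.

Fact quotring_mul1 : left_id (quotmap 1) quotring_mul.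
Proof. by move=> x; rewrite -[x]quotmap_repr -quotmapM mul1r. Qed.

Fact quotring_mulD : left_distributive quotring_mul +%R.
Proof.
move=> x y z; rewrite -[x]quotmap_repr -[y]quotmap_repr -[z]quotmap_repr.
by rewrite -raddfD /= -!quotmapM -raddfD mulrDl.
Qed.

HB.instance Definition _ := GRing.Zmodule_isComPzRing.Build quotring
  quotring_mulA quotring_mulC quotring_mul1 quotring_mulD.

Fact quotmap_monoid : monoid_morphism quotmap.
Proof. by split=> // x y; apply: quotmapM. Qed.
HB.instance Definition _ :=
  GRing.isMonoidMorphism.Build A quotring quotmap quotmap_monoid.

End QuotientRing.

Section Localization.
Variables (A : comPzRingType) (S : mulrClosed A).

Definition denom := {s : A | s \in S}.
HB.instance Definition _ := Choice.on denom.

Definition one_denom : denom := exist _ 1 (rpred1 S).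
Definition mul_denom (s t : denom) : denom :=
  exist _ (val s * val t) (rpredM (valP s) (valP t)).

Definition loc_rel (x y : A * denom) : bool :=
  `[< exists2 u, u \in S & u * (x.1 * val y.2 - y.1 * val x.2) = 0 >].

Fact loc_rel_equiv : equiv_class_of loc_rel.
Proof.
split=> [x|x y|y x z].
- by apply/asboolP; exists 1; rewrite ?rpred1 // subrr mulr0.
- apply/idP/idP => /asboolP[u uS e]; apply/asboolP; exists u => //;
  by rewrite -opprB mulrN e oppr0.
- move=> /asboolP[u uS e] /asboolP[v vS f]; apply/asboolP.
  exists (u * v * val y.2); first by rewrite !rpredM ?(valP y.2).
  have -> : u * v * val y.2 * (x.1 * val z.2 - z.1 * val x.2) =
     (v * val z.2) * (u * (x.1 * val y.2 - y.1 * val x.2)) +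
     (u * val x.2) * (v * (y.1 * val z.2 - z.1 * val y.2)) by ring.
  by rewrite e f !mulr0 addr0.
Qed.

Canonical loc_rel_equiv_rel := EquivRelPack loc_rel_equiv.
Canonical loc_rel_enc := defaultEncModRel loc_rel.

Definition loc := {eq_quot loc_rel}.
HB.instance Definition _ := Choice.on loc.
HB.instance Definition _ := EqQuotient.on loc.

Definition frac (a : A) (s : denom) : loc := \pi_loc (a, s).
Definition numer (x : loc) : A := (repr x).1.
Definition denomi (x : loc) : denom := (repr x).2.

Fact frac_repr x : frac (numer x) (denomi x) = x.
Proof. by rewrite /frac /numer /denomi -surjective_pairing reprK. Qed.

Fact frac_eqP a s b t :
  (exists2 u, u \in S & u * (a * val t - b * val s) = 0) <->
  frac a s = frac b t.
Proof.
split=> [h|/eqP]; last by rewrite eqmodE => /asboolP.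
by apply/eqP; rewrite eqmodE; apply/asboolP.
Qed.

Definition loc_add (x y : loc) : loc :=
  frac (numer x * val (denomi y) + numer y * val (denomi x))
       (mul_denom (denomi x) (denomi y)).
Definition loc_opp (x : loc) : loc := frac (- numer x) (denomi x).
Definition loc_mul (x y : loc) : loc :=
  frac (numer x * numer y) (mul_denom (denomi x) (denomi y)).

Fact frac_add a s b t : loc_add (frac a s) (frac b t) =
  frac (a * val t + b * val s) (mul_denom s t).
Proof.
rewrite /loc_add; apply/frac_eqP.
have /frac_eqP[u uS e] := frac_repr (frac a s).
have /frac_eqP[v vS f] := frac_repr (frac b t).
exists (u * v); first exact: rpredM.
set a' := numer _ in e *; set s' := denomi _ in e *.
set b' := numer _ in f *; set t' := denomi _ in f *.
rewrite /= (_ : _ * _ = v * val t' * val t * (u * (a' * val s - a * val s')) +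
  u * val s' * val s * (v * (b' * val t - b * val t'))); last by rewrite /=; ring.
by rewrite e f !mulr0 addr0.
Qed.

Fact frac_mul a s b t : loc_mul (frac a s) (frac b t) =
  frac (a * b) (mul_denom s t).
Proof.
rewrite /loc_mul; apply/frac_eqP.
have /frac_eqP[u uS e] := frac_repr (frac a s).
have /frac_eqP[v vS f] := frac_repr (frac b t).
exists (u * v); first exact: rpredM.
set a' := numer _ in e *; set s' := denomi _ in e *.
set b' := numer _ in f *; set t' := denomi _ in f *.
rewrite /= (_ : _ * _ = v * b' * val t * (u * (a' * val s - a * val s')) +
  u * a * val s' * (v * (b' * val t - b * val t'))); last by rewrite /=; ring.
by rewrite e f !mulr0 addr0.
Qed.

Fact frac_opp a s : loc_opp (frac a s) = frac (- a) s.
Proof.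
rewrite /loc_opp; apply/frac_eqP.
have /frac_eqP[u uS e] := frac_repr (frac a s).
exists u => //; rewrite -[RHS]oppr0 -e; ring.
Qed.

Fact frac_eq a s b t : a * val t = b * val s -> frac a s = frac b t.
Proof.
by move=> e; apply/frac_eqP; exists 1; rewrite ?rpred1 // e subrr mulr0.
Qed.

Fact loc_addA : associative loc_add.
Proof.
move=> x y z; rewrite -[x]frac_repr -[y]frac_repr -[z]frac_repr !frac_add.
by apply: frac_eq => /=; ring.
Qed.

Fact loc_addC : commutative loc_add.
Proof.
move=> x y; rewrite -[x]frac_repr -[y]frac_repr !frac_add.
by apply: frac_eq => /=; ring.
Qed.

Fact loc_add0 : left_id (frac 0 one_denom) loc_add.
Proof.
by move=> x; rewrite -[x]frac_repr !frac_add; apply: frac_eq => /=; ring.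
Qed.

Fact loc_addN : left_inverse (frac 0 one_denom) loc_opp loc_add.
Proof.
move=> x; rewrite -[x]frac_repr frac_opp !frac_add.
by apply: frac_eq => /=; ring.
Qed.

HB.instance Definition _ :=
  GRing.isZmodule.Build loc loc_addA loc_addC loc_add0 loc_addN.

Fact loc_mulA : associative loc_mul.
Proof.
move=> x y z; rewrite -[x]frac_repr -[y]frac_repr -[z]frac_repr !frac_mul.
by apply: frac_eq => /=; ring.
Qed.

Fact loc_mulC : commutative loc_mul.
Proof.
move=> x y; rewrite -[x]frac_repr -[y]frac_repr !frac_mul.
by apply: frac_eq => /=; ring.
Qed.

Fact loc_mul1 : left_id (frac 1 one_denom) loc_mul.
Proof.
by move=> x; rewrite -[x]frac_repr !frac_mul; apply: frac_eq => /=; ring.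
Qed.

Fact loc_mulD : left_distributive loc_mul +%R.
Proof.
move=> x y z; rewrite -[x]frac_repr -[y]frac_repr -[z]frac_repr.
rewrite [_ + _]frac_add !frac_mul [RHS]frac_add.
by apply: frac_eq => /=; ring.
Qed.

HB.instance Definition _ := GRing.Zmodule_isComPzRing.Build loc
  loc_mulA loc_mulC loc_mul1 loc_mulD.

Definition locmap (a : A) : loc := frac a one_denom.

Fact locmap_zmod : zmod_morphism locmap.
Proof.
move=> a b; rewrite [- locmap b]frac_opp [RHS]frac_add.
by apply: frac_eq => /=; ring.
Qed.
HB.instance Definition _ := GRing.isZmodMorphism.Build A loc locmap locmap_zmod.

Fact locmap_monoid : monoid_morphism locmap.
Proof.
by split=> // a b; rewrite [RHS]frac_mul; apply: frac_eq => /=; ring.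
Qed.
HB.instance Definition _ :=
  GRing.isMonoidMorphism.Build A loc locmap locmap_monoid.

Definition loc_scale (a : A) (x : loc) : loc := locmap a * x.

Fact loc_scaleA a b x : loc_scale a (loc_scale b x) = loc_scale (a * b) x.
Proof. by rewrite /loc_scale rmorphM mulrA. Qed.
Fact loc_scale1 : left_id 1 loc_scale.
Proof. by move=> x; rewrite /loc_scale rmorph1 mul1r. Qed.
Fact loc_scaleDr : right_distributive loc_scale +%R.
Proof. by move=> a x y; rewrite /loc_scale mulrDr. Qed.
Fact loc_scaleDl x : {morph loc_scale^~ x : a b / a + b}.
Proof. by move=> a b; rewrite /loc_scale rmorphD mulrDl. Qed.

HB.instance Definition _ := GRing.Zmodule_isLmodule.Build A loc
  loc_scaleA loc_scale1 loc_scaleDr loc_scaleDl.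

(* [a / s], with [s] replaced by [1] when it is not a legal denominator. *)
Definition fraction (a s : A) : loc := frac a (insubd one_denom s).

End Localization.

Definition least (E : nat -> Prop) : nat :=
  if pselect (exists m, `[< E m >]) is left h then ex_minn h else 0%N.

Section Dimension.
(* [k] is the structure map of a [K]-algebra [A], and [V], [W] stand for
   [K]-subspaces of [A] with [W] contained in [V]. *)
Variables (K : fieldType) (A : comPzRingType) (k : K -> A).

Definition basis_mod (V W : A -> Prop) (d : nat) (e : 'I_d -> A) : Prop :=
  (forall i, V (e i)) /\
  (forall v, V v ->
     exists! c : {ffun 'I_d -> K}, W (v - \sum_(i < d) k (c i) * e i)).

(* The dimension of [V / W], or [0] if it is infinite. *)
Definition dim_mod (V W : A -> Prop) : nat :=
  least (fun d => exists e : 'I_d -> A, basis_mod V W e).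

End Dimension.

Section LocalRings.
Variable A : comPzRingType.

Definition nonunit (a : A) : Prop := ~ exists b, a * b = 1.

Definition local_ring : Prop :=
  (1 : A) <> 0 /\ (forall a b, nonunit a -> nonunit b -> nonunit (a + b)).

Definition noetherian : Prop :=
  forall J : ideal A, exists m (g : 'I_m -> A), forall x,
    x \in J <-> exists c : 'I_m -> A, x = \sum_(i < m) c i * g i.

Definition injective_module (E : lmodType A) : Prop :=
  forall (M N : lmodType A) (i : {linear M -> N}) (f : {linear M -> E}),
    injective i -> exists g : {linear N -> E}, forall x, g (i x) = f x.

(* [M] has an injective resolution 0 -> M -> E_0 -> ... -> E_d -> 0; each
   constructor [injdimS] peels off the short exact sequence 0 -> M -> E -> N. *)
Inductive injdim_le : nat -> lmodType A -> Prop :=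
  | injdim0 (E : lmodType A) : injective_module E -> injdim_le 0 E
  | injdimS d (M E N : lmodType A) (f : {linear M -> E}) (g : {linear E -> N}) :
      injective_module E -> injective f -> (forall z, exists y, g y = z) ->
      (forall y, g y = 0 <-> exists x, f x = y) ->
      injdim_le d N -> injdim_le d.+1 M.

Definition gorenstein_local : Prop :=
  [/\ local_ring, noetherian & exists d, injdim_le d A^o].

End LocalRings.

Section GradedModules.

(* A graded submodule of [U]: its underlying set and its homogeneous parts. *)
Record graded (U : Type) := Graded {
  carrier :> U -> Prop;
  hpart : int -> U -> Prop
}.

(* M(d) *)
Definition shift (U : Type) (M : graded U) (d : int) : graded U :=
  Graded M (fun i => hpart M (i + d)).

Variables (A : pzRingType) (L : A -> Prop) (U V : lmodType A).
Variables (M : graded U) (N : graded V).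

(* Maps out of [M] are functions on all of [U] of which only the values on [M]
   are relevant; the scalars are taken from the subset [L] of [A]. *)
Definition linear_on (phi : U -> V) : Prop :=
  [/\ forall u, M u -> N (phi u),
      forall u v, M u -> M v -> phi (u + v) = phi u + phi v &
      forall a u, L a -> M u -> phi (a *: u) = a *: phi u].

Definition homog_hom (d : int) (phi : U -> V) : Prop :=
  linear_on phi /\ (forall i u, M u -> hpart M i u -> hpart N (i + d) (phi u)).

(* The elements of the graded Hom module: finite sums of homogeneous maps. *)
Definition graded_hom (phi : U -> V) : Prop :=
  exists m (d : 'I_m -> int) (psi : 'I_m -> U -> V),
    (forall k, homog_hom (d k) (psi k)) /\
    (forall u, M u -> phi u = \sum_(k < m) psi k u).

End GradedModules.

Section Scheme.
Variables (K : fieldType) (n : nat).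
Local Notation P := {mpoly K[n.+1]}.

Definition homogeneous_ideal (I : {pred P}) : Prop :=
  forall (F : P) (d : nat), F \in I -> pihomog mdeg d F \in I.

Definition saturated (I : {pred P}) : Prop :=
  forall F : P,
    (exists N : nat, forall G : P, G \is N.-homog -> G * F \in I) -> F \in I.

(* Closed subschemes of P^n are represented by their saturated homogeneous
   vanishing ideals, and points by homogeneous primes. *)
Definition subscheme_ideal (I : ideal P) : Prop :=
  homogeneous_ideal I /\ saturated I.

Definition point (p : prime_idealr P) : Prop :=
  homogeneous_ideal p /\ (exists i, 'X_i \notin p).

Definition closed_point (p : prime_idealr P) : Prop :=
  point p /\
  (forall q : prime_idealr P, point q -> {subset p <= q} -> {subset q <= p}).

Definition zero_dimensional (I : ideal P) : Prop :=
  (exists p : prime_idealr P, point p /\ {subset I <= p}) /\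
  (forall p : prime_idealr P, point p -> {subset I <= p} -> closed_point p).

Definition support_enum (I : ideal P) (s : nat) (p : 'I_s -> prime_idealr P) :=
  [/\ forall j, closed_point (p j) /\ {subset I <= p j},
      forall q : prime_idealr P, closed_point q -> {subset I <= q} ->
        exists j, p j =i q &
      forall j k, p j =i p k -> j = k].

Definition coord_ring (I : ideal P) := quotring I.
HB.instance Definition _ (I : ideal P) := GRing.ComPzRing.on (coord_ring I).

Definition coord (I : ideal P) (F : P) : coord_ring I := quotmap I F.
Definition const (I : ideal P) (c : K) : coord_ring I := coord I c%:MP.
Definition x0 (I : ideal P) : coord_ring I := coord I 'X_ord0.

Definition homog_poly (i : int) (F : P) : Prop :=
  if i is Posz d then F \is d.-homog else F = 0.

Definition coord_deg (I : ideal P) (i : int) (f : coord_ring I) : Prop :=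
  exists2 F, homog_poly i F & f = coord I F.

(* The homogeneous maximal ideal of the coordinate ring. *)
Definition irrelevant (I : ideal P) (f : coord_ring I) : Prop :=
  exists2 F : P, F@_0%MM = 0 & f = coord I F.

Definition HF (I : ideal P) (i : int) : nat :=
  dim_mod (const I) (coord_deg i) (fun f => f = 0).

Section Stalk.
Variables (I : ideal P) (p : prime_idealr P).

Definition stalk_denom : {pred coord_ring I} := fun f =>
  `[< exists F d, [/\ F \is d.-homog, F \notin p & f = coord I F] >].

Fact stalk_denom_closed : mulr_closed stalk_denom.
Proof.
split=> [|_ _ /asboolP[F [d [hF pF ->]]] /asboolP[G [e [hG pG ->]]]].
  by apply/asboolP; exists 1, 0%N; rewrite dhomog1 idealr1 /coord rmorph1.
apply/asboolP; exists (F * G), (d + e)%N.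
rewrite dhomogM // prime_idealrM negb_or pF pG; split=> //.
by rewrite /coord rmorphM.
Qed.

HB.instance Definition _ :=
  GRing.isMulClosed.Build (coord_ring I) stalk_denom stalk_denom_closed.

Definition stalk_pred : {pred loc stalk_denom} := fun x =>
  `[< exists F G d, [/\ F \is d.-homog, G \is d.-homog, G \notin p &
        x = fraction stalk_denom (coord I F) (coord I G)] >].

Fact stalk_pred_closed : subring_closed stalk_pred.
Proof.
have dP G d : G \is d.-homog -> G \notin p -> coord I G \in stalk_denom.
  by move=> hG pG; apply/asboolP; exists G, d.
have fE (f g : coord_ring I) (gS : g \in stalk_denom) :
    fraction stalk_denom f g = frac f (exist _ g gS).
  by rewrite /fraction; congr frac; apply: val_inj; rewrite insubdK.
split.
- apply/asboolP; exists 1, 1, 0%N; rewrite dhomog1 idealr1; split=> //.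
  rewrite fE; first by apply: (dP _ 0%N); rewrite ?dhomog1 ?idealr1.
  by move=> h; apply: frac_eq; rewrite /= /coord rmorph1 mulr1.
- move=> _ _ /asboolP[F [G [d [hF hG pG ->]]]] /asboolP[F' [G' [e [hF' hG' pG' ->]]]].
  apply/asboolP; exists (F * G' - F' * G), (G * G'), (d + e)%N.
  have pGG : G * G' \notin p by rewrite prime_idealrM negb_or pG pG'.
  split=> //; try exact: dhomogM.
    by apply: rpredB; [exact: dhomogM | rewrite addnC; exact: dhomogM].
  rewrite (fE _ _ (dP _ _ hG pG)) (fE _ _ (dP _ _ hG' pG')).
  rewrite (fE _ _ (dP _ _ (dhomogM hG hG') pGG)).
  rewrite [- frac _ _]frac_opp [LHS]frac_add; apply: frac_eq => /=.
  by rewrite /coord rmorphB !rmorphM /=; ring.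
- move=> _ _ /asboolP[F [G [d [hF hG pG ->]]]] /asboolP[F' [G' [e [hF' hG' pG' ->]]]].
  apply/asboolP; exists (F * F'), (G * G'), (d + e)%N.
  have pGG : G * G' \notin p by rewrite prime_idealrM negb_or pG pG'.
  split=> //; try exact: dhomogM.
  rewrite (fE _ _ (dP _ _ hG pG)) (fE _ _ (dP _ _ hG' pG')).
  rewrite (fE _ _ (dP _ _ (dhomogM hG hG') pGG)).
  rewrite [LHS]frac_mul; apply: frac_eq => /=.
  by rewrite /coord !rmorphM.
Qed.

HB.instance Definition _ :=
  GRing.isSubringClosed.Build (loc stalk_denom) stalk_pred stalk_pred_closed.

(* The local ring at [p] of the subscheme defined by [I], i.e. the homogeneous
   localization of P/I at [p]; it is the zero ring if [p] does not contain [I]. *)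
Definition stalk := {x : loc stalk_denom | x \in stalk_pred}.
HB.instance Definition _ := SubType.on stalk.
HB.instance Definition _ := SubChoice.on stalk.
HB.instance Definition _ := GRing.SubChoice_isSubComPzRing.Build
  (loc stalk_denom) stalk_pred stalk stalk_pred_closed.

(* [f / g] for forms [f], [g] of the same degree with [g] outside [p]. *)
Definition stalk_frac (f g : coord_ring I) : stalk :=
  insubd 0 (fraction stalk_denom f g).

(* The germ at [p] of a form of degree [i], provided that [p] is not on the
   hyperplane X_0 = 0. *)
Definition germ (i : nat) (f : coord_ring I) : stalk := stalk_frac f (x0 I ^+ i).

Definition stalk_const (c : K) : stalk := germ 0 (const I c).

Definition stalk_dim : nat :=
  dim_mod stalk_const (fun _ => True) (fun a => a = 0).

Definition residue_basis (d : nat) (e : 'I_d -> stalk) : Prop :=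
  basis_mod stalk_const (fun _ => True) (@nonunit stalk) e.

Definition residue_dim : nat :=
  dim_mod stalk_const (fun _ => True) (@nonunit stalk).

End Stalk.

(* The canonical map between local rings at [p], for [I] contained in [J]. *)
Definition stalk_res (I J : ideal P) (p : prime_idealr P) (a : stalk I p) :
    stalk J p :=
  stalk_frac p (coord J (repr (numer (val a))))
               (coord J (repr (val (denomi (val a))))).

Section Invariants.
Variables (I : ideal P) (s : nat) (p : 'I_s -> prime_idealr P).

Definition degree (J : ideal P) : nat := \sum_(j < s) stalk_dim J (p j).

(* The least such integer is never negative: [HF] vanishes in negative degrees
   while the degree of a nonempty scheme is positive. *)
Definition reg_index : nat :=
  least (fun r => forall i : nat, (r <= i)%N -> HF I i%:Z = degree I).

Definition Delta : int := (degree I)%:Z - (HF I (reg_index%:Z - 1))%:Z.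

Definition max_subscheme (j : 'I_s) (J : ideal P) : Prop :=
  [/\ subscheme_ideal J,
      {subset I <= J},
      forall k, k != j -> bijective (@stalk_res I J (p k)),
      forall b, exists a, @stalk_res I J (p j) a = b &
      (degree J + residue_dim I (p j) = degree I)%N].

(* Via germs, R embeds into the product of the O_(p_k)[T_k, T_k^-1], a form of
   degree i going to (f_(p_k) T_k^i)_k; [mu j a] is the least i such that the
   element with j-th entry a T_j^i and zeros elsewhere lies in the image. *)
Definition mu (j : 'I_s) (a : stalk I (p j)) : nat :=
  least (fun i => exists f : coord_ring I,
    [/\ coord_deg i%:Z f, germ (p j) i f = a &
        forall k, k != j -> germ (p k) i f = 0]).

(* [m] is mu_{Y/X} for the maximal p_j-subscheme Y defined by [J]. *)
Definition mu_subscheme (j : 'I_s) (J : ideal P) (m : nat) : Prop :=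
  exists (sj : stalk I (p j)) (e : 'I_(residue_dim I (p j)) -> stalk I (p j)),
    [/\ sj <> 0 /\ (forall a, nonunit a -> a * sj = 0),
        forall a, stalk_res J a = 0 <-> exists b, a = b * sj,
        residue_basis e &
        m = (\max_k mu (e k * sj)%R)%N].

Definition point_degree (j : 'I_s) : nat :=
  least (fun m => exists J : ideal P, max_subscheme j J /\ mu_subscheme j J m).

Definition cayley_bacharach : Prop := forall j, point_degree j = reg_index.

End Invariants.

Section Complementary.
Variable I : ideal P.
Local Notation R := (coord_ring I).

Definition homog_nzd : {pred R} := fun g =>
  `[< (exists d, coord_deg d g) /\ (forall f, g * f = 0 -> f = 0) >].

Fact homog_nzd_closed : mulr_closed homog_nzd.
Proof.
split=> [|_ _ /asboolP[[d [F hF ->]] nF] /asboolP[[e [G hG ->]] nG]].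
  apply/asboolP; split=> [|f]; last by rewrite mul1r.
  by exists 0, 1; rewrite /= ?dhomog1 // /coord rmorph1.
apply/asboolP; split; last by move=> f; rewrite -mulrA => /nF /nG.
case: d e hF hG => [d|d] [e|e] hF hG; last 3 first.
- by exists (Negz e), 0; rewrite // (hG : G = 0) /coord rmorph0 mulr0.
- by exists (Negz d), 0; rewrite // (hF : F = 0) /coord rmorph0 mul0r.
- by exists (Negz d), 0; rewrite // (hF : F = 0) /coord rmorph0 mul0r.
by exists (d + e)%N%:Z, (F * G); [apply: dhomogM | rewrite /coord rmorphM].
Qed.

HB.instance Definition _ :=
  GRing.isMulClosed.Build R homog_nzd homog_nzd_closed.

Definition Qh := loc homog_nzd.
HB.instance Definition _ := GRing.ComPzRing.on Qh.
HB.instance Definition _ := GRing.Lmodule.on Qh.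

Definition Qfrac (f g : R) : Qh := fraction homog_nzd f g.

Definition Qh_deg (d : int) (q : Qh) : Prop :=
  exists (i j : nat) (f g : R),
    [/\ coord_deg i%:Z f, coord_deg j%:Z g, g \in homog_nzd,
        i%:Z - j%:Z = d & q = Qfrac f g].

(* The subrings K[x_0] of R and L_0 = K[x_0, x_0^-1] of the localization. *)
Definition Kx0 (a : R) : Prop :=
  exists q : {poly K}, a = \sum_(i < size q) const I q`_i * x0 I ^+ i.

Definition L0 (a : Qh) : Prop :=
  exists (b : R) (k : nat), Kx0 b /\ a = Qfrac b (x0 I ^+ k).

Definition gR : graded R^o := Graded (fun _ : R^o => True) (@coord_deg I).
Definition gKx0 : graded R^o :=
  Graded (Kx0 : R^o -> Prop) (fun i (a : R^o) => Kx0 a /\ coord_deg i a).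
Definition gQ : graded Qh^o := Graded (fun _ : Qh^o => True) Qh_deg.
Definition gL0 : graded Qh^o :=
  Graded (L0 : Qh^o -> Prop) (fun i (a : Qh^o) => L0 a /\ Qh_deg i a).

(* A homogeneous trace map of degree zero; (g sigma)(h) = sigma (g h). *)
Definition trace_map (sigma : Qh^o -> Qh^o) : Prop :=
  homog_hom L0 gQ gL0 0 sigma /\
  (forall psi : Qh^o -> Qh^o, graded_hom L0 gQ gL0 psi ->
     exists! g : Qh, forall h : Qh, psi h = sigma (g * h)).

Variable sigma : Qh^o -> Qh^o.

(* [g] such that g sigma is the L_0-linear extension
   f / x_0^k |-> phi f / x_0^k of some [phi]. *)
Definition complementary (g : Qh) : Prop :=
  exists phi : R^o -> R^o, graded_hom Kx0 gR gKx0 phi /\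
    (forall (f : R) (k : nat),
       sigma (g * Qfrac f (x0 I ^+ k)) = Qfrac (phi f) (x0 I ^+ k)).

Definition gC : graded Qh :=
  Graded complementary (fun i g => complementary g /\ Qh_deg i g).

Definition trace_ideal (f : R) : Prop :=
  exists m (phi : 'I_m -> Qh -> R^o) (c : 'I_m -> Qh),
    [/\ forall k, graded_hom (fun _ => True) gC gR (phi k),
        forall k, complementary (c k) & f = \sum_(k < m) phi k (c k)].

Definition nearly_gorenstein : Prop :=
  forall f : R, irrelevant f -> trace_ideal f.

Definition graded_module (M : lmodType R) (g : int -> M -> Prop) : Prop :=
  [/\ forall i, g i 0 /\ (forall u v, g i u -> g i v -> g i (u - v)),
      forall i j (f : R) u, coord_deg i f -> g j u -> g (i + j) (f *: u),
      forall u, exists m (d : 'I_m -> int) (v : 'I_m -> M),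
        (forall k, g (d k) (v k)) /\ u = \sum_(k < m) v k &
      forall m (d : 'I_m -> int) (v : 'I_m -> M), injective d ->
        (forall k, g (d k) (v k)) -> \sum_(k < m) v k = 0 ->
        forall k, v k = 0].

(* There is an exact sequence 0 -> R -> C(-r) -> M -> 0 of graded modules with
   degree-zero maps and with M annihilated by the irrelevant ideal. *)
Definition almost_gorenstein (r : nat) : Prop :=
  exists (M : lmodType R) (g : int -> M -> Prop)
         (theta : R^o -> Qh) (pi : Qh -> M),
    let gCr := shift gC (- r%:Z) in
    let gM := Graded (fun _ : M => True) g in
    [/\ graded_module g,
        homog_hom (fun _ => True) gR gCr 0 theta /\
        homog_hom (fun _ => True) gCr gM 0 pi,
        injective theta,
        (forall c, gCr c -> (pi c = 0 <-> exists f, theta f = c)) /\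
        (forall u, exists2 c, gCr c & pi c = u) &
        forall (f : R) (u : M), irrelevant f -> f *: u = 0].

End Complementary.

End Scheme.

(* Main.v *)
(* Write S for the degree-zero part of Q^h(R), so that Q^h(R) = S[x_0, 1/x_0] and R_i is
   a subspace F_i x_0^i with F_i increasing to S. A trace map is a linear form tau on S
   such that (a, b) |-> tau (a b) is nondegenerate and represents all linear forms; a
   diagonal argument shows that this forces dim S to be finite. The points of the scheme
   split S into its local components, so deg(X) = dim S, F_i = S for i >= r, and
   Delta = 1 says that F_(r-1) is the kernel of tau (omega * _) for some omega. In degree d
   the complementary module C is the annihilator of F_(-d-1) times x_0^d; hence it
   vanishes below -r, and C_(-r) is spanned by c_0 = omega / x_0^r.

   A socle element s_j has its ideal inside F_(r-1) iff omega s_j = 0, so X is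
   Cayley-Bacharach iff omega is a unit. A degree-zero embedding of R into C(-r) is
   multiplication by a multiple w of c_0, it is injective iff w is a unit, and its cokernel
   is killed by m iff m C <= R w; then m = m w / w lies in the trace of C. Conversely,
   let omega be a unit and m <= tr(C). Homomorphisms phi : C -> R satisfy
   phi(c) c_0 = phi(c_0) c, so phi(c_0) C <= R c_0, and comparing degrees in an expression
   of a linear form as a sum of values phi(c) leaves only multiples of elements phi(c_0). *)

From HB Require Import structures.
From mathcomp Require Import all_boot all_order all_algebra.
From mathcomp Require Import boolp classical_sets.
From mathcomp Require Import mpoly.
From mathcomp Require Import ring zify.
Require Import Defs.

Set Implicit Arguments.
Unset Strict Implicit.
Unset Printing Implicit Defensive.

Import GRing.Theory.

Local Open Scope ring_scope.

(** * Homogeneous prime ideals *)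

(** Zero-dimensionality is used in one algebraic form: each [a] in S satisfies a^k (1 - b a) = 0 for
    some k and [b] ([degree0_pow], which rests on [power_relation]). This gives denominators that
    are powers of x_0, inverses of non-zerodivisors, nilpotence of nonunits in the local components
    and idempotents separating the points. Each stalk thus becomes a quotient of S, and statements
    on points become statements on ideals of S. Finite dimension of S must be won from the trace map
    before anything can be counted, because [dim_mod] returns 0 for infinite dimension. What makes
    this possible is that every K-linear form on S extends to a graded map over L_0, which sigma has
    to represent. Both implications pass through the conductor of C into R c_0, the ideal of all f
    with f C <= R c_0. The obstacle in the harder one is a linear value phi(c) with c of degree
    above -r. There phi(c_0) is a constant: if it is nonzero, the conductor is all of R; if it is
    zero, so is phi(c). *)

Section PrimeAvoidance.
Variable A : comNzRingType.
Implicit Types (J M : A -> Prop).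

Definition is_ideal J : Prop :=
  [/\ J 0, forall u v, J u -> J v -> J (u + v) & forall a u, J u -> J (a * u)].

Lemma maximal_disjoint_ideal J M : is_ideal J -> (forall u, M u -> ~ J u) ->
  exists q, [/\ is_ideal q, forall u, J u -> q u, forall u, M u -> ~ q u &
    forall q', is_ideal q' -> (forall u, q u -> q' u) ->
      (forall u, M u -> ~ q' u) -> forall u, q' u -> q u].
Proof.
move=> [J0 JD JM] MJ.
(* Zorn is applied to the sets [X] for which [X \/ J] is an ideal missing [M]: the empty chain has
   empty union, which becomes an ideal only after [J] is added. *)
pose Z (X : set A) := is_ideal (fun u => X u \/ J u) /\
  (forall u, M u -> ~ (X u \/ J u)).
have [F FZ Ftot|X [ZX Xmax]] := @Zorn_bigcup A Z.
- split; last first.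
    move=> u Mu [[X FX Xu]|]; last exact: MJ.
    by have [_ /(_ u Mu)] := FZ X FX; apply; left.
  have FX2 X : F X -> is_ideal (fun u => X u \/ J u) by move=> /FZ[].
  split=> [|u v|a u].
  + by right.
  + case=> [[X FX Xu]|Ju] [[Y FY Yv]|Jv].
    * have [XY|YX] := Ftot _ _ FX FY.
        have [_ /(_ u v (or_introl (XY _ Xu)) (or_introl Yv))[?|?] _] := FX2 _ FY;
          [by left; exists Y|by right].
      have [_ /(_ u v (or_introl Xu) (or_introl (YX _ Yv)))[?|?] _] := FX2 _ FX;
          [by left; exists X|by right].
    * have [_ /(_ u v (or_introl Xu) (or_intror Jv))[?|?] _] := FX2 _ FX;
          [by left; exists X|by right].
    * have [_ /(_ u v (or_intror Ju) (or_introl Yv))[?|?] _] := FX2 _ FY;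
          [by left; exists Y|by right].
    * by right; apply: JD.
  + case=> [[X FX Xu]|Ju]; last by right; apply: JM.
    have [_ _ /(_ a u (or_introl Xu))[?|?]] := FX2 _ FX;
      [by left; exists X|by right].
- case: ZX => Xid XM; exists (fun u => X u \/ J u); split=> //.
    by move=> u Ju; right.
  move=> q' q'id Xq' Mq' u q'u; apply: contrapT => nXu.
  have /Xmax : (X `<` q')%classic.
    split=> [v Xv|q'X]; first by apply: Xq'; left.
    by apply: nXu; left; apply: q'X.
  apply; have E : (fun u => q' u \/ J u) = q'.
    apply/funext => v; apply/propext; split=> [[//|Jv]|]; last by left.
    by apply: Xq'; right.
  by split=> [|v Mv [/(Mq' v Mv)|/(MJ v Mv)]]; rewrite ?E.
Qed.

(** An ideal maximal among those missing a multiplicative set is prime: for u and v outside [q],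
    both q + (u) and q + (v) meet [M], and the product of the two elements found there lies in [q]
    as soon as u v does. *)
Lemma exists_prime_disjoint J M : is_ideal J -> M 1 ->
  (forall u v, M u -> M v -> M (u * v)) -> (forall u, M u -> ~ J u) ->
  exists q, [/\ is_ideal q, forall u, J u -> q u, forall u, M u -> ~ q u &
    forall u v, q (u * v) -> q u \/ q v].
Proof.
move=> Jid M1 MM MJ.
have [q [qid Jq Mq qmax]] := maximal_disjoint_ideal Jid MJ.
have [q0 qD qM] := qid.
exists q; split=> // u v quv; apply: contrapT => /not_orP[nu nv].
have adj w : ~ q w -> exists a m, M m /\ q (m - a * w).
  move=> nw; apply: contrapT => h; apply: nw.
  apply: (qmax (fun x => exists a y, q y /\ x = y + a * w)).
  - split=> [|_ _ [a [y [qy ->]]] [b [z [qz ->]]]|b _ [a [y [qy ->]]]].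
    + by exists 0, 0; rewrite mul0r addr0.
    + by exists (a + b), (y + z); split; [exact: qD|rewrite mulrDl addrACA].
    + by exists (b * a), (b * y); split; [exact: qM|rewrite mulrDr mulrA].
  - by move=> x qx; exists 0, x; rewrite mul0r addr0.
  - move=> x Mx [a [y [qy E]]]; apply: h; exists a, x; split=> //.
    by rewrite E addrK.
  - by exists 1, 0; rewrite add0r mul1r.
have [a [m [Mm qm]]] := adj u nu; have [b [l [Ml ql]]] := adj v nv.
apply: (Mq (m * l)); first exact: MM.
have -> : m * l = l * (m - a * u) + a * u * (l - b * v) + a * b * (u * v) by ring.
by apply: (qD); [apply: (qD)|]; apply: (qM).
Qed.

End PrimeAvoidance.

Section HomogeneousParts.
Variables (K : fieldType) (n : nat).
Local Notation P := {mpoly K[n.+1]}.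

(** The substitution X_i -> X_i T. It is a ring morphism whose T^d-coefficient is the part of degree
    d, so the product formula for homogeneous parts is that for coefficients of polynomials. *)
Definition grade_poly : P -> {poly P} :=
  mmap (polyC \o mpolyC n.+1 (R := K)) (fun i => 'X_i *: 'X).

Lemma coef_grade_poly F d : (grade_poly F)`_d = pihomog mdeg d F.
Proof.
rewrite /grade_poly /mmap pihomogE coef_sum [RHS]big_mkcond; apply: eq_bigr => m _.
have -> : mmap1 (fun i => 'X_i *: 'X : {poly P}) m = 'X_[m] *: 'X^(mdeg m).
  rewrite /mmap1; under eq_bigr do rewrite exprZn.
  by rewrite scaler_prod prodrXr -mdegE mpolyXE_id.
rewrite /= coefCM coefZ coefXn eq_sym mul_mpolyC.
by case: eqP => _; rewrite ?mulr1 ?mulr0 ?scaler0.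
Qed.

Implicit Types F G : P.

Lemma pihomogM d F G : pihomog mdeg d (F * G) =
  \sum_(i < d.+1) pihomog mdeg i F * pihomog mdeg (d - i) G.
Proof.
have E : grade_poly (F * G) = grade_poly F * grade_poly G by exact: rmorphM.
rewrite -coef_grade_poly E coefM; apply: eq_bigr => i _.
by congr (_ * _); apply: coef_grade_poly.
Qed.

Lemma pihomogMl d e F G : F \is d.-homog ->
  pihomog mdeg e (F * G) = if (d <= e)%N then F * pihomog mdeg (e - d) G else 0.
Proof.
move=> hF; rewrite pihomogM; case: leqP => [de|ed].
  rewrite (bigD1 (Ordinal (de : (d < e.+1)%N))) //= pihomog_dE // big1 ?addr0 //.
  move=> i ni; rewrite (@pihomog_ne0 _ _ _ d) ?mul0r //.
  by apply: contraNneq ni => E; apply/eqP/val_inj.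
apply: big1 => i _; rewrite (@pihomog_ne0 _ _ _ d) ?mul0r //.
by rewrite gtn_eqF // (leq_ltn_trans _ ed) // -ltnS.
Qed.

Lemma sum_pihomog F : exists N : nat, forall k, (N <= k)%N ->
  F = \sum_(d < k) pihomog mdeg d F.
Proof. by exists (msize F) => k hk; apply: pihomog_partitionE. Qed.

(** A prime [q] over [J] missing [M] need not be homogeneous, since [M] need not consist of forms.
    The polynomials all of whose homogeneous parts lie in [q] form a smaller ideal that still
    contains [J], misses [M] and is again prime. *)
Lemma exists_homogeneous_prime (J M : P -> Prop) :
  is_ideal J -> (forall F d, J F -> J (pihomog mdeg d F)) ->
  M 1 -> (forall u v, M u -> M v -> M (u * v)) -> (forall u, M u -> ~ J u) ->
  exists q : prime_idealr P,
    [/\ homogeneous_ideal q, forall F, J F -> F \in q &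
        forall F, M F -> F \notin q].
Proof.
move=> Jid Jh M1 MM MJ.
have [q [[q0 qD qM] Jq Mq qP]] := exists_prime_disjoint Jid M1 MM MJ.
have q1 : ~ q 1 by apply: Mq.
pose Q : pred P := fun F => `[< forall d, q (pihomog mdeg d F) >].
have qS (T : finType) (B : pred T) (f : T -> P) : (forall i, B i -> q (f i)) ->
    q (\sum_(i | B i) f i).
  by move=> h; elim/big_ind: _.
have Q1 : 1 \notin Q.
  by apply/asboolP => /(_ 0%N); rewrite pihomog_dE // dhomog1.
have Qc : idealr_closed Q.
  split=> //; first by apply/asboolP => d; rewrite raddf0.
  move=> a u v /asboolP hu /asboolP hv; apply/asboolP => d.
  by rewrite raddfD /= pihomogM; apply: qD => //; apply: qS => i _; apply: qM.
(* With i and j the lowest degrees in which F and G leave [q], the part of degree i + j of F G is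
   F_i G_j modulo [q]. *)
have Qp : prime_idealr_closed Q.
  move=> F G /asboolP hFG; apply/orP; apply: contrapT => /not_orP[].
  have ex H : ~ H \in Q -> exists2 i, ~ q (pihomog mdeg i H) &
      forall j, (j < i)%N -> q (pihomog mdeg j H).
    move=> nH; have [i ni] : exists i, ~ q (pihomog mdeg i H).
      by apply/existsNP => h; apply: nH; apply/asboolP.
    have ex : exists i, `[< ~ q (pihomog mdeg i H) >] by exists i; apply/asboolP.
    case: (ex_minnP ex) => m /asboolP nm mmin; exists m => // j jm.
    by apply: contrapT => nj; have := mmin j; rewrite leqNgt jm => /(_ (asboolT nj)).
  move=> /ex[i ni hi] /ex[j nj hj].
  have := hFG (i + j)%N; rewrite pihomogM.
  have lt : (i < (i + j).+1)%N by rewrite ltnS leq_addr.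
  rewrite (bigD1 (Ordinal lt)) //= addKn => h.
  have : q (pihomog mdeg i F * pihomog mdeg j G).
    set S := \sum_(_ < _ | _) _ in h.
    have qS' : q S.
      apply: qS => k nk; case: (ltnP k i) => ki; first by rewrite mulrC; apply/qM/hi.
      apply/qM/hj; have : k != i :> nat by [].
      have := ltn_ord k; lia.
    by rewrite -[_ * _](addrK S); apply: qD => //; rewrite -mulN1r; apply: qM.
  by case/qP.
pose q' : prime_idealr P :=
  HB.pack (Q : P -> bool) (isIdealr.Build P Q Qc) (isPrimeIdealrClosed.Build P Q Qp).
exists q'; split=> [F d FQ|F JF|F MF].
- apply/asboolP => e; have [->|ne] := eqVneq e d.
    by rewrite pihomog_id; exact: (asboolW FQ).
  by rewrite (pihomog_ne0 _ (pihomogP _ _ _)) // eq_sym.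
- by apply/asboolP => d; apply/Jq/Jh.
- apply/negP => /asboolP FQ; apply: (Mq F MF).
  by have [N /(_ N (leqnn _)) ->] := sum_pihomog F; apply: qS => i _.
Qed.

End HomogeneousParts.

(** * The coordinate ring *)

Section CoordinateRing.
Variables (K : fieldType) (n : nat) (I : ideal {mpoly K[n.+1]}).
Local Notation P := {mpoly K[n.+1]}.
Local Notation R := (coord_ring I).
Implicit Types (F G : P) (f g : R).

HB.instance Definition _ :=
  GRing.isZmodMorphism.Build P R (coord I) (quotmap_zmod I).
HB.instance Definition _ :=
  GRing.isMonoidMorphism.Build P R (coord I) (quotmap_monoid I).

Lemma coord0 : coord I 0 = 0.
Proof. exact: raddf0. Qed.

Lemma coordD F G : coord I (F + G) = coord I F + coord I G.
Proof. exact: raddfD. Qed.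

Lemma coordB F G : coord I (F - G) = coord I F - coord I G.
Proof. exact: raddfB. Qed.

Lemma coordM F G : coord I (F * G) = coord I F * coord I G.
Proof. exact: rmorphM. Qed.

Lemma coord_x0X k : coord I ('X_ord0 ^+ k) = x0 I ^+ k.
Proof. exact: rmorphXn. Qed.

Fact const_zmod : zmod_morphism (const I).
Proof. by move=> a b; rewrite /const !rmorphB. Qed.
Fact const_monoid : monoid_morphism (const I).
Proof. by split=> [|a b]; rewrite /const ?rmorph1 // !rmorphM. Qed.
HB.instance Definition _ := GRing.isZmodMorphism.Build K R (const I) const_zmod.
HB.instance Definition _ :=
  GRing.isMonoidMorphism.Build K R (const I) const_monoid.

Lemma coord_eq0 F : coord I F = 0 <-> F \in I.
Proof.
by rewrite -{2}[F]subr0; split=> [h|/quotmap_eqP h];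
   [apply/quotmap_eqP; rewrite [LHS]h|rewrite [LHS]h]; rewrite /quotmap raddf0.
Qed.

Lemma coord_surj f : exists F, f = coord I F.
Proof. by exists (repr f); rewrite /coord quotmap_repr. Qed.

Lemma ideal_mull F G : G \in I -> F * G \in I.
Proof. exact: mul_absorbing_subproof. Qed.

Lemma ideal_mulr F G : F \in I -> F * G \in I.
Proof. by rewrite mulrC; apply: ideal_mull. Qed.

Lemma coord_deg_neg d f : coord_deg (Negz d) f <-> f = 0.
Proof.
by split=> [[F /= -> ->]|->]; [rewrite raddf0|exists 0; rewrite ?raddf0].
Qed.

Lemma coord_deg0 (i : int) : coord_deg i (0 : R).
Proof. by case: i => d; exists 0; rewrite /= ?rpred0 ?raddf0. Qed.

Lemma coord_degD (i : int) f g : coord_deg i f -> coord_deg i g -> coord_deg i (f + g).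
Proof.
case: i => d; last by rewrite !coord_deg_neg => -> ->; rewrite addr0.
move=> [F hF ->] [G hG ->]; exists (F + G); last by rewrite raddfD.
exact: rpredD.
Qed.

Lemma coord_degM_nat (d e : nat) f g :
  coord_deg d%:Z f -> coord_deg e%:Z g -> coord_deg (d + e)%N%:Z (f * g).
Proof.
move=> [F hF ->] [G hG ->]; exists (F * G); last by rewrite rmorphM.
exact: dhomogM.
Qed.

Lemma coord_degM (i j : int) f g :
  coord_deg i f -> coord_deg j g -> coord_deg (i + j) (f * g).
Proof.
case: i => d; last by rewrite coord_deg_neg => -> _; rewrite mul0r; apply: coord_deg0.
case: j => e; last by rewrite coord_deg_neg => _ ->; rewrite mulr0; apply: coord_deg0.
exact: coord_degM_nat.
Qed.

Lemma coord_deg_const c : coord_deg 0 (const I c).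
Proof. by exists c%:MP => //=; rewrite -[c%:MP]mulr1 mul_mpolyC; apply: dhomogZ; apply: dhomog1. Qed.

Lemma coord_degZ (i : int) c f : coord_deg i f -> coord_deg i (const I c * f).
Proof. by move=> hf; rewrite -[i]add0r; apply: coord_degM => //; apply: coord_deg_const. Qed.

Lemma coord_degN (i : int) f : coord_deg i f -> coord_deg i (- f).
Proof. by move=> /(coord_degZ (-1)); rewrite rmorphN1 mulN1r. Qed.

Lemma coord_degB (i : int) f g : coord_deg i f -> coord_deg i g -> coord_deg i (f - g).
Proof. by move=> hf hg; apply/coord_degD/coord_degN. Qed.

Lemma coord_deg_sum (T : Type) (r : seq T) (Q : pred T) (F : T -> R) (i : int) :
  (forall k, Q k -> coord_deg i (F k)) -> coord_deg i (\sum_(k <- r | Q k) F k).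
Proof.
by move=> h; elim/big_ind: _ => //; [apply: coord_deg0|apply: coord_degD].
Qed.

Lemma coord_degX (m : 'X_{1..n.+1}) : coord_deg (mdeg m)%:Z (coord I 'X_[m]).
Proof. by exists 'X_[m]; rewrite //= dhomogX. Qed.

Lemma coord_deg_x0 d : coord_deg d%:Z (x0 I ^+ d).
Proof.
exists ('X_ord0 ^+ d); last by rewrite rmorphXn.
have h : ('X_ord0 : P) \is 1.-homog by rewrite dhomogX /=; apply/eqP/mdeg1.
by have := dhomogMn d h; rewrite mul1n.
Qed.

Lemma coord_deg1 : coord_deg 0 (1 : R).
Proof. exact: (coord_deg_x0 0). Qed.

Lemma coord_degMx0 (d : nat) e f : coord_deg d%:Z f -> coord_deg (d + e)%N%:Z (f * x0 I ^+ e).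
Proof. by move=> hf; apply: coord_degM_nat => //; apply: coord_deg_x0. Qed.

Hypothesis Ihom : homogeneous_ideal I.

Definition prj d f : R := coord I (pihomog mdeg d (repr f)).

Lemma prj_coord d F : prj d (coord I F) = coord I (pihomog mdeg d F).
Proof.
apply/quotmap_eqP; rewrite -raddfB /=; apply: Ihom.
by apply/quotmap_eqP; exact: quotmap_repr.
Qed.

Fact prj_zmod d : zmod_morphism (prj d).
Proof.
move=> f g; have [F ->] := coord_surj f; have [G ->] := coord_surj g.
by rewrite -raddfB /= !prj_coord !raddfB.
Qed.
HB.instance Definition _ d := GRing.isZmodMorphism.Build R R (prj d) (prj_zmod d).

Lemma prj_sum d (T : Type) (r : seq T) (B : pred T) (F : T -> R) :
  prj d (\sum_(i <- r | B i) F i) = \sum_(i <- r | B i) prj d (F i).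
Proof. exact: raddf_sum. Qed.

Lemma prj_deg d f : coord_deg d%:Z (prj d f).
Proof. by exists (pihomog mdeg d (repr f)); rewrite //= pihomogP. Qed.

Lemma prj_id d f : coord_deg d%:Z f -> prj d f = f.
Proof. by move=> [F hF ->]; rewrite prj_coord pihomog_dE. Qed.

Lemma prj_ne d (i : int) f : coord_deg i f -> i != d%:Z -> prj d f = 0.
Proof.
case: i => e; last by rewrite coord_deg_neg => ->; rewrite raddf0.
by move=> [F hF ->] ne; rewrite prj_coord (@pihomog_ne0 _ _ _ e) ?raddf0.
Qed.

Lemma prjMl d e f g : coord_deg d%:Z f ->
  prj e (f * g) = if (d <= e)%N then f * prj (e - d) g else 0.
Proof.
move=> [F hF ->]; have [G ->] := coord_surj g.
rewrite -rmorphM !prj_coord (pihomogMl _ _ hF); case: ifP => _; last by rewrite raddf0.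
by rewrite rmorphM.
Qed.

Lemma sum_prj f : exists N : nat, forall k, (N <= k)%N -> f = \sum_(d < k) prj d f.
Proof.
have [F ->] := coord_surj f; have [N hN] := sum_pihomog F; exists N => k Nk.
by rewrite {1}(hN k Nk) raddf_sum; apply: eq_bigr => d _; rewrite prj_coord.
Qed.

Lemma coord_deg_ind (Q : R -> Prop) : Q 0 -> (forall f g, Q f -> Q g -> Q (f + g)) ->
  (forall (d : nat) f, coord_deg d%:Z f -> Q f) -> forall f, Q f.
Proof.
move=> Q0 QD Qd f; have [N /(_ N (leqnn _)) ->] := sum_prj f.
by elim/big_ind: _ => // d _; apply: (Qd d); apply: prj_deg.
Qed.

End CoordinateRing.

Lemma monomial_large_exponent n (N : 'I_n -> nat) (m : 'X_{1..n}) :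
  (\sum_i N i < mdeg m)%N -> exists i, (N i <= m i)%N.
Proof.
move=> h; apply: contrapT => /forallNP no; move: h; rewrite ltnNge => /negP; apply.
rewrite mdegE; apply: leq_sum => i _; apply: ltnW; rewrite ltnNge; exact/negP/no.
Qed.

Section PowersOfX0.
Variables (K : fieldType) (n : nat) (I : ideal {mpoly K[n.+1]}).
Hypothesis nzd : forall f : coord_ring I, x0 I * f = 0 -> f = 0.

Lemma x0X_nzd k (f : coord_ring I) : x0 I ^+ k * f = 0 -> f = 0.
Proof. by elim: k => [|k IH]; rewrite ?mul1r // exprS -mulrA => /nzd/IH. Qed.

End PowersOfX0.

(** * Points of the scheme and pi-regularity *)

Section Points.
Variables (K : fieldType) (n : nat) (I : ideal {mpoly K[n.+1]}).
Local Notation P := {mpoly K[n.+1]}.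
Local Notation R := (coord_ring I).
Implicit Types (F G : P) (f g : R).
Hypotheses (hI : subscheme_ideal I) (hdim : zero_dimensional I).
Variables (s : nat) (p : 'I_s -> prime_idealr P).
Hypotheses (hp : support_enum I p) (hX0 : forall j, 'X_ord0 \notin p j).
Let Ihom := hI.1.

Lemma prime_idealX (q : prime_idealr P) F k : F ^+ k \in q -> F \in q.
Proof.
elim: k => [|k IH]; first by rewrite expr0 idealr1.
by rewrite exprS prime_idealrM => /orP[].
Qed.

(** A projective Nullstellensatz: a homogeneous prime over [J] avoiding the powers of X_i is a
    point, hence closed because the scheme is zero-dimensional, hence one of the [p j]. *)
Lemma ideal_vanishes_at_point (J : P -> Prop) i :
  is_ideal J -> (forall F d, J F -> J (pihomog mdeg d F)) ->
  {in I, forall F, J F} -> (forall k, ~ J ('X_i ^+ k)) ->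
  exists j, 'X_i \notin p j /\ forall F, J F -> F \in p j.
Proof.
move=> Jid Jh IJ JX.
pose M F := exists k, F = 'X_i ^+ k.
have M1 : M 1 by exists 0%N.
have MM u v : M u -> M v -> M (u * v).
  by move=> [k ->] [l ->]; exists (k + l)%N; rewrite exprD.
have MJ u : M u -> ~ J u by move=> [k ->].
have [q [qh Jq Xq]] := exists_homogeneous_prime Jid Jh M1 MM MJ.
have Xqi : 'X_i \notin q by apply: Xq; exists 1%N.
have qpt : point q by split; [|exists i].
have qI : {subset I <= q} by move=> F /IJ/Jq.
have qc := hdim.2 q qpt qI.
have [_ /(_ q qc qI)[j pq] _] := hp.
by exists j; split=> [|F /Jq]; rewrite pq.
Qed.

Lemma one_notin_ideal : 1 \notin I.
Proof.
have [[q [qpt Iq]] _] := hdim.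
by apply/negP => /Iq; rewrite idealr1.
Qed.

Lemma coord_ring_neq0 : (1 : R) <> 0.
Proof.
by rewrite -(rmorph1 (coord I)) => /coord_eq0; apply/negP/one_notin_ideal.
Qed.

(** For a form F with X_0 F in I, the ideal (I : F) contains X_0 and so lies in no [p j]. It
    therefore contains a power of every variable, hence all forms of large degree, and saturation
    puts F into I. *)
Lemma x0_nzd f : x0 I * f = 0 -> f = 0.
Proof.
have [F ->] := coord_surj f; rewrite -rmorphM => /coord_eq0 h; apply/coord_eq0.
have X1 : ('X_ord0 : P) \is 1.-homog by rewrite dhomogX /=; apply/eqP/mdeg1.
suff hom d : pihomog mdeg d F \in I.
  by have [N /(_ N (leqnn _)) ->] := sum_pihomog F; apply: rpred_sum => i _.
have {h} : 'X_ord0 * pihomog mdeg d F \in I.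
  by have := Ihom d.+1 h; rewrite (pihomogMl _ _ X1) /= subn1.
have := pihomogP mdeg d F; move: (pihomog _ _ _) => {F} F hF h.
pose J G := G * F \in I.
have Jid : is_ideal J.
  split=> [|u v|a u]; rewrite /J; first by rewrite mul0r rpred0.
  + by move=> uF vF; rewrite mulrDl; apply: rpredD.
  + by rewrite -mulrA; apply: ideal_mull.
have Jh G e : J G -> J (pihomog mdeg e G).
  rewrite /J [G * F]mulrC => /(Ihom (d + e)).
  by rewrite (pihomogMl _ _ hF) leq_addr addKn mulrC.
have IJ : {in I, forall G, J G} by move=> G GI; apply: ideal_mulr.
have pow i : exists k, J ('X_i ^+ k).
  apply: contrapT => /forallNP nJ.
  have [j [_ /(_ _ h)]] := ideal_vanishes_at_point Jid Jh IJ nJ.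
  by rewrite (negPf (hX0 j)).
have [N hN] := choice pow.
apply: hI.2; exists (\sum_i N i).+1 => G /dhomogP hG.
rewrite [G]mpolyE mulr_suml big_seq; apply: rpred_sum => m mG.
have [i Ni] : exists i, (N i <= m i)%N.
  by apply: monomial_large_exponent; rewrite (hG _ mG).
rewrite -mul_mpolyC -mulrA; apply: ideal_mull.
have -> : m = (U_(i) *+ N i + (m - U_(i) *+ N i))%MM.
  by apply/mnmP => k; rewrite !(mnmDE, mnmBE, mulmnE, mnm1E); case: eqP => [<-|]; lia.
by rewrite mpolyXD mulrAC -mpolyXn; apply: ideal_mulr; apply: hN.
Qed.

Lemma X0X_homog k : ('X_ord0 ^+ k : P) \is k.-homog.
Proof.
have X1 : ('X_ord0 : P) \is 1.-homog by rewrite dhomogX /=; apply/eqP/mdeg1.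
by have := dhomogMn k X1; rewrite mul1n.
Qed.

(* Otherwise two nested points, separated by [g], would contain [I]. *)
Lemma power_relation d g : coord_deg d%:Z g -> exists k m b,
  coord_deg m%:Z b /\ g ^+ k * (x0 I ^+ (m + d) - b * g) = 0.
Proof.
move=> [G hG ->].
(* A prime [q] missing this multiplicative set contains neither X_0 nor G, and q + (G) contains no
   power of X_0; a point above q + (G) then contradicts the closedness of [q]. *)
pose M F := exists a k c B, B * G \is c.-homog /\
  F = 'X_ord0 ^+ a * G ^+ k * ('X_ord0 ^+ c - B * G).
have M1 : M 1.
  exists 0%N, 0%N, 0%N, 0; rewrite mul0r subr0 !expr0 !mulr1.
  by split=> //; apply: rpred0.
have MM u v : M u -> M v -> M (u * v).
  move=> [a [k [c [B [hB ->]]]]] [a' [k' [c' [B' [hB' ->]]]]].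
  exists (a + a')%N, (k + k')%N, (c + c')%N,
    ('X_ord0 ^+ c * B' + 'X_ord0 ^+ c' * B - B * B' * G); split; last first.
    by rewrite !exprD; ring.
  rewrite !(mulrDl, mulNr) -!mulrA; apply: rpredB; first apply: rpredD.
  - by apply: dhomogM => //; apply: X0X_homog.
  - by rewrite addnC; apply: dhomogM => //; apply: X0X_homog.
  - by rewrite (_ : B * _ = (B * G) * (B' * G)); [apply: dhomogM|ring].
have [|MI] := pselect (exists u, M u /\ u \in I).
  move=> [_ [[a [k [c [B [hB ->]]]]]]] hI0.
  have {hI0} : coord I G ^+ k * (x0 I ^+ c - coord I (B * G)) = 0.
    apply: (@x0X_nzd _ _ _ x0_nzd a); rewrite mulrA -!rmorphXn -!(rmorphB, rmorphM) /=.
    exact/coord_eq0.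
  (* Only B G is known to be a form, so [B] is replaced by its part of degree c - d. For c < d the
     product B G vanishes, and then G^k is zero in R. *)
  rewrite -(pihomog_dE hB) [B * G]mulrC (pihomogMl _ _ hG); case: leqP => dc h.
    exists k, (c - d)%N, (coord I (pihomog mdeg (c - d) B)); split.
      by exists (pihomog mdeg (c - d) B) => //; apply: pihomogP.
    by rewrite subnK // [coord I _ * _]mulrC -rmorphM.
  exists k, 0%N, 0; split; first exact: coord_deg0.
  rewrite mul0r subr0; move: h; rewrite raddf0 subr0 mulrC => /(x0X_nzd x0_nzd) ->.
  by rewrite mul0r.
have MI' u : M u -> ~ u \in I by move=> Mu uI; apply: MI; exists u.
have Iid : is_ideal (fun F => F \in I).
  by split=> [|u v|a u]; [exact: rpred0|exact: rpredD|exact: ideal_mull].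
have Ih F e : F \in I -> pihomog mdeg e F \in I by apply: Ihom.
have [q [qh Iq Mq]] := exists_homogeneous_prime Iid Ih M1 MM MI'.
have Xq : 'X_ord0 \notin q.
  apply: Mq; exists 1%N, 0%N, 0%N, 0; rewrite mul0r subr0 !expr0 !mulr1.
  by split=> //; apply: rpred0.
have Gq : G \notin q.
  apply: Mq; exists 0%N, 1%N, 0%N, 0; rewrite mul0r subr0 !expr0 mul1r mulr1.
  by split=> //; apply: rpred0.
have Bq c B : B * G \is c.-homog -> 'X_ord0 ^+ c - B * G \notin q.
  by move=> hB; apply: Mq; exists 0%N, 0%N, c, B; rewrite !expr0 !mul1r.
have qpt : point q by split=> //; exists ord0.
have qc := hdim.2 q qpt Iq.
pose J F := exists u B, u \in q /\ F = u + B * G.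
have Jid : is_ideal J.
  split=> [|_ _ [u [B [uq ->]]] [v [C [vq ->]]]|a _ [u [B [uq ->]]]].
  - by exists 0, 0; rewrite rpred0 mul0r addr0.
  - by exists (u + v), (B + C); rewrite rpredD // mulrDl addrACA.
  - by exists (a * u), (a * B); rewrite idealMr // mulrDr mulrA.
have Jh F e : J F -> J (pihomog mdeg e F).
  move=> [u [B [uq ->]]]; rewrite raddfD /= [B * G]mulrC (pihomogMl _ _ hG).
  exists (pihomog mdeg e u), (if (d <= e)%N then pihomog mdeg (e - d) B else 0).
  by split; [exact: qh|case: ifP; rewrite ?mul0r // mulrC].
have IJ : {in I, forall F, J F}.
  by move=> F FI; exists F, 0; rewrite mul0r addr0; split=> //; apply: Iq.
have JX k : ~ J ('X_ord0 ^+ k).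
  move=> [u [B [uq E]]].
  have := congr1 (pihomog mdeg k) E; rewrite pihomog_dE ?X0X_homog // raddfD /=.
  move=> E'; have : pihomog mdeg k u \in q by apply: qh.
  rewrite [B * G]mulrC (pihomogMl _ _ hG) in E'; case: ifP E' => dk E'.
    have -> : pihomog mdeg k u = 'X_ord0 ^+ k - pihomog mdeg (k - d) B * G.
      by rewrite E' [_ * G]mulrC addrK.
    apply/negP/Bq; rewrite -(subnK dk); apply: dhomogM => //.
    by rewrite subnK //; apply: pihomogP.
  by rewrite -[pihomog _ _ _]addr0 -E' => /prime_idealX; apply/negP.
have [j [Xj Jj]] := ideal_vanishes_at_point Jid Jh IJ JX.
have [[jpt _] _] : closed_point (p j) /\ {subset I <= p j} by case: hp.
have qj : {subset q <= p j}.
  by move=> F Fq; apply: Jj; exists F, 0; rewrite mul0r addr0.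
have := qc.2 (p j) jpt qj G; rewrite (negPf Gq); case/(_ _)/negP => //.
by apply: Jj; exists 0, 1; rewrite rpred0 add0r mul1r.
Qed.

End Points.

(* [reg_pow]: after inverting [x0] every form is strongly pi-regular, which is how the
   zero-dimensionality of the scheme is used. *)
Record x0_regular (K : fieldType) (n : nat) (I : ideal {mpoly K[n.+1]}) : Prop :=
  X0Regular {
    reg_homog : homogeneous_ideal I;
    reg_nzd : forall f : coord_ring I, x0 I * f = 0 -> f = 0;
    reg_one : 1 <> 0 :> coord_ring I;
    reg_pow : forall d (g : coord_ring I), coord_deg d%:Z g -> exists k m b,
      coord_deg m%:Z b /\ g ^+ k * (x0 I ^+ (m + d) - b * g) = 0 }.

Section Regular.
Variables (K : fieldType) (n : nat) (I : ideal {mpoly K[n.+1]}).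
Hypothesis rI : x0_regular I.
Implicit Types f g : coord_ring I.

Lemma const_eq0 c : const I c = 0 -> c = 0.
Proof.
move=> h; apply/eqP/negPn/negP => nc; apply: (reg_one rI).
by rewrite -(rmorph1 (const I)) -(mulVf nc) rmorphM /= h mulr0.
Qed.

Lemma homog_nzdE g : g \in @homog_nzd K n I -> exists d : nat,
  coord_deg d%:Z g /\ forall f, g * f = 0 -> f = 0.
Proof.
move=> /asboolP[[[d|d] hg] nz]; first by exists d.
have := nz 1; rewrite (iffLR (coord_deg_neg _ _) hg) mul0r => /(_ erefl).
by move/(reg_one rI).
Qed.

(** Cancelling g^k in [reg_pow] makes [g] a divisor of a power of x_0; hence the denominators in
    Q^h(R) may be taken to be powers of x_0. *)
Lemma nzd_inverse d g : coord_deg d%:Z g -> (forall f, g * f = 0 -> f = 0) ->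
  exists m h, coord_deg m%:Z h /\ h * g = x0 I ^+ (m + d).
Proof.
move=> hg nz; have [k [m [b [hb E]]]] := reg_pow rI hg.
exists m, b; split=> //; apply/esym/eqP; rewrite -subr_eq0; apply/eqP.
elim: k E => [|k IH]; first by rewrite mul1r.
by rewrite exprS -mulrA => /nz.
Qed.

End Regular.

Lemma x0_regularP (K : fieldType) (n : nat) (I : ideal {mpoly K[n.+1]})
  (s : nat) (p : 'I_s -> prime_idealr {mpoly K[n.+1]}) :
  subscheme_ideal I -> zero_dimensional I -> support_enum I p ->
  (forall j, 'X_ord0 \notin p j) -> x0_regular I.
Proof.
move=> hI hdim hp hX0; split; first exact: hI.1.
- exact: (x0_nzd hI hdim hp hX0).
- exact: coord_ring_neq0.
- by move=> d g; apply: (power_relation hI hdim hp hX0).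
Qed.

(** * The homogeneous localization and its degree-zero part *)

Section LocalizationTheory.
Variables (A : comPzRingType) (D : mulrClosed A).

Lemma fraction_locmapM a u : u \in D -> fraction D a u * locmap D u = locmap D a.
Proof.
move=> uD; rewrite /fraction [LHS]frac_mul; apply: frac_eq.
by rewrite /= !mulr1 insubdK.
Qed.

Lemma locmapB a b : locmap D (a - b) = locmap D a - locmap D b.
Proof. exact: rmorphB. Qed.

Lemma locmapM a b : locmap D (a * b) = locmap D a * locmap D b.
Proof. exact: rmorphM. Qed.

Lemma loc_cancel u (x y : loc D) : u \in D -> x * locmap D u = y * locmap D u -> x = y.
Proof.
move=> uD /(congr1 (fun z => z * fraction D 1 u)); rewrite -!mulrA.
by rewrite [locmap D u * _]mulrC fraction_locmapM // rmorph1 !mulr1.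
Qed.

Lemma locmap_eq0 a : locmap D a = 0 <-> exists2 u, u \in D & u * a = 0.
Proof.
rewrite -(rmorph0 (locmap D)); split=> [/frac_eqP[u uD]|[u uD ua]].
  by rewrite /= !mulr1 subr0; exists u.
by apply/frac_eqP; exists u => //=; rewrite !mulr1 subr0.
Qed.

End LocalizationTheory.

Section HomogeneousLocalization.
Variables (K : fieldType) (n : nat) (I : ideal {mpoly K[n.+1]}).
Local Notation P := {mpoly K[n.+1]}.
Local Notation R := (coord_ring I).
Local Notation Q := (Qh I).
Implicit Types (F G : P) (f g : R) (q : Q).

Lemma Qfrac_locmapM f g : g \in @homog_nzd K n I ->
  Qfrac f g * locmap _ g = locmap _ f.
Proof. exact: fraction_locmapM. Qed.

Lemma locmap_inj : injective (@locmap R (@homog_nzd K n I)).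
Proof.
move=> f g /frac_eqP[u /asboolP[_ nz]] /=; rewrite !mulr1 => /nz/eqP.
by rewrite subr_eq0 => /eqP.
Qed.

Lemma locmap_cancel g q q' : g \in @homog_nzd K n I ->
  q * locmap _ g = q' * locmap _ g -> q = q'.
Proof. exact: loc_cancel. Qed.

Definition Qh0 : {pred Q} := fun q => `[< Qh_deg 0 q >].

Fact Qh0_subring : subring_closed Qh0.
Proof.
have nzM g h : g \in @homog_nzd K n I -> h \in @homog_nzd K n I ->
    g * h \in @homog_nzd K n I by apply: rpredM.
split.
- apply/asboolP; exists 0%N, 0%N, 1, 1; split=> //; try exact: coord_deg1.
    exact: rpred1.
  by apply: (@locmap_cancel 1); rewrite ?rpred1 // Qfrac_locmapM ?rpred1 // mul1r.
- move=> _ _ /asboolP[i [j [f [g [hf hg ng e ->]]]]]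
    /asboolP[i' [j' [f' [g' [hf' hg' ng' e' ->]]]]].
  apply/asboolP; exists (i + j')%N, (j + j')%N, (f * g' - f' * g), (g * g'); split.
  + apply: coord_degB; first exact: coord_degM_nat.
    by rewrite (_ : (i + j' = i' + j)%N); [apply: coord_degM_nat|lia].
  + exact: coord_degM_nat.
  + exact: nzM.
  + by lia.
  + apply: (@locmap_cancel (g * g')); first exact: nzM.
    rewrite Qfrac_locmapM; last exact: nzM.
    rewrite rmorphB !rmorphM /= mulrBl mulrA Qfrac_locmapM //.
    by rewrite [locmap _ g * _]mulrC mulrA Qfrac_locmapM.
- move=> _ _ /asboolP[i [j [f [g [hf hg ng e ->]]]]]
    /asboolP[i' [j' [f' [g' [hf' hg' ng' e' ->]]]]].
  apply/asboolP; exists (i + i')%N, (j + j')%N, (f * f'), (g * g'); split.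
  + exact: coord_degM_nat.
  + exact: coord_degM_nat.
  + exact: nzM.
  + by lia.
  + apply: (@locmap_cancel (g * g')); first exact: nzM.
    rewrite Qfrac_locmapM; last exact: nzM.
    by rewrite !rmorphM /= mulrACA !Qfrac_locmapM.
Qed.

HB.instance Definition _ := GRing.isSubringClosed.Build Q Qh0 Qh0_subring.

(** This is the ring S. In the description of Q^h(R) by the local rings it is their product, as x_0
    becomes (T_1, ..., T_s). *)
Definition degree0 := {q : Q | q \in Qh0}.
HB.instance Definition _ := SubType.on degree0.
HB.instance Definition _ := SubChoice.on degree0.
HB.instance Definition _ := GRing.SubChoice_isSubComPzRing.Build
  Q Qh0 degree0 Qh0_subring.

Implicit Types a b : degree0.

Lemma degree0_ex q : Qh_deg 0 q -> exists a, val a = q.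
Proof. by move=> /asboolT h; exists (exist (fun q => q \in Qh0) q h). Qed.

Lemma degree0P a : Qh_deg 0 (val a).
Proof. exact: (asboolW (valP a)). Qed.

Definition constQ (c : K) : Q := locmap _ (const I c).

Fact constQ_zmod : zmod_morphism constQ.
Proof. by move=> a b; rewrite /constQ !rmorphB. Qed.
Fact constQ_monoid : monoid_morphism constQ.
Proof. by split=> [|a b]; rewrite /constQ ?rmorph1 // !rmorphM. Qed.
HB.instance Definition _ := GRing.isZmodMorphism.Build K Q constQ constQ_zmod.
HB.instance Definition _ := GRing.isMonoidMorphism.Build K Q constQ constQ_monoid.

Fact const0_subproof c : constQ c \in Qh0.
Proof.
apply/asboolP; exists 0%N, 0%N, (const I c), 1; split=> //.
- exact: coord_deg_const.
- exact: coord_deg1.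
- exact: rpred1.
- apply: (@locmap_cancel 1); first exact: rpred1.
  by rewrite Qfrac_locmapM ?rpred1 // rmorph1 mulr1.
Qed.
Definition const0 (c : K) : degree0 := exist _ (constQ c) (const0_subproof c).

Fact const0_zmod : zmod_morphism const0.
Proof. by move=> c d; apply: val_inj; rewrite rmorphB /= rmorphB. Qed.
Fact const0_monoid : monoid_morphism const0.
Proof.
by split=> [|c d]; apply: val_inj; rewrite ?rmorph1 /= ?rmorph1 // rmorphM.
Qed.
HB.instance Definition _ := GRing.isZmodMorphism.Build K degree0 const0 const0_zmod.
HB.instance Definition _ :=
  GRing.isMonoidMorphism.Build K degree0 const0 const0_monoid.

Definition scale0 (c : K) (a : degree0) := const0 c * a.
Fact scale0A c d a : scale0 c (scale0 d a) = scale0 (c * d) a.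
Proof. by rewrite /scale0 rmorphM mulrA. Qed.
Fact scale01 : left_id 1 scale0.
Proof. by move=> a; rewrite /scale0 rmorph1 mul1r. Qed.
Fact scale0Dr : right_distributive scale0 +%R.
Proof. by move=> c a b; rewrite /scale0 mulrDr. Qed.
Fact scale0Dl a : {morph scale0^~ a : c d / c + d}.
Proof. by move=> c d; rewrite /scale0 rmorphD mulrDl. Qed.
HB.instance Definition _ := GRing.Zmodule_isLmodule.Build K degree0
  scale0A scale01 scale0Dr scale0Dl.

Lemma scale0E (c : K) a : c *: a = const0 c * a. Proof. by []. Qed.

Lemma val_scale0 (c : K) a : val (c *: a) = constQ c * val a.
Proof. by []. Qed.

End HomogeneousLocalization.

Section InvertX0.
Variables (K : fieldType) (n : nat) (I : ideal {mpoly K[n.+1]}).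
Local Notation P := {mpoly K[n.+1]}.
Local Notation R := (coord_ring I).
Local Notation Q := (Qh I).
Implicit Types (F G : P) (f g : R) (q : Q) (a b : degree0 I).
Hypothesis rI : x0_regular I.
Let Ihom := reg_homog rI.
Local Notation lc := (@locmap R (@homog_nzd K n I)).

Lemma x0X_homog_nzd k : x0 I ^+ k \in @homog_nzd K n I.
Proof.
apply/asboolP; split; first by exists k; apply: coord_deg_x0.
by move=> f; apply: (x0X_nzd (reg_nzd rI)).
Qed.

Definition x0V : Q := Qfrac 1 (x0 I).

Lemma x0VK : lc (x0 I) * x0V = 1.
Proof.
by rewrite mulrC Qfrac_locmapM ?rmorph1 // -[x0 I]expr1 x0X_homog_nzd.
Qed.

Definition x0z (i : int) : Q :=
  match i with Posz k => lc (x0 I) ^+ k | Negz k => x0V ^+ k.+1 end.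

Lemma x0zB (k l : nat) : x0z (k%:Z - l%:Z) = lc (x0 I) ^+ k * x0V ^+ l.
Proof.
have e m : lc (x0 I) ^+ m * x0V ^+ m = 1 by rewrite -exprMn x0VK expr1n.
case: (leqP l k) => lk.
  have -> : k%:Z - l%:Z = (k - l)%N by lia.
  by rewrite /= -{2}(subnK lk) exprD -mulrA e mulr1.
have -> : k%:Z - l%:Z = Negz (l - k).-1 by lia.
rewrite /= prednK ?subn_gt0 // -{2}(subnK (ltnW lk)) exprD [_ * x0V ^+ k]mulrC.
by rewrite mulrA e mul1r.
Qed.

Lemma x0zD (i j : int) : x0z (i + j) = x0z i * x0z j.
Proof.
have r (k : int) : exists m l : nat, k = m%:Z - l%:Z.
  by case: k => k; [exists k, 0%N|exists 0%N, k.+1]; lia.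
have [m [l ->]] := r i; have [m' [l' ->]] := r j.
have -> : m%:Z - l%:Z + (m'%:Z - l'%:Z) = (m + m')%N%:Z - (l + l')%N%:Z by lia.
by rewrite !x0zB !exprD mulrACA.
Qed.

Lemma x0z0 : x0z 0 = 1. Proof. by []. Qed.

Lemma x0zNK i : x0z (- i) * x0z i = 1.
Proof. by rewrite -x0zD addNr. Qed.

Lemma x0zKN i : x0z i * x0z (- i) = 1.
Proof. by rewrite -x0zD addrN. Qed.

Lemma x0z_nat k : x0z k%:Z = lc (x0 I ^+ k).
Proof. by rewrite rmorphXn. Qed.

Lemma x0z_inj i q q' : x0z i * q = x0z i * q' -> q = q'.
Proof. by move=> /(congr1 ( *%R (x0z (- i)))); rewrite !mulrA x0zNK !mul1r. Qed.

Lemma Qfrac_x0X f k : Qfrac f (x0 I ^+ k) = lc f * x0z (- k%:Z).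
Proof.
apply: (@locmap_cancel _ _ _ (x0 I ^+ k)); rewrite ?Qfrac_locmapM ?x0X_homog_nzd //.
by rewrite -mulrA -x0z_nat x0zNK mulr1.
Qed.

Lemma Qh_repr q : exists f k, q = lc f * x0z (- k%:Z).
Proof.
pose u := denomi q.
have [d [hd nz]] := homog_nzdE rI (valP u).
have [m [h [_ e]]] := nzd_inverse rI hd nz.
exists (numer q * h), (m + d)%N; apply: (@locmap_cancel _ _ _ (val u)); first exact: valP.
have E : lc (numer q * h) * lc (val u) = lc (numer q) * x0z (m + d)%N%:Z.
  by rewrite -rmorphM -mulrA e rmorphM x0z_nat.
rewrite mulrAC E -mulrA x0zKN mulr1.
rewrite -[q in LHS]frac_repr [LHS]frac_mul; apply: frac_eq => /=.
by rewrite !mulr1.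
Qed.

Lemma Qh_degP (d : int) q : Qh_deg d q <->
  exists (i : nat) f, coord_deg i%:Z f /\ q = lc f * x0z (d - i%:Z).
Proof.
split=> [[i [j [f [g [hf hg ng <- ->]]]]]|[i [f [hf ->]]]].
  have [_ nz] : (exists d, coord_deg d g) /\ _ := asboolW ng.
  have [m [h [hh e]]] := nzd_inverse rI hg nz.
  exists (i + m)%N, (f * h); split; first exact: coord_degM_nat.
  apply: (locmap_cancel ng); rewrite (Qfrac_locmapM _ ng) mulrAC -rmorphM -mulrA e.
  by rewrite rmorphM /= -x0z_nat -mulrA -x0zD (_ : _ + _ = 0 :> int) ?mulr1 //; lia.
case e : (d - i%:Z) => [k|k].
  exists (i + k)%N, 0%N, (f * x0 I ^+ k), (x0 I ^+ 0); split.
  - exact: coord_degMx0.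
  - exact: coord_deg_x0.
  - exact: x0X_homog_nzd.
  - by lia.
  - by rewrite Qfrac_x0X mulr1 rmorphM /= -x0z_nat.
exists i, k.+1, f, (x0 I ^+ k.+1); split=> //.
- exact: coord_deg_x0.
- exact: x0X_homog_nzd.
- by lia.
- by rewrite Qfrac_x0X.
Qed.

Lemma Qh_deg0 d : Qh_deg d (0 : Q).
Proof.
by apply/Qh_degP; exists 0%N, 0; rewrite rmorph0 mul0r; split=> //; apply: coord_deg0.
Qed.

Lemma Qh_deg_locmap (d : int) f : coord_deg d f -> Qh_deg d (lc f).
Proof.
case: d => d; last by rewrite coord_deg_neg => ->; rewrite rmorph0; apply: Qh_deg0.
by move=> hf; apply/Qh_degP; exists d, f; rewrite subrr mulr1.
Qed.

Lemma Qh_deg_x0z d : Qh_deg d (x0z d).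
Proof.
apply/Qh_degP; exists 0%N, 1; rewrite rmorph1 mul1r subr0; split=> //.
exact: coord_deg1.
Qed.

Lemma Qh_degM (d e : int) q q' : Qh_deg d q -> Qh_deg e q' -> Qh_deg (d + e) (q * q').
Proof.
move=> /Qh_degP[i [f [hf ->]]] /Qh_degP[j [g [hg ->]]]; apply/Qh_degP.
exists (i + j)%N, (f * g); split; first exact: coord_degM_nat.
by rewrite rmorphM /= mulrACA -x0zD; congr (_ * x0z _); lia.
Qed.

Lemma Qh_degP0 (d : int) q : Qh_deg d q <-> exists a : degree0 I, q = x0z d * val a.
Proof.
split=> [hq|[a ->]].
  have [|a ea] := @degree0_ex _ _ _ (x0z (- d) * q).
    by rewrite -(addNr d); apply: Qh_degM => //; apply: Qh_deg_x0z.
  by exists a; rewrite ea mulrA x0zKN mul1r.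
rewrite -[d]addr0; apply: Qh_degM; first by rewrite addr0; apply: Qh_deg_x0z.
exact: degree0P.
Qed.

Lemma Qh_degD (d : int) q q' : Qh_deg d q -> Qh_deg d q' -> Qh_deg d (q + q').
Proof.
move=> /Qh_degP0[a ->] /Qh_degP0[b ->]; apply/Qh_degP0; exists (a + b).
by rewrite rmorphD /= mulrDr.
Qed.

Lemma Qh_degN (d : int) q : Qh_deg d q -> Qh_deg d (- q).
Proof.
by move=> /Qh_degP0[a ->]; apply/Qh_degP0; exists (- a); rewrite rmorphN /= mulrN.
Qed.

(** The claim covers all large [N], so that finitely many elements can share one denominator
    x_0^N. *)
Lemma Qh_deg_clear (d : int) q : Qh_deg d q -> exists N0 : nat, forall N : nat, (N0 <= N)%N ->
  exists (e : nat) f, [/\ e%:Z = d + N%:Z, coord_deg e%:Z f & q * x0z N%:Z = lc f].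
Proof.
move=> /Qh_degP[i [f [hf ->]]]; exists (i + absz d)%N => N hN.
have [k ek] : exists k : nat, d - i%:Z + N%:Z = k by exists (absz (d - i%:Z + N%:Z)); lia.
exists (i + k)%N, (f * x0 I ^+ k); split; first lia; first exact: coord_degMx0.
by rewrite -mulrA -x0zD ek rmorphM /= -x0z_nat.
Qed.

(** Some x_0^N f is a form, so the parts of f outside degree d are killed by x_0^N. For negative d
    this gives f = 0, which is how pairings in negative degrees are shown to vanish. *)
Lemma coord_deg_of_Qh (d : int) f : Qh_deg d (lc f) -> coord_deg d f.
Proof.
move=> /Qh_deg_clear[N0 /(_ N0 (leqnn _))[e [g [ed hg]]]].
rewrite x0z_nat -rmorphM => /locmap_inj E.
have pr (i : nat) : i%:Z != d -> prj i f = 0.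
  move=> ne; apply: (x0X_nzd (reg_nzd rI) (k := N0)).
  have := @prjMl _ _ _ Ihom N0 (N0 + i) (x0 I ^+ N0) f (coord_deg_x0 _ _).
  rewrite leq_addr addKn mulrC E => <-; apply: (prj_ne Ihom hg).
  by apply: contraNneq ne => e'; apply/eqP; lia.
have [M /(_ M (leqnn _)) ->] := sum_prj Ihom f; apply: coord_deg_sum => i _.
have [<-|ne] := eqVneq (i : nat)%:Z d; first exact: prj_deg.
by rewrite pr //; apply: coord_deg0.
Qed.

End InvertX0.

(** * Trace form and finite dimension *)

Section Subspaces.
Variables (K : fieldType) (V : vectType K).

(** A subspace of maximal dimension inside [B] is all of [B], since otherwise a line could be added
    to it. *)
Lemma vspace_of_pred (B : V -> Prop) :
  B 0 -> (forall x y, B x -> B y -> B (x + y)) -> (forall c x, B x -> B (c *: x)) ->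
  exists U : {vspace V}, forall x, x \in U <-> B x.
Proof.
move=> B0 BD BZ.
pose A r := `[< exists U : {vspace V}, (forall x, x \in U -> B x) /\ \dim U = r >].
have A0 : exists r, A r.
  by exists 0%N; apply/asboolP; exists 0%VS; rewrite dimv0; split=> // x; rewrite memv0 => /eqP->.
have Amax r : A r -> (r <= \dim {:V})%N by move=> /asboolP[U [_ <-]]; rewrite dimvS ?subvf.
case: (ex_maxnP A0 Amax) => r /asboolP[U [UB dU]] rmax; exists U => x; split=> [/UB//|Bx].
have : A (\dim (U + <[x]>)).
  apply/asboolP; exists (U + <[x]>)%VS; split=> // y /memv_addP[u uU [w /vlineP[c ->] ->]].
  by apply: BD; [apply: UB|apply: BZ].
move=> /rmax; rewrite -dU => le.
have /eqP -> : U == (U + <[x]>)%VS by rewrite eqEdim addvSl le.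
by rewrite memvE addvSr.
Qed.

End Subspaces.

(** The [e i] are preimages of a basis of T(V), so V is the sum of their span and ker T even when V
    is infinite-dimensional. *)
Lemma finite_span_of_image (K : fieldType) (V : lmodType K) (W : vectType K)
    (T : {linear V -> W}) :
  exists m (e : 'I_m -> V), forall y, exists c : 'I_m -> K,
    T (y - \sum_i c i *: e i) = 0.
Proof.
have [|||U hU] := @vspace_of_pred K W (fun w => exists v, T v = w).
- by exists 0; rewrite raddf0.
- by move=> _ _ [x <-] [y <-]; exists (x + y); rewrite raddfD.
- by move=> c _ [x <-]; exists (c *: x); rewrite linearZ.
have /choice[e he] : forall i : 'I_(\dim U), exists v, T v = (vbasis U)`_i.
  by move=> i; apply/hU/vbasis_mem/mem_nth; rewrite size_tuple.
exists (\dim U), e => y; exists (fun i => vector.coord (vbasis U) i (T y)).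
have yU : T y \in U by apply/hU; exists y.
rewrite raddfB raddf_sum /= {1}(coord_vbasis yU); apply/eqP; rewrite subr_eq0.
by apply/eqP/eq_bigr => i _; rewrite linearZ /= he.
Qed.

Section BaseRing.
Variables (K : fieldType) (n : nat) (I : ideal {mpoly K[n.+1]}).
Local Notation P := {mpoly K[n.+1]}.
Local Notation R := (coord_ring I).
Local Notation Q := (Qh I).
Implicit Types (F G : P) (f g : R) (q : Q) (a b : degree0 I).
Hypothesis rI : x0_regular I.
Let Ihom := reg_homog rI.
Local Notation lc := (@locmap R (@homog_nzd K n I)).
Local Notation x0z := (x0z I).

Lemma Kx0P f : Kx0 f <->
  exists N (c : nat -> K), f = \sum_(i < N) const I (c i) * x0 I ^+ i.
Proof.
split=> [[q ->]|[N [c ->]]]; first by exists (size q), (fun i => q`_i).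
exists (\poly_(i < N) c i); have hs := size_poly N c.
rewrite (big_ord_widen N (fun i => const I (\poly_(i < N) c i)`_i * x0 I ^+ i)) //.
rewrite [RHS]big_mkcond /=; apply: eq_bigr => i _; rewrite coef_poly ltn_ord.
case: ltnP => // /(nth_default 0); rewrite coef_poly ltn_ord => ->.
by rewrite rmorph0 mul0r.
Qed.

Lemma Kx0_mono c k : Kx0 (const I c * x0 I ^+ k).
Proof.
apply/Kx0P; exists k.+1, (fun i => if i == k then c else 0).
rewrite big_ord_recr /= eqxx big1 ?add0r // => i _.
by rewrite ltn_eqF // rmorph0 mul0r.
Qed.

Lemma Kx0_deg d f : Kx0 f -> coord_deg d%:Z f -> exists c, f = const I c * x0 I ^+ d.
Proof.
move=> /Kx0P[N [c ->]] /(prj_id Ihom) <-; rewrite prj_sum //.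
have pr (i : nat) : prj d (const I (c i) * x0 I ^+ i) =
    if i == d then const I (c d) * x0 I ^+ d else 0.
  have h : coord_deg i%:Z (const I (c i) * x0 I ^+ i).
    by apply: coord_degZ; apply: coord_deg_x0.
  by case: eqP => [<-|ne]; [apply: prj_id|apply: (prj_ne Ihom h); apply/eqP => -[]].
under eq_bigr do rewrite pr.
case: (ltnP d N) => dN.
  exists (c d); rewrite (bigD1 (Ordinal dN)) //= eqxx big1 ?addr0 // => i ne.
  by case: eqP => // e; case/eqP: ne; apply: val_inj.
exists 0; rewrite rmorph0 mul0r big1 // => i _; rewrite ltn_eqF //.
exact: leq_trans dN.
Qed.

Lemma Kx0_degZ (d : int) f : Kx0 f -> coord_deg d f -> exists c, lc f = constQ I c * x0z d.
Proof.
case: d => d hf; last first.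
  by move=> /coord_deg_neg ->; exists 0; rewrite !rmorph0 mul0r.
by move=> /(Kx0_deg hf)[c ->]; exists c; rewrite rmorphM /= -x0z_nat.
Qed.

Lemma L0_mono c i : L0 (constQ I c * x0z i).
Proof.
case: i => k.
  exists (const I c * x0 I ^+ k), 0%N; split; first exact: Kx0_mono.
  by rewrite (Qfrac_x0X rI) oppr0 mulr1 rmorphM /= -x0z_nat.
exists (const I c * x0 I ^+ 0), k.+1; split; first exact: Kx0_mono.
by rewrite (Qfrac_x0X rI) mulr1.
Qed.

Lemma L0_const c : L0 (constQ I c).
Proof. by have := L0_mono c 0; rewrite x0z0 mulr1. Qed.

Lemma L0_x0z i : L0 (x0z i).
Proof. by have := L0_mono 1 i; rewrite rmorph1 mul1r. Qed.

Lemma L0_deg (d : int) q : L0 q -> Qh_deg d q -> exists c, q = constQ I c * x0z d.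
Proof.
move=> [f [k [hf]]]; rewrite (Qfrac_x0X rI) => E hq.
have E' : q * x0z k = lc f.
  by rewrite E -mulrA -x0zD // (_ : - k%:Z + k%:Z = 0) ?mulr1 //; lia.
have : Qh_deg (d + k%:Z) (lc f).
  by rewrite -E'; apply: (Qh_degM rI) => //; apply: Qh_deg_x0z.
move=> /(coord_deg_of_Qh rI) /(Kx0_degZ hf)[c ec].
exists c; apply: (x0z_inj rI (i := k)).
by rewrite mulrC E' ec (x0zD rI) mulrA mulrC.
Qed.

Lemma constQ_inj : injective (constQ I).
Proof.
move=> c d /eqP; rewrite -subr_eq0 -rmorphB /= => /eqP e.
apply/eqP; rewrite -subr_eq0; apply/eqP/(const_eq0 rI).
by apply: locmap_inj; rewrite rmorph0.
Qed.

Lemma x0z_cancel i c d : constQ I c * x0z i = constQ I d * x0z i -> c = d.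
Proof.
move=> e; apply: constQ_inj; apply: (x0z_inj rI (i := i)).
by rewrite mulrC e mulrC.
Qed.

Lemma Qh_ind (B : Q -> Prop) : B 0 -> (forall q q', B q -> B q' -> B (q + q')) ->
  (forall i a, B (x0z i * val a)) -> forall q, B q.
Proof.
move=> B0 BD Bh q; have [f [k ->]] := Qh_repr rI q.
have [N /(_ N (leqnn _)) ->] := sum_prj Ihom f; rewrite rmorph_sum mulr_suml /=.
elim/big_ind: _ => // d _.
have /(Qh_degP0 rI)[a ->] : Qh_deg (d%:Z - k%:Z) (lc (prj d f) * x0z (- k%:Z)).
  apply: (Qh_degM rI); last exact: Qh_deg_x0z.
  by apply/(Qh_deg_locmap rI)/prj_deg.
exact: Bh.
Qed.

Lemma monomial0_ex (m : 'X_{1..n.+1}) :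
  exists a : degree0 I, lc (coord I 'X_[m]) = x0z (mdeg m)%:Z * val a.
Proof.
apply/(Qh_degP0 rI)/(Qh_deg_locmap rI); exact: coord_degX.
Qed.

Lemma Qh_monomials q : exists (r : seq 'X_{1..n.+1}) (c : 'X_{1..n.+1} -> K) (k : nat),
  q = \sum_(m <- r) constQ I (c m) * lc (coord I 'X_[m]) * x0z (- k%:Z).
Proof.
have [f [k ->]] := Qh_repr rI q; have [F ->] := coord_surj f.
exists (msupp F), (fun m => F@_m), k; rewrite -mulr_suml; congr (_ * _).
rewrite {1}[F]mpolyE !rmorph_sum /=; apply: eq_bigr => m _.
by rewrite -mul_mpolyC !rmorphM.
Qed.

End BaseRing.

Lemma mul_shuffle (A : comPzRingType) (a c t v u : A) :
  a * (c * (t * v) * u) = c * (t * u * (a * v)).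
Proof. by ring. Qed.

Section TraceForm.
Variables (K : fieldType) (n : nat) (I : ideal {mpoly K[n.+1]}).
Local Notation P := {mpoly K[n.+1]}.
Local Notation R := (coord_ring I).
Local Notation Q := (Qh I).
Local Notation S := (degree0 I).
Implicit Types (q : Q) (a b : S).
Hypothesis rI : x0_regular I.
Let Ihom := reg_homog rI.
Local Notation lc := (@locmap R (@homog_nzd K n I)).
Local Notation x0z := (x0z I).
Variable sigma : Q -> Q.
Hypothesis hsigma : trace_map sigma.

Let sigmaD q q' : sigma (q + q') = sigma q + sigma q'.
Proof. by have [[[_ h _] _] _] := hsigma; apply: h. Qed.

Let sigmaZ q q' : L0 q -> sigma (q * q') = q * sigma q'.
Proof. by have [[[_ _ h] _] _] := hsigma; move=> hq; apply: (h q q' hq). Qed.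

Let sigma0 : sigma 0 = 0.
Proof. by apply: (addrI (sigma 0)); rewrite -sigmaD !addr0. Qed.

(** A degree-zero map sends S into the degree-zero part K of L_0; linearity over L_0 then determines
    it in the other degrees. *)
Lemma trace_form_exists : exists tau : {linear S -> K^o},
  forall i a, sigma (x0z i * val a) = constQ I (tau a) * x0z i.
Proof.
have /choice[t ht] : forall a, exists c, sigma (val a) = constQ I c.
  move=> a; have [[[hL _ _] hd] _] := hsigma.
  have [c] := L0_deg rI (hL _ Logic.I) (hd 0 (val a) Logic.I (degree0P a)).2.
  by rewrite mulr1 => e; exists c.
have tD a b : t (a + b) = t a + t b.
  by apply: (constQ_inj rI); rewrite rmorphD /= -!ht rmorphD sigmaD.
have tZ c a : t (c *: a) = c * t a.
  apply: (constQ_inj rI); rewrite rmorphM /= -!ht val_scale0 sigmaZ //.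
  exact: L0_const.
have tB : zmod_morphism (t : S -> K^o).
  by move=> a b; rewrite -scaleN1r tD tZ mulN1r.
pose tau : {linear S -> K^o} := HB.pack (t : S -> K^o)
  (GRing.isZmodMorphism.Build S K^o t tB) (GRing.isScalable.Build K S K^o *:%R t tZ).
exists tau => i a; rewrite sigmaZ ?ht; first by rewrite mulrC.
exact: L0_x0z.
Qed.

Variable tau : {linear S -> K^o}.
Hypothesis tauE : forall i a, sigma (x0z i * val a) = constQ I (tau a) * x0z i.

Lemma sigma_nondeg q : (forall x, sigma (q * x) = 0) -> q = 0.
Proof.
move=> hq; have [|g [_ gu]] := hsigma.2 (fun _ => 0).
  exists 0%N, (fun _ => 0), (fun _ _ => 0); split=> [[]//|u _].
  by rewrite big_ord0.
by rewrite -(gu 0) ?(gu q) // => x; rewrite ?mul0r.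
Qed.

Lemma sigma_uniq q q' : (forall x, sigma (q * x) = sigma (q' * x)) -> q = q'.
Proof.
move=> h; apply/eqP; rewrite -subr_eq0; apply/eqP/sigma_nondeg => x.
apply: (addIr (sigma (q' * x))); rewrite -sigmaD -mulrDl subrK add0r; exact: h.
Qed.

Lemma tau_nondeg a : (forall b, tau (a * b) = 0) -> a = 0.
Proof.
move=> ha; apply: val_inj; rewrite rmorph0; apply: sigma_nondeg.
apply: (Qh_ind rI) => [|q q' hq hq'|i b]; first by rewrite mulr0.
  by rewrite mulrDr sigmaD hq hq' addr0.
by rewrite mulrCA -rmorphM tauE ha rmorph0 mul0r.
Qed.

Section Monomials.
Variable v : 'X_{1..n.+1} -> S.
Hypothesis hv : forall m, lc (coord I 'X_[m]) = x0z (mdeg m)%:Z * val (v m).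

(** Since [v m] is X^m / x_0^(deg m), [kills N] is the orthogonal of a span of finitely many
    dehomogenized monomials, and [bounded N q] says that pairing with [q] factors through S modulo
    [kills N]. *)
Definition kills N a := forall m, (mdeg m < N)%N -> tau (a * v m) = 0.
Definition bounded N q := forall a, kills N a -> sigma (val a * q) = 0.

Lemma killsW N N' a : (N <= N')%N -> kills N' a -> kills N a.
Proof. by move=> h ka m mN; apply: ka; apply: leq_trans h. Qed.

Lemma boundedW N N' q : (N <= N')%N -> bounded N q -> bounded N' q.
Proof. by move=> h hq a /(killsW h)/hq. Qed.

Lemma bounded_ex q : exists N, bounded N q.
Proof.
have [r [c [k ->]]] := Qh_monomials rI q.
exists (\sum_(m <- r) (mdeg m).+1)%N => a ka; rewrite mulr_sumr.
elim: r ka => [|m r IH] ka; first by rewrite big_nil.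
rewrite !big_cons in ka *; rewrite sigmaD IH ?addr0; last first.
  by apply: killsW ka; rewrite leq_addl.
have -> : val a * (constQ I (c m) * lc (coord I 'X_[m]) * x0z (- k%:Z)) =
    constQ I (c m) * (x0z ((mdeg m)%:Z - k%:Z) * val (a * v m)).
  by rewrite hv x0zD // rmorphM; apply: mul_shuffle.
by rewrite sigmaZ ?tauE; [rewrite ka ?leq_addr // rmorph0 mul0r mulr0|exact: L0_const].
Qed.

Lemma kills0 N : kills N 0.
Proof. by move=> m _; rewrite mul0r raddf0. Qed.

Lemma killsD N a b : kills N a -> kills N b -> kills N (a + b).
Proof. by move=> ha hb m mN; rewrite mulrDl raddfD /= ha // hb // addr0. Qed.

(* If [kills N] is self-orthogonal then S embeds in a finite-dimensional space. *)
Lemma non_self_orthogonal N (H : S) : (forall m (Phi : {linear S -> 'rV[K]_m}), ~ injective Phi) ->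
  exists g h, [/\ kills N g, kills N h & tau ((H + h) * g) != 0].
Proof.
move=> inf; apply: contrapT => no.
(* Were the claim false, tau ((H + h) b) would vanish for h = a and for h = 0; the difference is tau
   (a b). *)
have orth a b : kills N a -> kills N b -> tau (a * b) = 0.
  move=> ka kb; have zero h : kills N h -> tau ((H + h) * b) = 0.
    by move=> kh; apply/eqP/negPn/negP => nz; apply: no; exists b, h.
  have := zero _ ka; have := zero _ (@kills0 N).
  by rewrite addr0 mulrDl raddfD /= => ->; rewrite add0r.
pose w (k : 'I_#|{: 'X_{1..n.+1 < N}}|) : S := v (enum_val k).
have lin M (u : 'I_M -> S) : exists T : {linear S -> 'rV[K]_M},
    forall a i, T a 0 i = tau (a * u i).
  pose T (a : S) := (\row_i (tau (a * u i) : K)) : 'rV[K]_M.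
  have TB : zmod_morphism T.
    by move=> a b; apply/rowP => i; rewrite !mxE mulrBl raddfB.
  have TZ : scalable_for *:%R T.
    by move=> c a; apply/rowP => i; rewrite !mxE -[_ * u i]mulrA linearZ.
  pose T' : {linear S -> 'rV[K]_M} := HB.pack T
    (GRing.isZmodMorphism.Build S 'rV[K]_M T TB)
    (GRing.isScalable.Build K S 'rV[K]_M *:%R T TZ).
  by exists T' => a i; rewrite mxE.
have [T hT] := lin _ w.
have T0 a : T a = 0 -> kills N a.
  move=> /rowP h m mN; have := h (enum_rank (BMultinom mN)).
  by rewrite hT mxE /w enum_rankK.
(* The [e k] span S modulo [kills N]. Pairing with the [v m] and the [e k] is then injective: an
   element of the kernel lies in [kills N], so it is orthogonal to [kills N] and to the [e k], hence
   to all of S. *)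
have [M [e he]] := finite_span_of_image T.
have [T' hT'] := lin _ (fun i => match split i with inl k => w k | inr k => e k end).
apply: (inf _ T'); apply: raddf_inj => a /rowP Ta.
have ka : kills N a.
  apply: T0; apply/rowP => k; have := Ta (lshift _ k).
  by rewrite hT hT' !mxE; case: split_ordP => l; [move/lshift_inj=> ->|move/eqP; rewrite eq_lrshift].
apply: tau_nondeg => y; have [c hc] := he y.
rewrite -[y](subrK (\sum_i c i *: e i)) mulrDr raddfD /= (orth _ _ ka (T0 _ hc)) add0r.
rewrite mulr_sumr raddf_sum big1 //= => k _; rewrite mulrCA linearZ /=.
have := Ta (rshift _ k); rewrite hT' mxE; case: split_ordP => l.
  by move/eqP; rewrite eq_sym eq_lrshift.
by move=> /rshift_inj <- ->; rewrite scaler0.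
Qed.

End Monomials.

(* Were S infinite-dimensional, the pointwise limit psi of the maps sigma (H_k * _) would
   not be of the form sigma (q * _): psi is nonzero at every g_k, whereas each q pairs to
   zero with almost all of them. *)
Lemma degree0_finite_dim : exists m (Phi : {linear S -> 'rV[K]_m}), injective Phi.
Proof.
apply: contrapT => nfin.
have inf m (Phi : {linear S -> 'rV[K]_m}) : ~ injective Phi.
  by move=> h; apply: nfin; exists m, Phi.
have /choice[v hv] := monomial0_ex rI.
have /choice[nb hnb] := bounded_ex hv.
(* A state is a bound N and an element H. The new [h] pairs to zero with everything bounded by N, so
   earlier values survive; the new bound also bounds [g], so tau (H g), once nonzero, no longer
   changes. *)
have step (x : nat * S) : exists y : nat * (S * S),
    [/\ (x.1 < y.1)%N, kills v x.1 y.2.1, kills v x.1 y.2.2,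
        tau ((x.2 + y.2.2) * y.2.1) != 0 & bounded v y.1 (val y.2.1)].
  have [g [h [kg kh nz]]] := non_self_orthogonal v x.1 x.2 inf.
  exists ((x.1 + nb (val g)).+1, (g, h)); split=> //=; first by rewrite ltnS leq_addr.
  by apply: boundedW (hnb (val g)); rewrite leqW // leq_addl.
have {step} /choice[st hst] := step.
pose x k := iter k (fun x => ((st x).1, x.2 + (st x).2.2)) (0%N, 0 : S).
pose g k := (st (x k)).2.1.
have xS k : x k.+1 = ((st (x k)).1, (x k).2 + (st (x k)).2.2) by [].
have lt k : ((x k).1 < (x k.+1).1)%N by have [? _ _ _ _] := hst (x k).
have mono k l : (k <= l)%N -> ((x k).1 <= (x l).1)%N.
  by move=> /subnK <-; elim: (l - k)%N => // d /leq_trans; apply; apply/ltnW/lt.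
have ge k : (k <= (x k).1)%N by elim: k => // k /leq_ltn_trans; apply.
have stab k l : (k <= l)%N -> kills v (x k).1 ((x l).2 - (x k).2).
  move=> /subnK <-; elim: (l - k)%N => [|d IH]; first by rewrite subrr; apply: kills0.
  rewrite addSn xS /= addrAC; apply: killsD => //.
  have [_ _ kh _ _] := hst (x (d + k)%N); apply: killsW kh.
  by apply: mono; rewrite leq_addl.
have limit q k l : bounded v (x k).1 q -> (k <= l)%N ->
    sigma (val (x l).2 * q) = sigma (val (x k).2 * q).
  move=> bq kl; rewrite -[(x l).2](subrK (x k).2) rmorphD mulrDl sigmaD.
  by rewrite (bq _ (stab _ _ kl)) add0r.
pose psi q := sigma (val (x (nb q)).2 * q).
have psiE q l : (nb q <= l)%N -> psi q = sigma (val (x l).2 * q).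
  by move=> h; rewrite (limit q (nb q)) //; apply: boundedW (hnb q).
have [|G [hG _]] := hsigma.2 psi.
  exists 1%N, (fun _ => 0), (fun _ => psi); split; last by move=> q _; rewrite big_ord1.
  move=> _; split; last first.
    move=> i q _ hq; have [[_ hd] _] := hsigma; apply: hd => //.
    by rewrite -[i]add0r; apply: Qh_degM => //; apply: degree0P.
  split=> [q _|q q' _ _|a q La _].
  - by have [[[h _ _] _] _] := hsigma; apply: h.
  - pose l := (nb q + nb q' + nb (q + q')%R)%N.
    by rewrite !(psiE _ l) ?mulrDr ?sigmaD // /l; lia.
  - pose l := (nb q + nb (a * q)%R)%N.
    have e : psi (a *: q) = sigma (val (x l).2 * (a * q)) by apply: psiE; rewrite leq_addl.
    by rewrite e (psiE q l) ?leq_addr // mulrCA (sigmaZ _ La).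
(* The bound reached after k steps is at least k, so at this index [g k] is orthogonal to everything
   that is bounded by [nb G], in particular to [G]. *)
pose k := nb G.
have [_ kg _ nz bg] := hst (x k).
have : psi (val (g k)) = 0.
  rewrite hG mulrC; apply: (boundedW _ (hnb G)) kg; exact: ge.
pose l := (nb (val (g k)) + k.+1)%N.
rewrite (psiE _ l) ?leq_addr // (limit _ k.+1) //; last by rewrite leq_addl.
have := tauE 0 ((x k.+1).2 * g k); rewrite x0z0 mul1r mulr1 rmorphM => -> /eqP.
by rewrite -(rmorph0 (constQ I)) => /eqP/(constQ_inj rI)/eqP; apply/negP.
Qed.

End TraceForm.

(** * Dimensions of quotients *)

Section DimensionOfQuotient.
Variables (K : fieldType) (T : vectType K) (A : comPzRingType) (k : K -> A).
Variables (phi : T -> A) (U V : {vspace T}) (V' W' : A -> Prop).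
Hypotheses (VU : (V <= U)%VS)
  (phiU : forall x, x \in U -> V' (phi x))
  (phiV : forall a, V' a -> exists2 x, x \in U & phi x = a)
  (phiB : {in U &, {morph phi : x y / x - y}})
  (phiZ : forall c, {in U, forall x, phi (c *: x) = k c * phi x})
  (phiW : forall x, x \in U -> W' (phi x) <-> x \in V).

Let phi0 : phi 0 = 0.
Proof. by have := phiB (mem0v U) (mem0v U); rewrite !subrr. Qed.

Let phiD : {in U &, {morph phi : x y / x + y}}.
Proof.
move=> x y xU yU; have yU' : - y \in U by rewrite memvN.
have e : phi (- y) = - phi y by have := phiB (mem0v U) yU; rewrite phi0 !sub0r.
by rewrite -{1}[y]opprK phiB // e opprK.
Qed.

Let phi_sum d (x : 'I_d -> T) (c : 'I_d -> K) : (forall i, x i \in U) ->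
  phi (\sum_i c i *: x i) = \sum_i k (c i) * phi (x i).
Proof.
move=> xU; have [] : \sum_i c i *: x i \in U /\
    phi (\sum_i c i *: x i) = \sum_i k (c i) * phi (x i); last by [].
elim/big_rec2: _ => [|i a b _ [aU <-]]; first by rewrite mem0v.
by rewrite phiD ?phiZ ?memvD ?memvZ.
Qed.

Let phi_rel d (x : 'I_d -> T) (c : 'I_d -> K) v : (forall i, x i \in U) -> v \in U ->
  W' (phi v - \sum_i k (c i) * phi (x i)) <-> v - \sum_i c i *: x i \in V.
Proof.
move=> xU vU; have sU : \sum_i c i *: x i \in U.
  by apply: memv_suml => i _; apply: memvZ.
by rewrite -(phi_sum c xU) -phiB //; apply/phiW; rewrite memvB.
Qed.

(** The basis comes from a complement of [V] in [U]. Linearity of [phi] is asked on [U] only,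
    because [phi] may be chosen pointwise there and be arbitrary elsewhere, as in [HF_dim]. *)
Lemma basis_mod_map : exists e : 'I_(\dim U - \dim V) -> A, basis_mod k V' W' e.
Proof.
have dC : \dim (U :\: V)%VS = (\dim U - \dim V)%N.
  by rewrite -(dimv_cap_compl U V) (capv_idPr VU) addKn.
rewrite -dC; set C := (U :\: V)%VS in dC *.
have CU : (C <= U)%VS := diffvSl U V.
pose x i := (vbasis C)`_i; have xC (i : 'I_(\dim C)) : x i \in C.
  by apply: vbasis_mem; rewrite mem_nth // size_tuple.
have xU (i : 'I_(\dim C)) : x i \in U by apply: subvP CU _ (xC i).
exists (fun i => phi (x i)); split=> [i|_ /phiV[v vU <-]]; first exact: phiU.
have : v \in (C + V)%VS by rewrite -[V](capv_idPr VU) addv_diff_cap.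
move=> /memv_addP[w wC [z zV ->]].
pose c0 := [ffun i => vector.coord (vbasis C) i w].
have e0 : w = \sum_i c0 i *: x i.
  by rewrite {1}(coord_vbasis wC); apply: eq_bigr => i _; rewrite ffunE.
have wzU : w + z \in U by rewrite memvD ?(subvP CU w) ?(subvP VU z).
exists c0; split=> [|c]; rewrite phi_rel // -?e0; first by rewrite addrC addKr.
move=> h; have : w - \sum_i c i *: x i \in (V :&: C)%VS.
  rewrite memv_cap; apply/andP; split.
    by rewrite -[w](addrK z) addrAC memvB.
  by rewrite memvB //; apply: memv_suml => i _; apply: memvZ.
rewrite capvC capv_diff memv0 subr_eq0 {1}e0 => /eqP e.
apply/ffunP => i; have fr := basis_free (vbasisP C).
have := congr1 (vector.coord (vbasis C) i) e.
by rewrite !coord_sum_free.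
Qed.

(** Preimages of a basis are independent and span a complement of [V] in [U]; so the minimum in
    [dim_mod] is taken over a single number. *)
Lemma basis_mod_size d (e : 'I_d -> A) : basis_mod k V' W' e -> d = (\dim U - \dim V)%N.
Proof.
move=> [eV eb]; have /choice[x hx] : forall i, exists x, x \in U /\ phi x = e i.
  by move=> i; have [x ? ?] := phiV (eV i); exists x.
have xU i : x i \in U by have [] := hx i.
pose X := [tuple x i | i < d].
have indep (c : {ffun 'I_d -> K}) : \sum_i c i *: x i \in V -> c = 0.
  have [c1 [_ u]] := eb _ (phiU (mem0v U)).
  move=> h; transitivity c1; [symmetry|]; apply: u.
    under eq_bigr => i _ do rewrite -(hx i).2.
    by rewrite phi_rel ?mem0v // sub0r memvN.
  under eq_bigr => i _ do rewrite -(hx i).2.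
  by rewrite phi_rel ?mem0v // big1 ?subrr ?mem0v // => i _; rewrite ffunE scale0r.
have fX : free X.
  apply/freeP => c hc i; have /(congr1 (fun f : {ffun _ -> _} => f i)) : finfun c = 0.
    apply: indep; rewrite (_ : \sum_i _ = 0) ?mem0v // -[RHS]hc.
    by apply: eq_bigr => l _; rewrite ffunE (nth_map l) ?size_enum_ord // nth_ord_enum.
  by rewrite !ffunE.
have XiV : (<<X>> :&: V)%VS = 0%VS.
  apply/eqP; rewrite -subv0; apply/subvP => v; rewrite memv_cap => /andP[vX vV].
  pose c := [ffun i => vector.coord X i v].
  have E : v = \sum_i c i *: x i.
    rewrite {1}(coord_span vX); apply: eq_bigr => l _.
    by rewrite ffunE (nth_map l) ?size_enum_ord // nth_ord_enum.
  have c0 : c = 0 by apply: indep; rewrite -E.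
  by rewrite E memv0 c0 big1 // => i _; rewrite ffunE scale0r.
have XV : (<<X>> + V)%VS = U.
  apply/eqP; rewrite eqEsubv subv_add VU andbT; apply/andP; split.
    by apply/span_subvP => _ /mapP[i _ ->].
  apply/subvP => v vU; have [c [h _]] := eb _ (phiU vU); move: h.
  under eq_bigr => i _ do rewrite -(hx i).2.
  rewrite phi_rel // => h; rewrite -[v](subrK (\sum_i c i *: x i)) addrC.
  apply: memv_add => //; apply: memv_suml => i _; apply/memvZ/memv_span.
  by apply/mapP; exists i => //; rewrite mem_enum.
by rewrite -XV (dimv_disjoint_sum XiV) addnK (eqnP fX) size_tuple.
Qed.

Lemma dim_mod_map : dim_mod k V' W' = (\dim U - \dim V)%N.
Proof.
rewrite /dim_mod /least; case: pselect => [h|[]].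
  case: ex_minnP => m /asboolP[e /basis_mod_size ->] _ //.
by exists (\dim U - \dim V)%N; apply/asboolP; exact: basis_mod_map.
Qed.

End DimensionOfQuotient.

(** * Local rings at the points *)

Section Representatives.
Variables (K : fieldType) (n : nat) (I : ideal {mpoly K[n.+1]}).
Local Notation P := {mpoly K[n.+1]}.
Local Notation R := (coord_ring I).
Local Notation S := (degree0 I).
Implicit Types (f g : R) (a b : S) (i j : int) (N M : nat).
Hypothesis rI : x0_regular I.
Let Ihom := reg_homog rI.
Local Notation lc := (@locmap R (@homog_nzd K n I)).
Local Notation x0z := (x0z I).

(* [a] is the fraction f / x_0^i. *)
Definition dehom i f a : Prop := coord_deg i f /\ lc f = x0z i * val a.

Lemma dehom_exists i f : coord_deg i f -> exists a, dehom i f a.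
Proof.
move=> hf; have /(Qh_degP0 rI)[a ea] := Qh_deg_locmap rI hf.
by exists a.
Qed.

Lemma dehom_repr a : exists N0, forall N, (N0 <= N)%N -> exists f, dehom N f a.
Proof.
have [N0 h] := Qh_deg_clear rI (degree0P a).
exists N0 => N /h[e [f [he hf E]]]; exists f; rewrite add0r in he.
by split; [rewrite -he|rewrite -E mulrC].
Qed.

Lemma dehom_repr2 a b : exists N f g, dehom N%:Z f a /\ dehom N%:Z g b.
Proof.
have [N0 h0] := dehom_repr a; have [N1 h1] := dehom_repr b.
have [f hf] := h0 _ (leq_addr N1 N0); have [g hg] := h1 _ (leq_addl N0 N1).
by exists (N0 + N1)%N, f, g.
Qed.

Lemma dehom_eq i f a b : dehom i f a -> dehom i f b -> a = b.
Proof. by move=> [_ e] [_]; rewrite e => /(x0z_inj rI)/val_inj. Qed.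

Lemma dehom_inj i f g a : dehom i f a -> dehom i g a -> f = g.
Proof. by move=> [_ e] [_]; rewrite -e => /locmap_inj. Qed.

Lemma dehomD i f g a b : dehom i f a -> dehom i g b -> dehom i (f + g) (a + b).
Proof.
move=> [hf ef] [hg eg]; split; first exact: coord_degD.
by rewrite rmorphD /= ef eg -mulrDr -rmorphD.
Qed.

Lemma dehomM i j f g a b : dehom i f a -> dehom j g b -> dehom (i + j) (f * g) (a * b).
Proof.
move=> [hf ef] [hg eg]; split; first exact: coord_degM.
by rewrite [lc _]rmorphM /= ef eg mulrACA -x0zD // -rmorphM.
Qed.

Lemma dehom0 i : dehom i 0 0.
Proof. by split; [apply: coord_deg0|rewrite !rmorph0 mulr0]. Qed.

Lemma dehomZ i c f a : dehom i f a -> dehom i (const I c * f) (c *: a).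
Proof.
move=> [hf ef]; split; first exact: coord_degZ.
have -> : lc (const I c * f) = constQ I c * lc f by exact: rmorphM.
by rewrite ef val_scale0 mulrCA.
Qed.

Lemma dehomN i f a : dehom i f a -> dehom i (- f) (- a).
Proof. by move=> /(dehomZ (-1)); rewrite rmorphN1 mulN1r scaleN1r. Qed.

Lemma dehomB i f g a b : dehom i f a -> dehom i g b -> dehom i (f - g) (a - b).
Proof. by move=> hf hg; apply/dehomD/dehomN. Qed.

Lemma dehom_x0X N : dehom N (x0 I ^+ N) 1.
Proof. by split; [apply: coord_deg_x0|rewrite rmorph1 mulr1 x0z_nat]. Qed.

Lemma dehomMx0 i k f a : dehom i f a -> dehom (i + k%:Z) (f * x0 I ^+ k) a.
Proof. by move=> /dehomM/(_ (dehom_x0X k)); rewrite mulr1. Qed.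

Lemma dehom1 : dehom 0 1 1. Proof. exact: (dehom_x0X 0). Qed.

Lemma dehom_const c : dehom 0 (const I c) (const0 I c).
Proof. by have := dehomZ c dehom1; rewrite mulr1 scale0E mulr1. Qed.

Lemma dehom_eq0 i f : dehom i f 0 -> f = 0.
Proof. by move=> h; apply: dehom_inj h (dehom0 i). Qed.

Lemma dehom0_eq i a : dehom i 0 a -> a = 0.
Proof. by move=> h; apply: dehom_eq h (dehom0 i). Qed.

Lemma dehom_neg N f a : dehom (Negz N) f a -> f = 0 /\ a = 0.
Proof. by move=> h; have [/coord_deg_neg f0 _] := h; move: h; rewrite f0 => /dehom0_eq. Qed.

(** The relation [reg_pow] divided by powers of x_0. It makes non-zerodivisors of S units, and
    nonunits nilpotent in every local component. *)
Lemma degree0_pow a : exists k b, a ^+ k * (1 - b * a) = 0.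
Proof.
have [N /(_ N (leqnn _))[f ha]] := dehom_repr a.
have [k [m [g [hg E]]]] := reg_pow rI ha.1.
have [b hb] := dehom_exists hg.
exists k, b.
have hX : dehom (N * k)%N%:Z (f ^+ k) (a ^+ k).
  elim: k {E} => [|k IH]; first by rewrite muln0; apply: dehom1.
  rewrite !exprS mulnS; exact: (dehomM ha IH).
have := dehomM hX (dehomB (dehom_x0X (m + N)%N) (dehomM hb ha)).
by rewrite E => /dehom0_eq.
Qed.

Lemma degree0_one : 1 <> 0 :> S.
Proof.
by move=> e; have := dehom_x0X 0; rewrite e => /dehom_eq0/(reg_one rI).
Qed.

Definition filtration i a : Prop := exists f, dehom i f a.

Lemma filtration0 i : filtration i 0. Proof. by exists 0; apply: dehom0. Qed.

Lemma filtrationD i a b : filtration i a -> filtration i b -> filtration i (a + b).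
Proof. by move=> [f hf] [g hg]; exists (f + g); apply: dehomD. Qed.

Lemma filtrationZ i c a : filtration i a -> filtration i (c *: a).
Proof. by move=> [f hf]; exists (const I c * f); apply: dehomZ. Qed.

Lemma filtrationM i j a b : filtration i a -> filtration j b -> filtration (i + j) (a * b).
Proof. by move=> [f hf] [g hg]; exists (f * g); apply: dehomM. Qed.

Lemma filtrationW i k a : filtration i a -> filtration (i + k%:Z) a.
Proof. by move=> [f hf]; exists (f * x0 I ^+ k); apply: dehomMx0. Qed.

Lemma filtration_ex a : exists N0, forall N, (N0 <= N)%N -> filtration N a.
Proof. by have [N0 h] := dehom_repr a; exists N0 => N /h. Qed.

End Representatives.

Lemma rmorph_pow_eq0 (A B : comPzRingType) (phi : {rmorphism A -> B}) a b k :
  a ^+ k * (1 - b * a) = 0 -> phi a ^+ k * (1 - phi b * phi a) = 0.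
Proof.
by move=> /(congr1 phi); rewrite rmorphM rmorphXn rmorphB rmorph1 rmorphM rmorph0.
Qed.

Section StalkMap.
Variables (K : fieldType) (n : nat) (I : ideal {mpoly K[n.+1]}).
Local Notation P := {mpoly K[n.+1]}.
Local Notation R := (coord_ring I).
Local Notation S := (degree0 I).
Implicit Types (f g : R) (a b : S) (i j : int) (N M : nat) (F G : P).
Hypothesis rI : x0_regular I.
Variable q : prime_idealr P.
Local Notation O := (stalk I q).
Local Notation D := (@stalk_denom K n I q).
Local Notation lo := (locmap D).

Lemma val_stalkB (x y : O) : val (x - y) = val x - val y.
Proof. exact: (raddfB (val : O -> _)). Qed.

Lemma val_stalkM (x y : O) : val (x * y) = val x * val y.
Proof. exact: (rmorphM (val : O -> _)). Qed.

Lemma val_stalk1 : val (1 : O) = 1. Proof. by []. Qed.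

Lemma val_stalk0 : val (0 : O) = 0. Proof. by []. Qed.

Lemma stalk_denomP N G : G \is N.-homog -> G \notin q -> coord I G \in D.
Proof. by move=> hG qG; apply/asboolP; exists G, N. Qed.

Lemma stalk_fracM N F G : F \is N.-homog -> G \is N.-homog -> G \notin q ->
  val (stalk_frac q (coord I F) (coord I G)) * lo (coord I G) = lo (coord I F).
Proof.
move=> hF hG qG; rewrite /stalk_frac insubdK.
  by apply: fraction_locmapM; apply: stalk_denomP hG qG.
by apply/asboolP; exists F, G, N.
Qed.

Lemma stalk_repr (x : O) : exists N F G,
  [/\ F \is N.-homog, G \is N.-homog, G \notin q &
      val x * lo (coord I G) = lo (coord I F)].
Proof.
have /asboolP[F [G [N [hF hG qG e]]]] := valP x.
exists N, F, G; split=> //; rewrite e; apply: fraction_locmapM.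
exact: stalk_denomP hG qG.
Qed.

Lemma stalk_eq G (x y : O) N : G \is N.-homog -> G \notin q ->
  val x * lo (coord I G) = val y * lo (coord I G) -> x = y.
Proof.
by move=> hG qG /loc_cancel e; apply/val_inj/e; apply: stalk_denomP hG qG.
Qed.

Hypothesis X0q : 'X_ord0 \notin q.

Lemma X0X_notin N : 'X_ord0 ^+ N \notin q.
Proof. by apply: contra X0q; apply: prime_idealX. Qed.

Lemma germM N f : coord_deg N%:Z f -> val (germ q N f) * lo (x0 I ^+ N) = lo f.
Proof.
move=> [F hF ->]; rewrite /germ -coord_x0X.
by apply: (stalk_fracM hF (X0X_homog K n N)); apply: X0X_notin.
Qed.

Lemma stalk_cancel N (x y : O) : val x * lo (x0 I ^+ N) = val y * lo (x0 I ^+ N) -> x = y.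
Proof.
rewrite -coord_x0X; apply: stalk_eq; first exact: (X0X_homog K n N).
exact: X0X_notin.
Qed.

(* The proof argument makes the ring morphism structure below canonical. *)
Definition stalk_map of 'X_ord0 \notin q := fun a : S =>
  let N := projT1 (cid (dehom_repr rI a)) in
  germ q N (projT1 (cid (projT2 (cid (dehom_repr rI a)) N (leqnn N)))) : O.
Local Notation gam := (stalk_map X0q).

Lemma stalk_mapM N f a : dehom N f a -> val (gam a) * lo (x0 I ^+ N) = lo f.
Proof.
move=> ha; rewrite /stalk_map; case: cid => M hM /=; case: cid => g hg /=.
have e : f * x0 I ^+ M = g * x0 I ^+ N.
  have := dehomMx0 rI M ha; have := dehomMx0 rI N hg.
  by rewrite [M%:Z + _]addrC => h h'; apply: dehom_inj h' h.
have uD : x0 I ^+ M \in D.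
  by rewrite -coord_x0X; apply: stalk_denomP (X0X_homog K n M) (X0X_notin M).
apply: (loc_cancel uD); rewrite -locmapM e locmapM mulrAC.
by rewrite (germM hg.1).
Qed.

Lemma stalk_mapE N f a : dehom N f a -> gam a = germ q N f.
Proof.
by move=> ha; apply: (@stalk_cancel N); rewrite (stalk_mapM ha) (germM ha.1).
Qed.

Fact stalk_map_zmod : zmod_morphism gam.
Proof.
move=> a b; have [N [f [g [ha hb]]]] := dehom_repr2 rI a b.
apply: (@stalk_cancel N); rewrite (stalk_mapM (dehomB ha hb)) locmapB.
by rewrite val_stalkB mulrBl !(stalk_mapM ha, stalk_mapM hb).
Qed.

Fact stalk_map_monoid : monoid_morphism gam.
Proof.
split=> [|a b].
  by apply: (@stalk_cancel 0); rewrite (stalk_mapM (dehom1 I)) val_stalk1 mul1r.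
have [N [f [g [ha hb]]]] := dehom_repr2 rI a b.
apply: (@stalk_cancel (N + N)); rewrite (stalk_mapM (dehomM rI ha hb)) exprD !locmapM.
by rewrite val_stalkM mulrACA (stalk_mapM ha) (stalk_mapM hb).
Qed.

HB.instance Definition _ := GRing.isZmodMorphism.Build S O gam stalk_map_zmod.
HB.instance Definition _ := GRing.isMonoidMorphism.Build S O gam stalk_map_monoid.

Lemma stalk_map_const c : gam (const0 I c) = stalk_const I q c.
Proof. exact: (stalk_mapE (dehom_const I c)). Qed.

Lemma stalk_mapZ c a : gam (c *: a) = stalk_const I q c * gam a.
Proof. by rewrite scale0E rmorphM /= stalk_map_const. Qed.

Lemma stalk_map_eq0 N f a : dehom N%:Z f a ->
  gam a = 0 <-> exists M G, [/\ G \is M.-homog, G \notin q & coord I G * f = 0].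
Proof.
move=> ha; split=> [a0|[M [G [hG qG e]]]].
  have : lo f = 0 by rewrite -(stalk_mapM ha) a0 val_stalk0 mul0r.
  by move=> /locmap_eq0[_ /asboolP[G [M [hG qG ->]]] e]; exists M, G.
apply: (@stalk_cancel N); rewrite (stalk_mapM ha) val_stalk0 mul0r; apply/locmap_eq0.
by exists (coord I G) => //; apply: stalk_denomP hG qG.
Qed.

Hypothesis Iq : {subset I <= q}.

Lemma stalk_map_unitP N G a : G \is N.-homog -> dehom N (coord I G) a ->
  (exists x, gam a * x = 1) -> G \notin q.
Proof.
move=> hG ha [x e]; have [M [F [H [hF hH qH eH]]]] := stalk_repr x.
have E : lo (coord I (G * F - 'X_ord0 ^+ N * H)) = 0.
  rewrite coordB !coordM coord_x0X locmapB !locmapM -eH -(stalk_mapM ha).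
  by rewrite mulrACA -val_stalkM e val_stalk1 mul1r subrr.
have /locmap_eq0[_ /asboolP[U [d [hU qU ->]]]] := E.
rewrite -coordM => /coord_eq0/Iq; rewrite prime_idealrM (negPf qU) /= => h.
apply: contra qH => Gq; have : 'X_ord0 ^+ N * H \in q.
  by rewrite -[_ * H](subKr (G * F)) rpredB // mulrC idealMr.
by rewrite prime_idealrM (negPf (X0X_notin N)).
Qed.

(** The stalk contains the inverse X_0^N / G; the point is that it comes from S. In a^k (1 - b a) =
    0 the factor a^k becomes invertible at [q], which leaves [gam b] as the inverse. *)
Lemma stalk_map_unit N G a : G \is N.-homog -> G \notin q -> dehom N (coord I G) a ->
  exists b, gam a * gam b = 1.
Proof.
move=> hG qG ha; have [k [b e]] := degree0_pow rI a.
have [y ey] : exists y, gam a * y = 1.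
  exists (stalk_frac q (coord I ('X_ord0 ^+ N)) (coord I G)).
  have qXG : 'X_ord0 ^+ N * G \notin q by rewrite prime_idealrM negb_or X0X_notin.
  apply: (stalk_eq (dhomogM (X0X_homog K n N) hG) qXG).
  rewrite val_stalkM coordM locmapM coord_x0X mulrACA (stalk_mapM ha).
  rewrite -coord_x0X (stalk_fracM (X0X_homog K n N) hG qG).
  by rewrite val_stalk1 mul1r mulrC.
exists b; have h := rmorph_pow_eq0 gam e.
have : y ^+ k * gam a ^+ k = 1 by rewrite -exprMn mulrC ey expr1n.
move=> yk; have := congr1 ( *%R (y ^+ k)) h; rewrite mulrA yk mul1r mulr0.
by move/eqP; rewrite subr_eq0 mulrC => /eqP.
Qed.

(** A fraction F / G is the image of F / x_0^N times the inverse of the image of G / x_0^N, and that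
    inverse is itself an image. *)
Lemma stalk_map_surj (x : O) : exists a, gam a = x.
Proof.
have [N [F [G [hF hG qG e]]]] := stalk_repr x.
have hF' : coord_deg N%:Z (coord I F) by exists F.
have hG' : coord_deg N%:Z (coord I G) by exists G.
have [a ha] := dehom_exists rI hF'; have [b hb] := dehom_exists rI hG'.
have [c ec] := stalk_map_unit hG qG hb; exists (a * c).
have E : x * gam b = gam a.
  by apply: (@stalk_cancel N); rewrite val_stalkM -mulrA (stalk_mapM ha) (stalk_mapM hb).
by rewrite rmorphM /= -E -mulrA ec mulr1.
Qed.

Lemma stalk_map_nonunit N G a : G \is N.-homog -> dehom N (coord I G) a ->
  nonunit (gam a) <-> G \in q.
Proof.
move=> hG ha; split=> [nu|Gq /(stalk_map_unitP hG ha)]; last by rewrite Gq.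
apply/negPn/negP => qG; apply: nu.
by have [b eb] := stalk_map_unit hG qG ha; exists (gam b).
Qed.

End StalkMap.

(* Otherwise comparing germs at different points unfolds the choice of representatives. *)
Global Opaque stalk_map.

Lemma rmorphMX_eq0 (A B : comPzRingType) (phi : {rmorphism A -> B}) a b k :
  phi a ^+ k = 0 -> phi ((b * a) ^+ k) = 0.
Proof. by move=> e; rewrite rmorphXn rmorphM exprMn e mulr0. Qed.

Section Components.
Variables (K : fieldType) (n : nat) (I : ideal {mpoly K[n.+1]}).
Local Notation P := {mpoly K[n.+1]}.
Local Notation R := (coord_ring I).
Local Notation S := (degree0 I).
Implicit Types (f g : R) (a b : S) (N M : nat) (F G : P).
Hypotheses (rI : x0_regular I) (hdim : zero_dimensional I).
Variables (s : nat) (p : 'I_s -> prime_idealr P).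
Hypotheses (hp : support_enum I p) (hX0 : forall j, 'X_ord0 \notin p j).
Hypothesis hloc : forall j, local_ring (stalk I (p j)).
Let Ihom := reg_homog rI.
Local Notation gam j := (stalk_map rI (hX0 j)).

Lemma support_sub j : {subset I <= p j}.
Proof. by have [h _ _] := hp; have [] := h j. Qed.

Lemma support_closed j : closed_point (p j).
Proof. by have [h _ _] := hp; have [] := h j. Qed.

(** The annihilator of a nonzero form contains no power of X_0, so it lies in some [p j], whereas a
    form with zero germ at [p j] is killed by a form outside [p j]. *)
Lemma stalk_map_joint_inj a : (forall j, gam j a = 0) -> a = 0.
Proof.
move=> a0; have [N /(_ N (leqnn _))[f ha]] := dehom_repr rI a.
suff f0 : f = 0 by apply: (dehom0_eq rI (i := N)); rewrite -f0.
apply: contrapT => nf; have hf := ha.1; have [E hE ef] := hf.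
pose J F := coord I F * f = 0.
have Jid : is_ideal J.
  rewrite /J; split=> [|u v|u v]; first by rewrite raddf0 mul0r.
    by rewrite raddfD /= mulrDl => -> ->; rewrite addr0.
  by rewrite coordM -mulrA => ->; rewrite mulr0.
have Jh F d : J F -> J (pihomog mdeg d F).
  rewrite /J ef -!coordM => /coord_eq0/(Ihom (N + d)); rewrite mulrC (pihomogMl _ _ hE).
  by rewrite leq_addr addKn mulrC => /coord_eq0.
have IJ : {in I, forall F, J F} by move=> F /coord_eq0; rewrite /J => ->; rewrite mul0r.
have JX k : ~ J ('X_ord0 ^+ k).
  by rewrite /J coord_x0X => /(x0X_nzd (reg_nzd rI)).
have [j [_ Jp]] := ideal_vanishes_at_point hdim hp Jid Jh IJ JX.
have [M [G [_ qG /Jp]]] := iffLR (stalk_map_eq0 _ _ ha) (a0 j).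
by rewrite (negPf qG).
Qed.

Lemma separating_form j k : k != j -> exists d F, [/\ F \is d.-homog, F \in p k & F \notin p j].
Proof.
move=> kj; apply: contrapT => no.
have sub : {subset p k <= p j}.
  move=> F Fk; have [N /(_ N (leqnn _)) ->] := sum_pihomog F.
  apply: rpred_sum => d _; apply/negPn/negP => nd; apply: no.
  exists d, (pihomog mdeg d F); split; first exact: pihomogP.
    by apply: (support_closed k).1.1.
  by [].
have := (support_closed k).2 _ (support_closed j).1 sub => sub'.
have [_ _ inj] := hp; case/eqP: kj; apply: inj => F.
by apply/idP/idP => [/sub|/sub'].
Qed.

Lemma nonunitM (A : comPzRingType) (x y : A) : nonunit x -> nonunit (y * x).
Proof. by move=> nx [z e]; apply: nx; exists (y * z); rewrite mulrCA mulrA. Qed.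

Lemma local_unit1B (A : comPzRingType) (x : A) : local_ring A -> nonunit x ->
  exists y, (1 - x) * y = 1.
Proof.
move=> [_ h] nx; apply: contrapT => n1; have := h _ _ n1 nx; apply.
by exists 1; rewrite subrK mulr1.
Qed.

Lemma local_pow_eq0 (A : comPzRingType) (x y : A) k : local_ring A -> nonunit x ->
  x ^+ k * (1 - y * x) = 0 -> x ^+ k = 0.
Proof.
move=> hA nx e; have [z ez] := local_unit1B hA (nonunitM (y := y) nx).
by rewrite -[LHS]mulr1 -ez mulrA e mul0r.
Qed.

(** A product [b] of dehomogenized separating forms is a unit at p_j and a nonunit, hence nilpotent,
    at the other points. From b^m (1 - c b) = 0 it follows that (c b)^m is 1 at p_j and 0
    elsewhere. *)
Lemma component_idempotent j :
  exists a, gam j a = 1 /\ forall k, k != j -> gam k a = 0.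
Proof.
have /choice[u hu] : forall k : 'I_s, exists b, (exists c, gam j b * gam j c = 1) /\
    (k != j -> nonunit (gam k b)).
  move=> k; have [->|kj] := eqVneq k j.
    by exists 1; split=> //; exists 1; rewrite !rmorph1 mulr1.
  have [d [F [hF Fk Fj]]] := separating_form kj.
  have hF' : coord_deg d%:Z (coord I F) by exists F.
  have [b hb] := dehom_exists rI hF'; exists b; split.
    exact: (stalk_map_unit rI (hX0 j) hF Fj hb).
  by move=> _; apply/(stalk_map_nonunit rI (hX0 k) (@support_sub k) hF hb).
pose b := \prod_k u k.
have bj : exists y, gam j b * y = 1.
  have /choice[v hv] := fun k => (hu k).1.
  exists (\prod_k gam j (v k)); rewrite rmorph_prod -big_split /=.
  by apply: big1 => k _; apply: hv.
have bk k : k != j -> nonunit (gam k b).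
  move=> kj; rewrite /b (bigD1 k) //= mulrC rmorphM /=.
  by apply: nonunitM; apply: (hu k).2.
have [m [c e]] := degree0_pow rI b.
exists ((c * b) ^+ m); split=> [|k kj].
  have := rmorph_pow_eq0 (gam j) e; have [y ey] := bj.
  move=> /(congr1 ( *%R (y ^+ m))); rewrite mulrA -exprMn [y * _]mulrC ey expr1n mul1r mulr0.
  by move/eqP; rewrite subr_eq0 => /eqP E; rewrite rmorphXn rmorphM /= -E expr1n.
have := local_pow_eq0 (hloc k) (bk k kj) (rmorph_pow_eq0 (gam k) e).
exact: rmorphMX_eq0.
Qed.

(** Together with [stalk_map_joint_inj] this is the isomorphism of S with the product of the stalks,
    used one factor at a time. *)
Lemma component_lift j (x : stalk I (p j)) :
  exists a, gam j a = x /\ forall k, k != j -> gam k a = 0.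
Proof.
have [a ea] := stalk_map_surj rI (hX0 j) x.
have [e [ej ek]] := component_idempotent j.
exists (e * a); split=> [|k kj]; first by rewrite rmorphM /= ej mul1r.
by rewrite rmorphM /= ek // mul0r.
Qed.

Lemma component_lift_uniq j a b : gam j a = gam j b ->
  (forall k, k != j -> gam k a = 0) -> (forall k, k != j -> gam k b = 0) -> a = b.
Proof.
move=> ej ha hb; apply/eqP; rewrite -subr_eq0; apply/eqP/stalk_map_joint_inj => k.
rewrite rmorphB /=; have [->|kj] := eqVneq k j; first by rewrite ej subrr.
by rewrite ha // hb // subrr.
Qed.

End Components.

(** * Maximal subschemes *)

Section StalkRestriction.
Variables (K : fieldType) (n : nat) (I J : ideal {mpoly K[n.+1]}).
Local Notation P := {mpoly K[n.+1]}.
Hypotheses (rI : x0_regular I) (IJ : {subset I <= J}).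
Variables (q : prime_idealr P) (X0q : 'X_ord0 \notin q).
Local Notation loI := (locmap (@stalk_denom K n I q)).
Local Notation loJ := (locmap (@stalk_denom K n J q)).
Local Notation gam := (stalk_map rI X0q).
Local Notation res := (@stalk_res K n I J q).
Implicit Types (a : degree0 I) (F G : P) (N M : nat).

Lemma coord_sub_eq0 F : coord I F = 0 -> coord J F = 0.
Proof. by move=> /coord_eq0/IJ/coord_eq0. Qed.

(** [stalk_res] uses representatives of numerator and denominator that need not be forms. Comparison
    with a presentation F / G by forms shows both that the fraction lies in the stalk and what its
    value is. *)
Lemma stalk_resM N F G (x : stalk I q) : F \is N.-homog -> G \is N.-homog -> G \notin q ->
  val x * loI (coord I G) = loI (coord I F) ->
  val (res x) * loJ (coord J G) = loJ (coord J F).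
Proof.
move=> hF hG qG ex.
pose A := repr (numer (val x)); pose B := repr (val (denomi (val x))).
have eA : numer (val x) = coord I A by rewrite /coord quotmap_repr.
have eB : val (denomi (val x)) = coord I B by rewrite /coord quotmap_repr.
have BI : coord I B \in @stalk_denom K n I q by rewrite -eB; apply: valP.
have exB : val x * loI (coord I B) = loI (coord I A).
  rewrite -eA -eB; have := frac_repr (val x).
  move: (numer _) (denomi _) => a d <-; rewrite [LHS]frac_mul; apply: frac_eq.
  by rewrite /= !mulr1.
have BJ : coord J B \in @stalk_denom K n J q.
  have /asboolP[H [d [hH qH e]]] := BI; apply/asboolP; exists H, d; split=> //.
  apply/eqP; rewrite -subr_eq0 -coordB; apply/eqP/coord_sub_eq0.
  by rewrite coordB e subrr.
have GJ : coord J G \in @stalk_denom K n J q by apply: stalk_denomP hG qG.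
have E : loJ (coord J A) * loJ (coord J G) = loJ (coord J F) * loJ (coord J B).
  have : loI (coord I (A * G - F * B)) = 0.
    by rewrite coordB !coordM locmapB !locmapM -ex -exB mulrAC subrr.
  move=> /locmap_eq0[_ /asboolP[U [d [hU qU ->]]]]; rewrite -coordM => /coord_sub_eq0 h.
  apply/eqP; rewrite -subr_eq0 -!locmapM -locmapB -!coordM -coordB; apply/eqP/locmap_eq0.
  by exists (coord J U); [apply: stalk_denomP hU qU|rewrite -coordM].
have frE : fraction (@stalk_denom K n J q) (coord J A) (coord J B) * loJ (coord J G) =
    loJ (coord J F).
  by apply: (loc_cancel BJ); rewrite mulrAC fraction_locmapM.
rewrite /stalk_res /stalk_frac -/A -/B insubdK //.
apply/asboolP; exists F, G, N; split=> //.
by apply: (loc_cancel GJ); rewrite frE fraction_locmapM.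
Qed.

Lemma stalk_res_surj y : exists x, res x = y.
Proof.
have [N [F [G [hF hG qG e]]]] := stalk_repr y.
exists (stalk_frac q (coord I F) (coord I G)); apply: (stalk_eq hG qG).
by rewrite e; apply: (stalk_resM hF hG qG); apply: (stalk_fracM I hF hG qG).
Qed.

Lemma stalk_res_mapM N F a : F \is N.-homog -> dehom N (coord I F) a ->
  val (res (gam a)) * loJ (x0 J ^+ N) = loJ (coord J F).
Proof.
move=> hF ha; rewrite -coord_x0X.
apply: (stalk_resM hF (X0X_homog K n N) (X0X_notin X0q N)).
by rewrite coord_x0X (stalk_mapM rI X0q ha).
Qed.

Lemma dehom_homog N f a : dehom N%:Z f a -> exists2 F, F \is N.-homog & f = coord I F.
Proof. by case. Qed.

Lemma stalk_res_mapB a b : res (gam (a - b)) = res (gam a) - res (gam b).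
Proof.
have [N [f [g [ha hb]]]] := dehom_repr2 rI a b.
have [F hF ef] := dehom_homog ha; have [G hG eg] := dehom_homog hb; subst f g.
apply: (@stalk_cancel _ _ _ _ X0q N).
have hFG : F - G \is N.-homog by apply: rpredB.
have hab : dehom N (coord I (F - G)) (a - b) by rewrite coordB; apply: dehomB.
rewrite (stalk_res_mapM hFG hab) val_stalkB mulrBl coordB locmapB.
by rewrite (stalk_res_mapM hF ha) (stalk_res_mapM hG hb).
Qed.

Lemma stalk_res_mapZ c a : res (gam (c *: a)) = stalk_const J q c * res (gam a).
Proof.
have [N /(_ N (leqnn _))[f ha]] := dehom_repr rI a.
have [F hF ef] := dehom_homog ha; subst f.
apply: (@stalk_cancel _ _ _ _ X0q N).
have hcF : c%:MP * F \is N.-homog by rewrite mul_mpolyC; apply: dhomogZ.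
have hca : dehom N (coord I (c%:MP * F)) (c *: a) by rewrite coordM; apply: dehomZ.
rewrite (stalk_res_mapM hcF hca) val_stalkM -mulrA (stalk_res_mapM hF ha) coordM locmapM.
congr (_ * _); have := germM X0q (coord_deg_const J c).
by rewrite expr0 rmorph1 mulr1.
Qed.

Lemma stalk_res_map_eq0 N F a : F \is N.-homog -> dehom N (coord I F) a ->
  res (gam a) = 0 <-> exists M U, [/\ U \is M.-homog, U \notin q & U * F \in J].
Proof.
move=> hF ha; have e := stalk_res_mapM hF ha; split=> [a0|[M [U [hU qU UF]]]].
  move: e; rewrite a0 val_stalk0 mul0r => /esym/locmap_eq0[_ /asboolP[U [M [hU qU ->]]]].
  by rewrite -coordM => /coord_eq0 UF; exists M, U.
apply: (@stalk_cancel _ _ _ _ X0q N); rewrite e val_stalk0 mul0r; apply/locmap_eq0.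
exists (coord J U); first exact: stalk_denomP hU qU.
by rewrite -coordM; apply/coord_eq0.
Qed.

End StalkRestriction.

Section Morphisms.
Variables (A B : comPzRingType) (phi : {rmorphism A -> B}).

Lemma rmorphM0l a b : phi a = 0 -> phi (a * b) = 0.
Proof. by rewrite rmorphM => ->; rewrite mul0r. Qed.

Lemma rmorphM0r a b : phi b = 0 -> phi (a * b) = 0.
Proof. by rewrite rmorphM => ->; rewrite mulr0. Qed.

Lemma rmorph_unit_eq0 u v a : phi u * v = 1 -> phi (u * a) = 0 -> phi a = 0.
Proof. by rewrite rmorphM => uv ua; rewrite -[LHS]mul1r -uv mulrAC ua mul0r. Qed.

End Morphisms.

Section MaximalSubscheme.
Variables (K : fieldType) (n : nat) (I : ideal {mpoly K[n.+1]}).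
Local Notation P := {mpoly K[n.+1]}.
Local Notation R := (coord_ring I).
Local Notation S := (degree0 I).
Implicit Types (a b : S) (N M d : nat) (F G : P).
Hypotheses (rI : x0_regular I) (hdim : zero_dimensional I).
Variables (s : nat) (p : 'I_s -> prime_idealr P).
Hypotheses (hp : support_enum I p) (hX0 : forall j, 'X_ord0 \notin p j).
Hypothesis hloc : forall j, local_ring (stalk I (p j)).
Let Ihom := reg_homog rI.
Local Notation gam j := (stalk_map rI (hX0 j)).

(** [J] collects the polynomials whose homogeneous parts become multiples of [t] after division by a
    power of x_0. It is saturated because multiplication by X_0^N does not change the
    dehomogenization. *)
Lemma principal_subscheme (t : S) : exists J : ideal P,
  [/\ subscheme_ideal J, {subset I <= J} &
    forall d F a, F \is d.-homog -> dehom d (coord I F) a ->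
      F \in J <-> exists y, a = y * t].
Proof.
pose B F := forall d, exists y, dehom d%:Z (coord I (pihomog mdeg d F)) (y * t).
pose Jp : pred P := fun F => `[< B F >].
have B0 F : F \in I -> B F.
  move=> FI d; exists 0; rewrite mul0r.
  by rewrite (iffRL (coord_eq0 _ _) (Ihom d FI)); apply: dehom0.
have BB F G : B F -> B G -> B (F - G).
  move=> hF hG d; have [y hy] := hF d; have [z hz] := hG d.
  exists (y - z); have -> : coord I (pihomog mdeg d (F - G)) =
      coord I (pihomog mdeg d F) - coord I (pihomog mdeg d G).
      by rewrite pihomogB; apply: coordB.
    by rewrite [_ * t]mulrBl; apply: dehomB hy hz.
have BM F G : B G -> B (F * G).
  move=> hG d; rewrite pihomogM.
  pose f i := pihomog mdeg i F; pose g i := pihomog mdeg i G.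
  suff h (r : seq 'I_d.+1) : exists y,
      dehom d%:Z (coord I (\sum_(i <- r) f i * g (d - i)%N)) (y * t) by apply: h.
  elim: r => [|i r [y hy]].
    by exists 0; rewrite big_nil mul0r coord0; apply: dehom0.
  have [z hz] := hG (d - i)%N.
  have hf : coord_deg (i : nat)%:Z (coord I (f i)) by exists (f i); rewrite //= pihomogP.
  have [a ha] := dehom_exists rI hf.
  have hD : dehom d%:Z (coord I (f i) * coord I (g (d - i)%N)) (a * (z * t)).
    have := dehomM rI ha hz; rewrite (_ : (i : nat)%:Z + _ = d%:Z) //.
    by have := ltn_ord i; lia.
  exists (a * z + y); have -> : (a * z + y) * t = a * (z * t) + y * t.
    by rewrite mulrDl mulrA.
  have -> : coord I (\sum_(i <- i :: r) f i * g (d - i)%N) =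
      coord I (f i) * coord I (g (d - i)%N) + coord I (\sum_(i <- r) f i * g (d - i)%N).
    by rewrite big_cons coordD coordM.
  exact: dehomD hD hy.
have Jz : zmod_closed Jp.
  split; first by apply/asboolP/B0/rpred0.
  by move=> F G /asboolP hF /asboolP hG; apply/asboolP/BB.
have Jm F : {in Jp, forall G, F * G \in Jp}.
  by move=> G /asboolP hG; apply/asboolP/BM.
pose J : ideal P := HB.pack (Jp : P -> bool) (GRing.isZmodClosed.Build P Jp Jz)
  (isMulAbsorbing.Build P Jp Jm).
have JE d F a : F \is d.-homog -> dehom d (coord I F) a ->
    F \in J <-> exists y, a = y * t.
  move=> hF ha; split=> [/asboolP/(_ d)[y]|[y ey]].
    by rewrite pihomog_dE // => hy; exists y; apply: (dehom_eq rI ha hy).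
  apply/asboolP => e; have [->|ne] := eqVneq e d.
    by exists y; rewrite pihomog_dE // -ey.
  by exists 0; rewrite (pihomog_ne0 _ hF) 1?eq_sym // mul0r coord0; apply: dehom0.
exists J; split=> //; last by move=> F FI; apply/asboolP/B0.
split=> [F d /asboolP hF|F [N hN]].
  apply/asboolP => e; have [->|ne] := eqVneq e d; first by rewrite pihomog_id.
  exists 0; rewrite (pihomog_ne0 _ (pihomogP _ _ _)) 1?eq_sym //.
  by rewrite mul0r coord0; apply: dehom0.
apply/asboolP => d; have /asboolP/(_ (N + d)%N)[y] := hN _ (X0X_homog K n N).
rewrite (pihomogMl _ _ (X0X_homog K n N)) leq_addr addKn coordM coord_x0X mulrC => hy.
have hf : coord_deg d%:Z (coord I (pihomog mdeg d F)).
  by exists (pihomog mdeg d F); rewrite //= pihomogP.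
have [a ha] := dehom_exists rI hf; exists y.
have := dehomMx0 rI N ha; rewrite addrC => /(dehom_eq rI)/(_ hy) <- //.
Qed.

Section Socle.
Variables (j : 'I_s) (t : S).
Hypothesis ht : forall k, k != j -> gam k t = 0.

Lemma principal_subscheme_stalks : exists J : ideal P,
  [/\ subscheme_ideal J, {subset I <= J},
      forall k a, k != j -> @stalk_res K n I J (p k) (gam k a) = 0 <-> gam k a = 0 &
      forall a, @stalk_res K n I J (p j) (gam j a) = 0 <->
        exists x, gam j a = x * gam j t].
Proof.
have [J [hJ IJ JE]] := principal_subscheme t.
(* Vanishing modulo [J] at p_k means lying in t S after multiplication by some [u] that is a unit at
   p_k. Below, the idempotent of the component serves as such a [u]. *)
have ker k a : stalk_res J (gam k a) = 0 <->
    exists2 u, (exists v, gam k u * gam k v = 1) & exists y, u * a = y * t.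
  have [N /(_ N (leqnn _))[f ha]] := dehom_repr rI a.
  have [F hF ef] := dehom_homog ha; subst f.
  rewrite (stalk_res_map_eq0 rI IJ (hX0 k) hF ha); split.
    move=> [M [U [hU qU UF]]].
    have hU' : coord_deg M%:Z (coord I U) by exists U.
    have [u hu] := dehom_exists rI hU'.
    exists u; first exact: (stalk_map_unit rI (hX0 k) hU qU hu).
    have hua := dehomM rI hu ha; rewrite -coordM in hua.
    exact/(JE _ _ _ (dhomogM hU hF) hua).
  move=> [u [v uv] [y uy]]; have [M /(_ M (leqnn _))[g hu]] := dehom_repr rI u.
  have [U hU eg] := dehom_homog hu; subst g; exists M, U; split=> //.
    apply: (stalk_map_unitP (rI := rI) (X0q := hX0 k) (@support_sub _ _ _ _ _ hp k) hU hu).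
    by exists (gam k v).
  have hua := dehomM rI hu ha; rewrite -coordM in hua.
  by apply/(JE _ _ _ (dhomogM hU hF) hua); exists y.
exists J; split=> // [k a kj|a].
  split=> [/ker[u [v uv] [y uy]]|a0].
    apply: (rmorph_unit_eq0 (phi := gam k) uv); rewrite uy.
    exact: (rmorphM0r _ (ht kj)).
  apply/ker; have [e [ek el]] := component_idempotent rI hp hX0 hloc k.
  exists e; first by exists 1; rewrite ek rmorph1 mulr1.
  exists 0; rewrite mul0r; apply: (stalk_map_joint_inj (rI := rI) hdim hp (hX0 := hX0)) => l.
  have [->|lk] := eqVneq l k; first exact: (rmorphM0r _ a0).
  exact: (rmorphM0l _ (el l lk)).
split=> [/ker[u [v uv] [y uy]]|[x ex]].
  exists (gam j v * gam j y).
  have := congr1 (gam j) uy; rewrite 2!rmorphM /= => E; rewrite -mulrA -E mulrA.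
  by rewrite [gam j v * _]mulrC uv mul1r.
apply/ker; have [e [ej el]] := component_idempotent rI hp hX0 hloc j.
have [y ey] := stalk_map_surj rI (hX0 j) x.
exists e; first by exists 1; rewrite ej rmorph1 mulr1.
exists y; apply: (component_lift_uniq (rI := rI) hdim hp (hX0 := hX0) (j := j)).
- by rewrite !rmorphM /= ej mul1r ex ey.
- by move=> k kj; exact: (rmorphM0l _ (el k kj)).
- by move=> k kj; exact: (rmorphM0r _ (ht kj)).
Qed.

End Socle.
End MaximalSubscheme.

(** * Degrees and the Cayley-Bacharach property *)

Section LinearAlgebra.
Variable K : fieldType.

Lemma linear_of (V W : lmodType K) (f : V -> W) :
  (forall x y, f (x + y) = f x + f y) -> (forall c x, f (c *: x) = c *: f x) ->
  exists L : {linear V -> W}, forall x, L x = f x.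
Proof.
move=> fD fZ.
have fB : zmod_morphism f by move=> x y; rewrite -scaleN1r fD fZ scaleN1r.
pose L : {linear V -> W} := HB.pack f (GRing.isZmodMorphism.Build V W f fB)
  (GRing.isScalable.Build K V W *:%R f fZ).
by exists L.
Qed.

Lemma vector_axiom_of_injection (V : lmodType K) m (Phi : {linear V -> 'rV[K]_m}) :
  injective Phi -> exists D, inhabited (Vector.axiom D V).
Proof.
move=> Pinj; have [|||U hU] := @vspace_of_pred K 'rV[K]_m (fun w => exists v, Phi v = w).
- by exists 0; rewrite raddf0.
- by move=> _ _ [x <-] [y <-]; exists (x + y); rewrite raddfD.
- by move=> c _ [x <-]; exists (c *: x); rewrite linearZ.
have PU x : Phi x \in U by apply/hU; exists x.
pose f x : 'rV[K]_(\dim U) := \row_i vector.coord (vbasis U) i (Phi x).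
exists (\dim U); split; exists f.
  by move=> c x y; apply/rowP => i; rewrite !mxE !linearP.
have /choice[g hg] : forall r : 'rV[K]_(\dim U), exists x, f x = r.
  move=> r; have [|x ex] := iffLR (hU (\sum_i r 0 i *: (vbasis U)`_i)).
    by apply: memv_suml => i _; apply/memvZ/vbasis_mem/mem_nth; rewrite size_tuple.
  by exists x; apply/rowP => i; rewrite mxE ex coord_sum_free ?(basis_free (vbasisP U)).
exists g => // x; apply: Pinj; rewrite (coord_vbasis (PU _)) [RHS](coord_vbasis (PU _)).
apply: eq_bigr => i _; congr (_ *: _).
by have /rowP/(_ i) := hg (f x); rewrite !mxE.
Qed.

Variable V : vectType K.

Lemma hyperplane_functional (U : {vspace V}) : \dim {:V} = (\dim U).+1 ->
  exists lam : {linear V -> K^o}, forall x, x \in U <-> lam x = 0.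
Proof.
move=> dU; have dC : \dim U^C = 1%N by rewrite dimv_compl dU subSnn.
pose w := vpick U^C; have w0 : w != 0 by rewrite vpick0 -dimv_eq0 dC.
have wC : <[w]>%VS = U^C%VS.
  by apply/eqP; rewrite eqEdim -memvE memv_pick dC dim_vline w0.
have wU : (<[w]> :&: U = 0)%VS by rewrite wC capvC capv_compl.
have Uw : (U :&: <[w]> = 0)%VS by rewrite capvC.
have wUf x : x \in (<[w]> + U)%VS by rewrite wC addvC addv_complf memvf.
pose f (x : V) : K^o := vector.coord [tuple w] ord0 (daddv_pi <[w]> U x).
have [lam hlam] : exists L : {linear V -> K^o}, forall x, L x = f x.
  by apply: linear_of => [x y|c x]; rewrite /f ?linearD ?linearZ.
exists lam => x; rewrite hlam /f; have piw : daddv_pi <[w]> U x \in <[w]>%VS by apply: memv_pi.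
have e : daddv_pi <[w]> U x = vector.coord [tuple w] ord0 (daddv_pi <[w]> U x) *: w.
  have h : daddv_pi <[w]> U x \in <<[tuple w]>>%VS by rewrite span_seq1.
  by rewrite {1}(coord_span h) big_ord1.
split=> [xU|x0].
  have := daddv_pi_add wU (wUf x); rewrite (daddv_pi_id Uw xU) -[RHS]add0r.
  by move=> /addIr ->; rewrite linear0.
have := daddv_pi_add wU (wUf x); rewrite e x0 scale0r add0r => <-; exact: memv_pi.
Qed.

Lemma nondegenerate_riesz (B : V -> {linear V -> K^o}) :
  (forall x y z, B (x + y) z = B x z + B y z) ->
  (forall c x z, B (c *: x) z = c * B x z) ->
  (forall x, (forall y, B x y = 0) -> x = 0) ->
  forall lam : {linear V -> K^o}, exists g, forall x, lam x = B g x.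
Proof.
move=> BD BZ Bnd lam.
have [L hL] : exists L : {linear V -> 'Hom(V, K^o)}, forall x, L x = linfun (B x).
  apply: linear_of => [x y|c x]; apply/lfunP => z.
    by rewrite add_lfunE !lfunE /= BD.
  by rewrite scale_lfunE !lfunE /= BZ.
have k0 : lker (linfun L) == 0%VS.
  apply/lker0P => x y; rewrite !lfunE /= => /eqP; rewrite -subr_eq0 -linearB hL => /eqP e.
  apply/eqP; rewrite -subr_eq0; apply/eqP/Bnd => z.
  by have /lfunP/(_ z) := e; rewrite lfunE /= zero_lfunE.
have dL : \dim (limg (linfun L)) = \dim {:V} by apply: limg_dim_eq; rewrite (eqP k0) capv0.
have : linfun lam \in limg (linfun L).
  suff -> : limg (linfun L) = fullv by rewrite memvf.
  by apply/eqP; rewrite eqEdim subvf dL !dimvf /= /dim /= muln1.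
move=> /memv_imgP[g _ e]; exists g => x.
by have /lfunP/(_ x) := e; rewrite !lfunE /= hL lfunE.
Qed.

End LinearAlgebra.

Section Dimensions.
Variables (K : fieldType) (n : nat) (I : ideal {mpoly K[n.+1]}).
Local Notation P := {mpoly K[n.+1]}.
Local Notation R := (coord_ring I).
Local Notation S := (degree0 I).
Variables (D : nat) (ax : Vector.axiom D S).

(** Finite dimension of S is a theorem depending on the trace map, so the [vectType] structure is
    put on a copy of S indexed by the proof [ax]. *)
Definition degree0_vect of Vector.axiom D S := S.
HB.instance Definition _ := GRing.Lmodule.on (degree0_vect ax).
HB.instance Definition _ := Lmodule_hasFinDim.Build K (degree0_vect ax) ax.
Local Notation V := (degree0_vect ax).

Implicit Types (a b t : S) (N M : nat) (i : int).
Hypotheses (rI : x0_regular I) (hdim : zero_dimensional I).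
Variables (s : nat) (p : 'I_s -> prime_idealr P).
Hypotheses (hp : support_enum I p) (hX0 : forall j, 'X_ord0 \notin p j).
Hypothesis hloc : forall j, local_ring (stalk I (p j)).
Local Notation gam j := (stalk_map rI (hX0 j)).
Local Notation dimS := (\dim {:V}).

Lemma subspace_of_pred (B : S -> Prop) :
  B 0 -> (forall x y, B x -> B y -> B (x + y)) -> (forall c x, B x -> B (c *: x)) ->
  exists U : {vspace V}, forall x : S, (x : V) \in U <-> B x.
Proof. exact: (@vspace_of_pred K V). Qed.

Lemma filtration_vspace i : exists U : {vspace V}, forall x : S, (x : V) \in U <-> filtration i x.
Proof.
apply: subspace_of_pred.
- exact: filtration0.
- exact: filtrationD.
- exact: filtrationZ.
Qed.

Lemma HF_dim i (U : {vspace V}) : (forall x : S, (x : V) \in U <-> filtration i x) ->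
  HF I i = \dim U.
Proof.
move=> hU; have /choice[f hf] : forall x : V, exists f : R, filtration i x -> dehom i f x.
  move=> x; have [[f hf]|nf] := pselect (filtration i x); first by exists f.
  by exists 0.
have hfU (x : V) : x \in U -> dehom i (f x) x by move=> /hU/hf.
transitivity (\dim U - \dim (0%VS : {vspace V}))%N; last by rewrite dimv0 subn0.
apply: (@dim_mod_map K V R (const I) f U 0%VS).
- exact: sub0v.
- by move=> x /hfU[].
- move=> g hg; have [x hx] := dehom_exists rI hg.
  have xU : (x : V) \in U by apply/hU; exists g.
  by exists x => //; apply: dehom_inj (hfU _ xU) hx.
- move=> x y xU yU; apply: (@dehom_inj _ _ _ i _ _ (x - y)).
    by apply: hfU; rewrite memvB.
  by apply: (dehomB (hfU _ xU) (hfU _ yU)).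
- move=> c x xU; apply: (@dehom_inj _ _ _ i _ _ (c *: x)).
    by apply: hfU; rewrite memvZ.
  by apply: (dehomZ c (hfU _ xU)).
- move=> x xU; rewrite memv0; split=> [e|/eqP e].
    by have := hfU _ xU; rewrite e => /(dehom0_eq rI)/eqP.
  by have := hfU _ xU; rewrite {2}e => /dehom_eq0.
Qed.

Lemma filtration_full : exists N0, forall N, (N0 <= N)%N -> forall x : S, filtration N x.
Proof.
pose b (k : nat) := (vbasis {:V})`_k : V.
have /choice[Nb hNb] : forall k, exists N0, forall N, (N0 <= N)%N -> filtration N (b k : S).
  by move=> k; apply: (filtration_ex rI).
exists (\sum_(i < \dim {:V}) Nb i)%N => N hN x.
have [U hU] := filtration_vspace N; apply/hU.
rewrite (coord_vbasis (memvf (x : V))); apply: memv_suml => k _; apply/memvZ/hU/hNb.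
by apply: leq_trans hN; rewrite (bigD1 k) //= leq_addr.
Qed.

Section Quotients.
Variables (J : ideal P) (IJ : {subset I <= J}) (j : 'I_s).
Local Notation res := (@stalk_res K n I J (p j)).

Lemma stalk_dim_res (U : {vspace V}) :
  (forall x : S, (x : V) \in U <-> res (gam j x) = 0) ->
  stalk_dim J (p j) = (dimS - \dim U)%N.
Proof.
move=> hU; pose f (x : V) := res (gam j x).
have h1 : (U <= fullv)%VS by apply: subvf.
have h3 (y : stalk J (p j)) : True -> exists2 a : V, a \in fullv & f a = y.
  have [x <-] := stalk_res_surj IJ y => _; have [a <-] := stalk_map_surj rI (hX0 j) x.
  by exists a; [apply: memvf|].
have h4 : {in fullv &, {morph f : x y / x - y}}.
  by move=> x y _ _; apply: (stalk_res_mapB rI IJ).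
have h5 c : {in fullv, forall x : V, f (c *: x) = stalk_const J (p j) c * f x}.
  by move=> x _; apply: (stalk_res_mapZ rI IJ).
have h6 (x : V) : x \in fullv -> f x = 0 <-> x \in U by rewrite hU.
exact: (dim_mod_map (A := stalk J (p j)) (k := @stalk_const K n J (p j)) (phi := f) (V' := fun=> True) (W' := fun y => y = 0) h1 (fun _ _ => Logic.I) h3 h4 h5 h6).
Qed.

End Quotients.

Section Stalks.
Variable j : 'I_s.

Lemma stalk_dim_map (U : {vspace V}) : (forall x : S, (x : V) \in U <-> gam j x = 0) ->
  stalk_dim I (p j) = (dimS - \dim U)%N.
Proof.
move=> hU; pose f (x : V) := gam j x.
have h1 : (U <= fullv)%VS by apply: subvf.
have h3 (x : stalk I (p j)) : True -> exists2 a : V, a \in fullv & f a = x.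
  by move=> _; have [a <-] := stalk_map_surj rI (hX0 j) x; exists a; [apply: memvf|].
have h4 : {in fullv &, {morph f : x y / x - y}} by move=> x y _ _; apply: rmorphB.
have h5 c : {in fullv, forall x : V, f (c *: x) = stalk_const I (p j) c * f x}.
  by move=> x _; apply: stalk_mapZ.
have h6 (x : V) : x \in fullv -> f x = 0 <-> x \in U by rewrite hU.
exact: (dim_mod_map (A := stalk I (p j)) (k := @stalk_const K n I (p j)) (phi := f) (V' := fun=> True) (W' := fun y => y = 0) h1 (fun _ _ => Logic.I) h3 h4 h5 h6).
Qed.

Lemma nonunit_vspace : exists U : {vspace V}, forall x : S,
  (x : V) \in U <-> nonunit (gam j x).
Proof.
apply: subspace_of_pred.
- rewrite rmorph0 => -[y]; rewrite mul0r => /esym.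
  by have [h _] := hloc j.
- by move=> x y hx hy; rewrite rmorphD; apply: (hloc j).2.
- by move=> c x hx; rewrite stalk_mapZ; apply: nonunitM.
Qed.

Lemma kernel_vspace : exists U : {vspace V}, forall x : S, (x : V) \in U <-> gam j x = 0.
Proof.
apply: subspace_of_pred; first exact: rmorph0.
- by move=> x y hx hy; rewrite rmorphD /= hx hy addr0.
- by move=> c x hx; rewrite stalk_mapZ hx mulr0.
Qed.

Lemma residue_dim_map (U : {vspace V}) :
  (forall x : S, (x : V) \in U <-> nonunit (gam j x)) ->
  residue_dim I (p j) = (dimS - \dim U)%N /\
  exists e : 'I_(residue_dim I (p j)) -> stalk I (p j), residue_basis e.
Proof.
move=> hU; pose f (x : V) := gam j x.
have h1 : (U <= fullv)%VS by apply: subvf.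
have h3 (x : stalk I (p j)) : True -> exists2 a : V, a \in fullv & f a = x.
  by move=> _; have [a <-] := stalk_map_surj rI (hX0 j) x; exists a; [apply: memvf|].
have h4 : {in fullv &, {morph f : x y / x - y}} by move=> x y _ _; apply: rmorphB.
have h5 c : {in fullv, forall x : V, f (c *: x) = stalk_const I (p j) c * f x}.
  by move=> x _; apply: stalk_mapZ.
have h6 (x : V) : x \in fullv -> nonunit (f x) <-> x \in U by rewrite hU.
have E : residue_dim I (p j) = (dimS - \dim U)%N.
  exact: (dim_mod_map (A := stalk I (p j)) (k := @stalk_const K n I (p j)) (phi := f) (V' := fun=> True) (W' := @nonunit _) h1 (fun _ _ => Logic.I) h3 h4 h5 h6).
split=> //; rewrite E.
exact: (basis_mod_map (A := stalk I (p j)) (k := @stalk_const K n I (p j)) (phi := f) (V' := fun=> True) (W' := @nonunit _) h1 (fun _ _ => Logic.I) h3 h4 h5 h6).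
Qed.

End Stalks.
End Dimensions.

(** Nakayama's lemma for one element: 1 - c y is a unit of the local ring when y is a nonunit
    there. *)
Lemma rmorph_local_fix (A B : comPzRingType) (phi : {rmorphism A -> B}) y c t :
  local_ring B -> nonunit (phi y) -> t = c * (y * t) -> phi t = 0.
Proof.
move=> hB ny et; have [z ez] := local_unit1B hB (nonunitM (y := phi c) ny).
have h : phi t = phi c * (phi y * phi t) by rewrite -!rmorphM -et.
have h0 : (1 - phi c * phi y) * phi t = 0 by rewrite mulrBl mul1r -mulrA -h subrr.
by rewrite -[LHS]mul1r -ez mulrAC h0 mul0r.
Qed.

Lemma sum_replace m (F G : 'I_m -> nat) j r : (forall k, k != j -> F k = G k) ->
  (F j + r = G j -> \sum_k F k + r = \sum_k G k)%N.
Proof.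
move=> h e; rewrite (bigD1 j) //= [RHS](bigD1 j) //= (eq_bigr G) //; lia.
Qed.

Section MorphismIdentities.
Variables (A B : comPzRingType) (phi : {rmorphism A -> B}).

Lemma rmorphD0M u y t : phi u = 0 -> phi (u + y * t) = phi y * phi t.
Proof. by rewrite rmorphD rmorphM => ->; rewrite add0r. Qed.

Lemma rmorphB_mul x y t z : phi y = z -> phi x = z * phi t -> phi (x - y * t) = 0.
Proof. by move=> <- e; rewrite rmorphB rmorphM e subrr. Qed.

Lemma rmorph_ann y t : y * t = 0 -> phi y * phi t = 0.
Proof. by rewrite -rmorphM => ->; rewrite rmorph0. Qed.

End MorphismIdentities.

Section MorphismSums.
Variables (A B : comPzRingType) (phi : {rmorphism A -> B}) (T : finType) (F : T -> A).

Lemma rmorph_sum_single j : \sum_l F l = 0 -> (forall l, l != j -> phi (F l) = 0) ->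
  phi (F j) = 0.
Proof.
by move=> + hl => /(congr1 phi); rewrite rmorph0 rmorph_sum (bigD1 j) //= big1 ?addr0.
Qed.

Lemma rmorphB_sum_single j x : phi (F j) = phi x -> (forall l, l != j -> phi (F l) = 0) ->
  phi (x - \sum_l F l) = 0.
Proof.
by move=> hj hl; rewrite rmorphB rmorph_sum (bigD1 j) //= big1 ?addr0 ?hj ?subrr.
Qed.

End MorphismSums.

(** * Degree of the scheme, socle elements and maximal subschemes *)

Section Degree.
Variables (K : fieldType) (n : nat) (I : ideal {mpoly K[n.+1]}).
Local Notation P := {mpoly K[n.+1]}.
Local Notation R := (coord_ring I).
Local Notation S := (degree0 I).
Variables (D : nat) (ax : Vector.axiom D S).
Local Notation V := (degree0_vect ax).
Implicit Types (a b t : S) (N M : nat) (i : int).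
Hypotheses (rI : x0_regular I) (hdim : zero_dimensional I).
Variables (s : nat) (p : 'I_s -> prime_idealr P).
Hypotheses (hp : support_enum I p) (hX0 : forall j, 'X_ord0 \notin p j).
Hypothesis hloc : forall j, local_ring (stalk I (p j)).
Local Notation gam j := (stalk_map rI (hX0 j)).
Local Notation dimS := (\dim {:V}).

Definition supported_at j a := forall k, k != j -> gam k a = 0.

Lemma supported_vspace j : exists U : {vspace V}, forall x : S, (x : V) \in U <-> supported_at j x.
Proof.
apply: subspace_of_pred => [k kj|x y hx hy k kj|c x hx k kj]; first exact: rmorph0.
- by rewrite rmorphD /= (hx k kj) (hy k kj) addr0.
- by rewrite stalk_mapZ (hx k kj) mulr0.
Qed.

(** S is the direct sum of the subspaces [C j] of elements supported at one point, and [C j] maps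
    isomorphically onto the stalk at p_j. *)
Lemma degree_eq : degree p I = dimS.
Proof.
have /choice[C hC] := supported_vspace.
have /choice[U hU] := fun j => kernel_vspace ax rI hX0 j.
have dC j : stalk_dim I (p j) = \dim (C j).
  rewrite (stalk_dim_map (rI := rI) (hX0 := hX0) (hU j)).
  have CU : (C j :&: U j)%VS = 0%VS.
    apply/eqP; rewrite -subv0; apply/subvP => x; rewrite memv_cap => /andP[/hC xC /hU xU].
    rewrite memv0; apply/eqP/(stalk_map_joint_inj (rI := rI) hdim hp (hX0 := hX0)) => k.
    by have [->|kj] := eqVneq k j; [exact: xU|exact: xC k kj].
  have CUf : (C j + U j)%VS = fullv.
    apply/eqP; rewrite eqEsubv subvf /=; apply/subvP => x _.
    have [y [yj yk]] := component_lift rI hp hX0 hloc (gam j x).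
    rewrite -[x](subrK (y : V)) addrC; apply: memv_add; first exact/hC.
    by apply/hU; rewrite rmorphB /= yj subrr.
  by rewrite -CUf (dimv_disjoint_sum CU) addnK.
have Cf : (\sum_j C j)%VS = fullv.
  apply/eqP; rewrite eqEsubv subvf /=; apply/subvP => x _.
  have /choice[y hy] := fun j => component_lift rI hp hX0 hloc (gam j x).
  have -> : x = \sum_j y j :> S.
    apply/eqP; rewrite -subr_eq0; apply/eqP/(stalk_map_joint_inj (rI := rI) hdim hp (hX0 := hX0)) => k.
    apply: (rmorphB_sum_single (phi := gam k) (hy k).1) => j jk.
    by apply: (hy j).2; rewrite eq_sym.
  by apply: memv_sumr => j _; apply/hC; exact: (hy j).2.
rewrite -Cf; have /directvP -> : directv (\sum_j C j).
  apply/directv_sum_independent => u hu u0 j _.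
  have hu' l : supported_at l (u l) := iffLR (hC l _) (hu l isT).
  apply: (stalk_map_joint_inj (rI := rI) hdim hp (hX0 := hX0)) => k.
  have [->|kj] := eqVneq k j; last exact: hu' j k kj.
  have u0' : \sum_l (u l : S) = 0 :> S := u0.
  apply: (rmorph_sum_single (phi := gam j) u0') => l lj.
  by apply: (hu' l j); rewrite eq_sym.
by rewrite /degree /=; apply: eq_bigr => j _; apply: dC.
Qed.

Lemma mul_linear t : exists L : {linear V -> V}, forall a, L a = a * t :> S.
Proof.
apply: (@linear_of K V V (fun a : S => a * t : S)) => [x y|c x]; first exact: mulrDl.
by rewrite scale0E [RHS]scale0E -[RHS]/(_ * (_ * t)) mulrA.
Qed.

(** Take t nonzero, supported at p_j, with t S of least dimension. If y t were nonzero for a nonunit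
    y at p_j, minimality would give y t S = t S, so t would be a multiple of y t and vanish by
    [rmorph_local_fix]. *)
Lemma socle_exists j : exists t, [/\ t <> 0, supported_at j t &
  forall y, nonunit (gam j y) -> y * t = 0].
Proof.
have /choice[L hL] := mul_linear.
pose A d := `[< exists t, [/\ t <> 0, supported_at j t & \dim (limg (linfun (L t))) = d] >].
have A0 : exists d, A d.
  have [e [ej ek]] := component_idempotent rI hp hX0 hloc j.
  exists (\dim (limg (linfun (L e)))); apply/asboolP; exists e; split=> // e0.
  by move: ej; rewrite e0 rmorph0 => /esym; have [h _] := hloc j.
case: (ex_minnP A0) => d /asboolP[t [t0 tC td]] dmin; exists t; split=> // y ny.
apply: contrapT => yt0.
have ytC : supported_at j (y * t).
  by move=> k kj; exact: (rmorphM0r _ (tC k kj)).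
have : A (\dim (limg (linfun (L (y * t))))) by apply/asboolP; exists (y * t).
move=> /dmin; rewrite -td => le.
have sub : (limg (linfun (L (y * t))) <= limg (linfun (L t)))%VS.
  apply/subvP => _ /memv_imgP[x _ ->]; rewrite lfunE /= hL.
  by apply/memv_imgP; exists (x * y : S); rewrite ?memvf // lfunE /= hL mulrA.
have /eqP E : limg (linfun (L (y * t))) == limg (linfun (L t)).
  by rewrite eqEdim sub le.
have : (t : V) \in limg (linfun (L t)).
  by apply/memv_imgP; exists (1 : S); rewrite ?memvf // lfunE /= hL mul1r.
rewrite -E => /memv_imgP[c _]; rewrite lfunE /= hL => et.
apply: t0; apply: (stalk_map_joint_inj (rI := rI) hdim hp (hX0 := hX0)) => k.
have [->|kj] := eqVneq k j; last exact: tC k kj.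
exact: (rmorph_local_fix (phi := gam j) (hloc j) ny et).
Qed.

Section Socle.
Variables (j : 'I_s) (t : S).
Hypotheses (t0 : t <> 0) (tC : supported_at j t)
  (tS : forall y, nonunit (gam j y) -> y * t = 0).

(** The annihilator of t consists of the elements that are nonunits at p_j, so t S has the dimension
    of the residue field; this is exactly the drop in degree that maximality asks for. *)
Lemma maximal_subscheme_exists : exists J : ideal P, max_subscheme I p j J /\
  forall x, @stalk_res K n I J (p j) x = 0 <-> exists z, x = z * gam j t.
Proof.
have [J [hJ IJ hk hj]] := principal_subscheme_stalks (rI := rI) hdim hp (hX0 := hX0) hloc tC.
exists J; split; last first.
  by move=> x; have [a <-] := stalk_map_surj rI (hX0 j) x; exact: hj.
have gt0 : gam j t <> 0.
  move=> e; apply: t0; apply: (stalk_map_joint_inj (rI := rI) hdim hp (hX0 := hX0)) => k.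
  by have [->|kj] := eqVneq k j; [exact: e|exact: tC k kj].
have annt (y : S) : y * t = 0 <-> nonunit (gam j y).
  split=> [yt|]; last exact: tS.
  move=> [z yz]; apply: gt0; rewrite -[LHS]mul1r -yz mulrAC -rmorphM /= yt rmorph0.
  exact: mul0r.
split=> //.
- move=> k kj; have inj : injective (@stalk_res K n I J (p k)).
    move=> x y; have [a <-] := stalk_map_surj rI (hX0 k) x.
    have [b <-] := stalk_map_surj rI (hX0 k) y => e.
    have : stalk_res J (gam k (a - b)) = 0 by rewrite (stalk_res_mapB rI IJ) e subrr.
    by move=> /(hk _ _ kj)/eqP; rewrite rmorphB /= subr_eq0 => /eqP.
  have /choice[g hg] := @stalk_res_surj K n I J IJ (p k).
  by exists g => x; [apply: inj; exact: hg|exact: hg].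
- exact: stalk_res_surj.
have [L hL] := mul_linear t.
have [NU hNU] := nonunit_vspace ax rI hX0 hloc j.
have [U hU] := kernel_vspace ax rI hX0 j.
have [rd _] := residue_dim_map hNU.
have UL : (U :&: limg (linfun L))%VS = 0%VS.
  apply/eqP; rewrite -subv0; apply/subvP => x; rewrite memv_cap => /andP[/hU xU].
  move=> /memv_imgP[y _]; rewrite lfunE /= hL => ex.
  rewrite memv0; apply/eqP/(stalk_map_joint_inj (rI := rI) hdim hp (hX0 := hX0)) => k.
  have [->|kj] := eqVneq k j; first exact: xU.
  by rewrite ex; exact: (rmorphM0r _ (tC kj)).
pose UJ := (U + limg (linfun L))%VS.
have hUJ (x : S) : (x : V) \in UJ <-> stalk_res J (gam j x) = 0.
  rewrite hj; split=> [/memv_addP[u /hU u0 [_ /memv_imgP[y _ ->]]]|[z ez]].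
    rewrite lfunE /= hL => ->; exists (gam j y).
    exact: (rmorphD0M (phi := gam j) y t u0).
  have [y ey] := stalk_map_surj rI (hX0 j) z.
  rewrite -[x](subrK (y * t)); apply: memv_add.
    apply/hU; exact: (rmorphB_mul (phi := gam j) ey ez).
  apply/memv_imgP; exists (y : V); [exact: memvf|rewrite lfunE; exact: esym (hL y)].
have dL : \dim (limg (linfun L)) = (dimS - \dim NU)%N.
  have -> : NU = lker (linfun L).
    apply/eqP; rewrite eqEsubv; apply/andP; split; apply/subvP => x.
      by move=> /hNU/annt e; rewrite memv_ker lfunE /= hL e.
    by rewrite memv_ker lfunE /= hL => /eqP/annt/hNU.
  by rewrite -(limg_ker_dim (linfun L) fullv) capfv addKn.
have dJ : stalk_dim J (p j) = (dimS - \dim UJ)%N := stalk_dim_res IJ hUJ.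
have dI := stalk_dim_map hU.
have leUJ : (\dim UJ <= dimS)%N by apply: dimvS; apply: subvf.
have dUJ : \dim UJ = (\dim U + \dim (limg (linfun L)))%N by rewrite /UJ (dimv_disjoint_sum UL).
apply: (@sum_replace s (fun k => stalk_dim J (p k)) (fun k => stalk_dim I (p k)) j).
  move=> k kj; have [Uk hUk] := kernel_vspace ax rI hX0 k.
  rewrite (stalk_dim_map hUk); apply: (stalk_dim_res (rI := rI) (hX0 := hX0) IJ) => x.
  exact: iff_trans (hUk x) (iff_sym (hk k x kj)).
rewrite dJ dI rd -dL; move: leUJ; rewrite dUJ; lia.
Qed.

(** The last clause bounds the degree by every M with t S inside F_M. Conversely, by
    [mu_subscheme_filtration] a degree m yields a nonzero ideal inside F_m, so degrees of points
    become statements about ideals and the filtration. *)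
Lemma mu_subscheme_exists : exists J m, max_subscheme I p j J /\ mu_subscheme I p j J m /\
  (forall M, (forall y, filtration M (y * t)) -> (m <= M)%N).
Proof.
have [J [hJ hker]] := maximal_subscheme_exists.
have [NU hNU] := nonunit_vspace ax rI hX0 hloc j.
have [rd [e he]] := residue_dim_map hNU.
exists J, (\max_k mu (p := p) (j := j) (e k * gam j t)%R)%N; split; first exact: hJ.
split.
  exists (gam j t), e; split; [split|exact: hker|exact: he|by []].
    move=> e0; apply: t0; apply: (stalk_map_joint_inj (rI := rI) hdim hp (hX0 := hX0)) => k.
    by have [->|kj] := eqVneq k j; [exact: e0|exact: tC k kj].
  move=> x; have [y <-] := stalk_map_surj rI (hX0 j) x => /tS yt.
  exact: (rmorph_ann (gam j) yt).
move=> M hM; apply/bigmax_leqP => k _; rewrite /mu /least; case: pselect => // h.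
case: ex_minnP => m /asboolP hm; apply; apply/asboolP.
have [y ey] := stalk_map_surj rI (hX0 j) (e k).
have [f hf] := hM y; exists f; split; first exact: hf.1.
  by rewrite -(stalk_mapE rI (hX0 j) hf) rmorphM /= ey.
move=> l lj; rewrite -(stalk_mapE rI (hX0 l) hf).
exact: (rmorphM0r _ (tC lj)).
Qed.

End Socle.

Lemma mu_subscheme_filtration j J m : mu_subscheme I p j J m ->
  exists2 t : S, t <> 0 & forall y : S, filtration m (y * t).
Proof.
move=> [sj [e [[sj0 sjS] _ [_ he] ->]]].
have [t [et tk]] := component_lift rI hp hX0 hloc sj.
exists t => [t0|y]; first (apply: sj0; rewrite -et t0; exact: rmorph0).
have [c [hc _]] := he (gam j y) Logic.I.
pose q k := mu (p := p) (j := j) (e k * sj).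
have /choice[a ha] : forall k, exists a, [/\ filtration (q k) a, gam j a = e k * sj &
    forall l, l != j -> gam l a = 0].
  move=> k; rewrite /q /mu /least; case: pselect => [h|[]].
    case: ex_minnP => M /asboolP[f [hf fj fk]] _.
    have [a hfa] := dehom_exists rI hf; exists a; split; first by exists f.
      by rewrite (stalk_mapE rI (hX0 j) hfa).
    by move=> l lj; rewrite (stalk_mapE rI (hX0 l) hfa) fk.
  have [a [aj ak]] := component_lift rI hp hX0 hloc (e k * sj).
  have [N /(_ N (leqnn _))[f hf]] := dehom_repr rI a.
  exists N; apply/asboolP; exists f; split; first exact: hf.1.
    by rewrite -(stalk_mapE rI (hX0 j) hf).
  by move=> l lj; rewrite -(stalk_mapE rI (hX0 l) hf) ak.
(* Modulo nonunits at p_j, [y] is a combination of the residue basis, and nonunits annihilate the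
   socle element. *)
have E : y * t = \sum_k c k *: a k.
  apply: (component_lift_uniq (rI := rI) hdim hp (hX0 := hX0) (j := j)).
  - rewrite rmorphM /= et rmorph_sum /=.
    have := sjS _ hc; rewrite mulrBl => /eqP; rewrite subr_eq0 => /eqP ->.
    rewrite mulr_suml; apply: eq_bigr => k _.
    by rewrite stalk_mapZ; have [_ -> _] := ha k; rewrite mulrA.
  - by move=> l lj; exact: (rmorphM0r _ (tk l lj)).
  - move=> l lj; rewrite rmorph_sum /=; apply: big1 => k _.
    by rewrite stalk_mapZ; have [_ _ /(_ l lj) ->] := ha k; rewrite mulr0.
suff h M : (forall k, q k <= M)%N -> filtration M (y * t).
  by apply: h => k; apply: (leq_bigmax (F := q)).
move=> le; rewrite E; elim/big_ind: _ => [|x z hx hz|k _].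
- exact: filtration0.
- exact: filtrationD.
have [hk _ _] := ha k; apply: filtrationZ.
by rewrite -(subnKC (le k)) PoszD; apply: filtrationW.
Qed.

End Degree.

(** * Regularity index and the Cayley-Bacharach criterion *)

Section CayleyBacharach.
Variables (K : fieldType) (n : nat) (I : ideal {mpoly K[n.+1]}).
Local Notation P := {mpoly K[n.+1]}.
Local Notation S := (degree0 I).
Variables (D : nat) (ax : Vector.axiom D S).
Local Notation V := (degree0_vect ax).
Implicit Types (a b t x y : S) (N M : nat) (i : int).
Hypotheses (rI : x0_regular I) (hdim : zero_dimensional I).
Variables (s : nat) (p : 'I_s -> prime_idealr P).
Hypotheses (hp : support_enum I p) (hX0 : forall j, 'X_ord0 \notin p j).
Hypothesis hloc : forall j, local_ring (stalk I (p j)).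
Local Notation gam j := (stalk_map rI (hX0 j)).
Local Notation r := (reg_index I p).

Let HF_full N : (forall x, filtration N x) -> HF I N = degree p I.
Proof.
move=> hN; rewrite (degree_eq ax rI hdim hp hX0 hloc).
have [U hU] := filtration_vspace ax N.
rewrite (HF_dim rI hU); have -> // : U = fullv.
by apply/eqP; rewrite eqEsubv subvf; apply/subvP => x _; apply/hU.
Qed.

Lemma reg_index_spec N : (r <= N)%N -> HF I N = degree p I.
Proof.
rewrite /reg_index /least; case: pselect => [h|[]].
  by case: ex_minnP => m /asboolP hm _; apply: hm.
have [N0 h0] := filtration_full ax rI.
by exists N0; apply/asboolP => i hi; apply: HF_full; apply: h0.
Qed.

Lemma filtration_reg N x : (r <= N)%N -> filtration N x.
Proof.
move=> hN; have [U hU] := filtration_vspace ax N; apply/hU.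
have -> : U = fullv; last exact: memvf.
apply/eqP; rewrite eqEdim subvf /= -(HF_dim rI hU) (reg_index_spec hN).
by rewrite (degree_eq ax rI hdim hp hX0 hloc).
Qed.

Variable tau : {linear S -> K^o}.
Hypothesis tau_nd : forall a, (forall b, tau (a * b) = 0) -> a = 0.

Lemma tau_riesz (lam : {linear S -> K^o}) : exists g, forall x, lam x = tau (g * x).
Proof.
have /choice[B hB] : forall g : V, exists L : {linear V -> K^o}, forall x : V,
    L x = tau ((g : S) * (x : S)).
  move=> g; apply: (@linear_of K V K^o (fun x : S => tau (g * x))) => [x y|c x].
    by rewrite mulrDr raddfD.
  by rewrite scale0E mulrCA -linearZ.
have [lam' hlam'] : exists L : {linear V -> K^o}, forall x : V, L x = lam x.
  apply: (@linear_of K V K^o (lam : S -> _)) => [x y|c x]; first exact: raddfD.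
  exact: linearZ.
have [||x hx|g hg] := @nondegenerate_riesz K V B _ _ _ lam'.
- by move=> x y z; rewrite !hB -raddfD -mulrDl.
- by move=> c x z; rewrite !hB scale0E -mulrA -linearZ.
- by apply: tau_nd => b; rewrite -hB hx.
by exists g => x; rewrite -hlam' hg hB.
Qed.

Lemma filtration_hyperplane : Delta I p = 1 ->
  exists om, forall x, filtration (r%:Z - 1) x <-> tau (om * x) = 0.
Proof.
rewrite /Delta; have [U hU] := filtration_vspace ax (r%:Z - 1).
rewrite (HF_dim rI hU) (degree_eq ax rI hdim hp hX0 hloc) => hD.
have [|lam hlam] := @hyperplane_functional K V U; first by move: hD; lia.
have [lam' hlam'] : exists L : {linear S -> K^o}, forall x : S, L x = lam x.
  apply: (@linear_of K S K^o (lam : V -> _)) => [x y|c x]; first exact: raddfD.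
  exact: linearZ.
have [om hom] := tau_riesz lam'.
by exists om => x; rewrite -hU hlam -hlam' hom.
Qed.

Section Generator.
Variable om : S.

(** The least degree at a point is at most r since F_r = S. A smaller one would give a nonzero u
    with u S inside F_(r-1), so tau (om u y) = 0 for all y, and then om u = 0. *)
Lemma cayley_bacharach_of_nzd : (forall x, filtration (r%:Z - 1) x -> tau (om * x) = 0) ->
  (forall x, om * x = 0 -> x = 0) -> cayley_bacharach I p.
Proof.
move=> hom nz j; rewrite /point_degree /least.
have [t [t0 tC tS]] := socle_exists ax rI hdim hp hX0 hloc j.
have [J [m [hJ [hm hM]]]] := mu_subscheme_exists ax hdim hp hloc t0 tC tS.
case: pselect => [h|[]]; last by exists m; apply/asboolP; exists J.
case: ex_minnP => m' /asboolP[J' [_ hm']] /(_ m (asboolT (ex_intro _ J (conj hJ hm)))) le.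
have mr : (m <= r)%N by apply: hM => y; apply: filtration_reg.
apply/eqP; rewrite eqn_leq (leq_trans le mr) /= leqNgt; apply/negP => lt.
have [u u0 hu] := mu_subscheme_filtration rI hdim hp hX0 hloc hm'.
apply: u0; apply: nz; apply: tau_nd => y; rewrite -mulrA [u * y]mulrC; apply: hom.
rewrite (_ : r%:Z - 1 = m'%:Z + (r - m').-1%:Z); last by lia.
exact: filtrationW.
Qed.

(** If [om] is a nonunit at p_j, it kills a socle element t there, so t S lies in F_(r-1) and p_j
    has degree at most r - 1. Hence [om] is a unit at every point. *)
Lemma nzd_of_cayley_bacharach :
  (forall x, tau (om * x) = 0 -> filtration (r%:Z - 1) x) ->
  cayley_bacharach I p -> forall x, om * x = 0 -> x = 0.
Proof.
move=> hom cb x omx; apply: (stalk_map_joint_inj (rI := rI) hdim hp (hX0 := hX0)) => j.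
have [[y hy]|nu] := pselect (exists z, gam j om * z = 1).
  exact: (rmorph_unit_eq0 (phi := gam j) hy (etrans (congr1 _ omx) (rmorph0 _))).
have [t [t0 tC tS]] := socle_exists ax rI hdim hp hX0 hloc j.
have [J [m [hJ [hm hM]]]] := mu_subscheme_exists ax hdim hp hloc t0 tC tS.
have om0 : om * t = 0 by apply: tS.
have hf (y : S) : filtration (r%:Z - 1) (y * t).
  by apply: hom; rewrite mulrCA om0 mulr0 raddf0.
(* For r = 0 there is no natural number r - 1 to bound the degree; here F_(-1) = 0 already forces t
   = 0. *)
have [r0|rp] := posnP r.
  have := hf 1; rewrite mul1r (_ : r%:Z - 1 = Negz 0); last by move: r0; lia.
  by move=> [f hf']; case: (t0 (dehom_neg rI hf').2).
have : (m <= r.-1)%N.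
  by apply: hM => y; have := hf y; rewrite (_ : r%:Z - 1 = r.-1%:Z) //; lia.
have := cb j; rewrite /point_degree /least; case: pselect => [h|[]]; last first.
  by exists m; apply/asboolP; exists J.
case: ex_minnP => m' _ /(_ m (asboolT (ex_intro _ J (conj hJ hm)))) + e; rewrite e; lia.
Qed.

End Generator.
End CayleyBacharach.

(** * The complementary module *)

Lemma Kx0D (K : fieldType) (n : nat) (I : ideal {mpoly K[n.+1]}) (f g : coord_ring I) :
  Kx0 f -> Kx0 g -> Kx0 (f + g).
Proof.
move=> /Kx0P[M [c ec]] /Kx0P[M' [c' ec']].
apply/Kx0P; exists (M + M')%N, (fun k => (if (k < M)%N then c k else 0) +
  (if (k < M')%N then c' k else 0)).
have E (T : nat) (c0 : nat -> K) : (T <= M + M')%N -> \sum_(k < T) const I (c0 k) * x0 I ^+ k =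
    \sum_(k < M + M') const I (if (k < T)%N then c0 k else 0) * x0 I ^+ k.
  move=> hT; rewrite (big_ord_widen _ (fun k => const I (c0 k) * x0 I ^+ k) hT) big_mkcond.
  by apply: eq_bigr => l _; case: ifP; rewrite // rmorph0 mul0r.
rewrite ec ec' (E M) ?leq_addr // (E M') ?leq_addl // -big_split /=.
by apply: eq_bigr => l _; rewrite rmorphD mulrDl.
Qed.

Section ComplementaryModule.
Variables (K : fieldType) (n : nat) (I : ideal {mpoly K[n.+1]}).
Local Notation P := {mpoly K[n.+1]}.
Local Notation R := (coord_ring I).
Local Notation Q := (Qh I).
Local Notation S := (degree0 I).
Implicit Types (f g : R) (q : Q) (a b x y : S) (i d : int).
Hypothesis rI : x0_regular I.
Let Ihom := reg_homog rI.
Local Notation lc := (@locmap R (@homog_nzd K n I)).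
Local Notation x0z := (x0z I).
Variable sigma : Q -> Q.
Hypothesis hsigma : trace_map sigma.
Variable tau : {linear S -> K^o}.
Hypothesis tauE : forall i a, sigma (x0z i * val a) = constQ I (tau a) * x0z i.
Hypothesis riesz : forall lam : {linear S -> K^o}, exists a, forall x, lam x = tau (a * x).
Variable N0 : nat.
Hypothesis full : forall N, (N0 <= N)%N -> forall x, filtration N x.

Let sigmaD q q' : sigma (q + q') = sigma q + sigma q'.
Proof. by have [[[_ h _] _] _] := hsigma; apply: h. Qed.

Let sigmaZ q q' : L0 q -> sigma (q * q') = q * sigma q'.
Proof. by have [[[_ _ h] _] _] := hsigma; move=> hq; apply: (h q q' hq). Qed.

Let sigma0 : sigma 0 = 0.
Proof. by apply: (addrI (sigma 0)); rewrite -sigmaD !addr0. Qed.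

Let sigma_sum (T : Type) (r : seq T) (F : T -> Q) :
  sigma (\sum_(k <- r) F k) = \sum_(k <- r) sigma (F k).
Proof. exact: (big_morph sigma sigmaD sigma0). Qed.

(* [a x_0^d] maps R into K[x_0] under the pairing given by sigma. *)
Definition annihilates d a : Prop :=
  forall i x, i + d < 0 -> filtration i x -> tau (a * x) = 0.

Lemma annihilatesM d i a x : annihilates d a -> filtration i x ->
  annihilates (d + i) (x * a).
Proof.
move=> h hx j y lt hy; rewrite [x * a]mulrC -mulrA; apply: (h (i + j)); first by lia.
exact: filtrationM.
Qed.

Lemma sigma_dehom d i f a x : dehom i f x ->
  sigma (x0z d * val a * lc f) = constQ I (tau (a * x)) * x0z (i + d).
Proof.
by move=> [_ ->]; rewrite mulrACA -x0zD // -rmorphM tauE addrC.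
Qed.

Lemma Qh_deg_mono c i : Qh_deg i (constQ I c * x0z i).
Proof.
by have := Qh_degM rI (degree0P (const0 I c)) (Qh_deg_x0z rI i); rewrite add0r.
Qed.

Lemma L0_locmap f : Kx0 f -> L0 (lc f).
Proof.
by move=> hf; exists f, 0%N; split; rewrite // (Qfrac_x0X rI) oppr0 mulr1.
Qed.

Lemma annihilates_Kx0 d a f : annihilates d a ->
  exists h, Kx0 h /\ lc h = sigma (x0z d * val a * lc f).
Proof.
move=> ha; move: f; apply: (coord_deg_ind Ihom) => [|f g [h [hh eh]] [k [hk ek]]|i f hf].
- exists 0; rewrite !rmorph0 mulr0 sigma0; split=> //.
  by apply/Kx0P; exists 0%N, (fun=> 0); rewrite big_ord0.
- exists (h + k); rewrite !rmorphD /= mulrDr sigmaD eh ek; split=> //.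
  exact: Kx0D.
have [x hx] := dehom_exists rI hf; rewrite (sigma_dehom d a hx).
case e : (i%:Z + d) => [k|k].
  exists (const I (tau (a * x)) * x0 I ^+ k); split; first exact: Kx0_mono.
  by rewrite rmorphM /= -x0z_nat.
exists (const I 0 * x0 I ^+ 0); split; first exact: Kx0_mono.
rewrite (ha i x) ?e //; last by exists f.
by rewrite rmorph0 mul0r !rmorph0 mul0r.
Qed.

Lemma annihilates_hom d a : annihilates d a -> exists phi : R^o -> R^o,
  homog_hom (@Kx0 K n I) (gR I) (gKx0 I) d phi /\
  forall f, sigma (x0z d * val a * lc f) = lc (phi f).
Proof.
move=> ha; have /choice[phi hphi] := fun f => annihilates_Kx0 f ha.
exists phi; split=> [|f]; last by have [_ ->] := hphi f.
have E f : lc (phi f) = sigma (x0z d * val a * lc f) := (hphi f).2.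
have hdeg i f : coord_deg i f -> coord_deg (i + d) (phi f).
  move=> hf; apply: (coord_deg_of_Qh rI); rewrite E.
  have [x hx] := dehom_exists rI hf; rewrite (sigma_dehom d a hx).
  exact: Qh_deg_mono.
split; last by move=> i f _ hf; split; [exact: (hphi f).1|exact: hdeg].
split=> [f _|f g _ _|c f hc _].
- exact: (hphi f).1.
- by apply: locmap_inj; rewrite E !rmorphD /= !E -sigmaD mulrDr.
- apply: locmap_inj; have lcM u v : lc (u * v) = lc u * lc v by exact: rmorphM.
  rewrite -[LHS]/(lc (phi (c * f))) -[RHS]/(lc (c * phi f)) lcM !E lcM mulrCA.
  exact: (sigmaZ _ (L0_locmap hc)).
Qed.

(** On the form x x_0^i the pairing is tau (a x) x_0^(i + d), which belongs to K[x_0] exactly when i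
    + d >= 0 or tau (a x) = 0. *)
Lemma complementary_homog d a :
  complementary sigma (x0z d * val a) <-> annihilates d a.
Proof.
split=> [[phi [_ e]] i x lt [f hf]|ha].
  have E : lc (phi f) = constQ I (tau (a * x)) * x0z (i + d).
    rewrite -(sigma_dehom d a hf); have := e f 0%N.
    by rewrite !(Qfrac_x0X rI) oppr0 !mulr1.
  have : coord_deg (i + d) (phi f).
    apply: (coord_deg_of_Qh rI); rewrite E.
    exact: Qh_deg_mono.
  case e' : (i + d) lt E => [k|k] // _ E /coord_deg_neg h.
  move: E; rewrite h rmorph0 => E; apply: (x0z_cancel rI (i := Negz k)).
  by rewrite -E rmorph0 mul0r.
have [phi [hphi E]] := annihilates_hom ha; exists phi; split.
  exists 1%N, (fun=> d), (fun=> phi); split=> // f _; by rewrite big_ord1.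
move=> f k; rewrite !(Qfrac_x0X rI) mulrA mulrC sigmaZ; last exact: L0_x0z.
by rewrite E mulrC.
Qed.

Lemma complementary_sum (r : seq (int * S)) :
  (forall z, z \in r -> annihilates z.1 z.2) ->
  complementary sigma (\sum_(z <- r) x0z z.1 * val z.2).
Proof.
move=> hr; pose z (k : 'I_(size r)) := nth (0, 0) r k.
have /choice[phi hphi] : forall k, exists phi : R^o -> R^o,
    homog_hom (@Kx0 K n I) (gR I) (gKx0 I) (z k).1 phi /\
    forall f, sigma (x0z (z k).1 * val (z k).2 * lc f) = lc (phi f).
  by move=> k; apply: annihilates_hom; apply: hr; apply: mem_nth.
exists (fun f => \sum_k phi k f); split.
  by exists (size r), (fun k => (z k).1), phi; split=> // k; have [] := hphi k.
move=> f k; rewrite !(Qfrac_x0X rI) mulrA mulrC sigmaZ; last exact: L0_x0z.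
rewrite mulr_suml sigma_sum rmorph_sum /= mulrC; congr (_ * _).
rewrite (big_nth (0, 0)) big_mkord; apply: eq_bigr => l _.
by have [_ ->] := hphi l.
Qed.

(** In a degree N with F_N = S, the map [phi] reads as a linear form on S, which tau represents by
    some [a]; linearity over K[x_0] carries the formula to all other degrees. *)
Lemma hom_annihilates d (phi : R^o -> R^o) : homog_hom (@Kx0 K n I) (gR I) (gKx0 I) d phi ->
  exists a, forall i f x, dehom i f x -> lc (phi f) = constQ I (tau (a * x)) * x0z (i + d).
Proof.
move=> [[phiK phiD phiZ] phid].
pose N := (N0 + absz d)%N.
have /choice[F hF] : forall x, exists f, dehom N f x by move=> x; apply: full; rewrite leq_addr.
have val_phi i f : coord_deg i f -> exists c, lc (phi f) = constQ I c * x0z (i + d).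
  by move=> hf; apply: (Kx0_degZ rI); [apply: phiK|have [] := phid i f Logic.I hf].
have /choice[l hl] := fun x => val_phi _ _ (hF x).1.
have phi_const c f : phi (const I c * f) = const I c * phi f.
  by have := phiZ (const I c * x0 I ^+ 0) f (Kx0_mono I c 0) Logic.I; rewrite expr0 mulr1.
have phi_x0 k f : phi (f * x0 I ^+ k) = phi f * x0 I ^+ k.
  have h : phi (x0 I ^+ k * f) = x0 I ^+ k * phi f.
    by have := phiZ (const I 1 * x0 I ^+ k) f (Kx0_mono I 1 k) Logic.I; rewrite rmorph1 mul1r.
  by rewrite mulrC h mulrC.
have [lam hlam] : exists L : {linear S -> K^o}, forall x, L x = l x.
  apply: linear_of => [x y|c x]; apply: (x0z_cancel rI (i := N%:Z + d)); rewrite -hl.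
    have -> : F (x + y) = F x + F y by apply: dehom_inj (hF _) (dehomD (hF x) (hF y)).
    transitivity ((constQ I (l x) + constQ I (l y)) * x0z (N%:Z + d)).
      by rewrite phiD // rmorphD /= !hl mulrDl.
    by congr (_ * _); rewrite -rmorphD.
  have -> : F (c *: x) = const I c * F x by apply: dehom_inj (hF _) (dehomZ c (hF x)).
  transitivity (constQ I c * constQ I (l x) * x0z (N%:Z + d)).
    by rewrite phi_const rmorphM /= hl mulrA.
  by congr (_ * _); rewrite -rmorphM.
have [a ha] := riesz lam; exists a.
suff main (i : nat) f x : dehom i%:Z f x ->
    lc (phi f) = constQ I (tau (a * x)) * x0z (i%:Z + d).
  case=> i f x //; first exact: main.
  move=> /(dehom_neg rI)[-> ->]; rewrite mulr0 raddf0 rmorph0 mul0r.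
  have := phi_const 0 0; rewrite rmorph0 !mul0r => ->; exact: rmorph0.
move=> hf; rewrite -ha hlam.
have [iN|Ni] := leqP i N.
  have e : f * x0 I ^+ (N - i) = F x.
    have := dehomMx0 rI (N - i) hf; rewrite -PoszD subnKC // => h.
    exact: dehom_inj h (hF x).
  apply: (x0z_inj rI (i := (N - i)%N)); rewrite mulrC x0z_nat -rmorphM /= -phi_x0 e hl.
  rewrite mulrCA -x0z_nat -x0zD //; congr (_ * x0z _); lia.
have -> : f = F x * x0 I ^+ (i - N).
  have := dehomMx0 rI (i - N) (hF x); rewrite -PoszD subnKC 1?ltnW // => h.
  exact: dehom_inj hf h.
rewrite phi_x0 rmorphM /= hl -x0z_nat -mulrA -x0zD //; congr (_ * x0z _); lia.
Qed.

(** The map behind [q] is a sum of homogeneous maps, each given by a homogeneous element, and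
    nondegeneracy of sigma identifies [q] with the sum of these elements. So C is graded, and its
    closure properties below are checked on homogeneous elements. *)
Lemma complementary_span q : complementary sigma q -> exists r : seq (int * S),
  (forall z, z \in r -> annihilates z.1 z.2) /\ q = \sum_(z <- r) x0z z.1 * val z.2.
Proof.
move=> [phi [[m [d [psi [hpsi ephi]]]] e]].
have /choice[a ha] := fun k => hom_annihilates (hpsi k).
exists [seq (d k, a k) | k <- enum 'I_m]; split.
  move=> _ /mapP[k _ ->] /= i x lt [f hf]; have := ha k i f x hf.
  have := ((hpsi k).2 i f Logic.I hf.1).2; case: (i + d k) lt => // l _ /coord_deg_neg ->.
  rewrite rmorph0 => E; apply: (x0z_cancel rI (i := Negz l)).
  by rewrite -E rmorph0 mul0r.
rewrite big_map big_enum /=; apply: (sigma_uniq hsigma).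
apply: (Qh_ind rI) => [|u v hu hv|i x]; first by rewrite !mulr0.
  by rewrite !mulrDr !sigmaD hu hv.
have [M /(_ M (leqnn _))[f hf]] := dehom_repr rI x.
have -> : x0z i * val x = x0z (i - M%:Z) * lc f.
  by rewrite hf.2 mulrA -x0zD // subrK.
rewrite !(mulrCA _ (x0z _)) !(sigmaZ _ (L0_x0z rI _)); congr (_ * _).
have := e f 0%N; rewrite !(Qfrac_x0X rI) oppr0 !mulr1 => ->; rewrite ephi //.
rewrite mulr_suml rmorph_sum /= -[in RHS]big_enum sigma_sum big_enum /=; apply: eq_bigr => k _.
by rewrite (ha k _ _ _ hf) (sigma_dehom _ _ hf).
Qed.

Lemma complementaryD q q' : complementary sigma q -> complementary sigma q' ->
  complementary sigma (q + q').
Proof.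
move=> /complementary_span[r [hr ->]] /complementary_span[r' [hr' ->]].
rewrite -big_cat; apply: complementary_sum => z; rewrite mem_cat.
by case/orP; [apply: hr|apply: hr'].
Qed.

Lemma complementary0 : complementary sigma 0.
Proof. by have := @complementary_sum [::]; rewrite big_nil; apply. Qed.

Lemma complementaryM f q : complementary sigma q -> complementary sigma (lc f * q).
Proof.
move=> /complementary_span[r [hr ->]]; move: f.
apply: (coord_deg_ind Ihom) => [|f g hf hg|i f hf].
- by rewrite rmorph0 mul0r; apply: complementary0.
- by rewrite rmorphD mulrDl; apply: complementaryD.
have [x hx] := dehom_exists rI hf.
rewrite mulr_sumr; elim: r hr => [|z r IH] hr; first by rewrite big_nil; apply: complementary0.
rewrite big_cons; apply: complementaryD; last first.
  by apply: IH => u ur; apply: hr; rewrite inE ur orbT.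
rewrite hx.2 mulrACA -x0zD // -rmorphM addrC; apply/complementary_homog.
by apply: annihilatesM; [apply: hr; rewrite inE eqxx|exists f].
Qed.

End ComplementaryModule.

(** * The conductor of C into R c_0 and the trace of C *)

Section TraceCriterion.
Variables (K : fieldType) (n : nat) (I : ideal {mpoly K[n.+1]}).
Local Notation P := {mpoly K[n.+1]}.
Local Notation R := (coord_ring I).
Local Notation Q := (Qh I).
Local Notation S := (degree0 I).
Implicit Types (f h : R) (q c : Q) (a b x y : S) (i d : int).
Hypothesis rI : x0_regular I.
Let Ihom := reg_homog rI.
Local Notation lc := (@locmap R (@homog_nzd K n I)).
Local Notation x0z := (x0z I).
Variable sigma : Q -> Q.
Hypothesis hsigma : trace_map sigma.
Variable tau : {linear S -> K^o}.
Hypothesis tauE : forall i a, sigma (x0z i * val a) = constQ I (tau a) * x0z i.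
Hypothesis tau_nd : forall a, (forall b, tau (a * b) = 0) -> a = 0.
Hypothesis riesz : forall lam : {linear S -> K^o}, exists a, forall x, lam x = tau (a * x).
Variable r : nat.
Hypothesis full : forall N, (r <= N)%N -> forall x, filtration N x.
Local Notation compl := (complementary sigma).
Local Notation annih := (annihilates tau).

Let lcM f h : lc (f * h) = lc f * lc h. Proof. exact: rmorphM. Qed.

Lemma scaleQE f q : f *: q = lc f * q. Proof. by []. Qed.

Lemma degree0_nzd_unit a : (forall x, a * x = 0 -> x = 0) -> exists b, a * b = 1.
Proof.
move=> nz; have [k [b e]] := degree0_pow rI a; exists b.
suff : 1 - b * a = 0 by move/eqP; rewrite subr_eq0 mulrC eq_sym => /eqP.
by elim: k e => [|k IH]; [rewrite mul1r|rewrite exprS -mulrA => /nz].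
Qed.

Lemma annih_small d a : d < - r%:Z -> annih d a -> a = 0.
Proof.
move=> lt ha; apply: tau_nd => x; apply: (ha r); first by move: lt; lia.
exact: full.
Qed.

(** The filtration increases and vanishes in negative degrees, so in degree -r all conditions follow
    from the one on F_(r-1). *)
Lemma annih_r a : (forall x, filtration (r%:Z - 1) x -> tau (a * x) = 0) <-> annih (- r%:Z) a.
Proof.
split=> [h i x lt hx|h x hx]; last by apply: (h (r%:Z - 1)) => //; lia.
apply: h; case: i lt hx => k lt hx; last first.
  by have [f /(dehom_neg rI)[_ ->]] := hx; apply: filtration0.
rewrite (_ : r%:Z - 1 = k%:Z + (r - k.+1)%N%:Z); first exact: filtrationW.
by move: lt; lia.
Qed.

(** The form tau (a _) vanishes on the kernel of the nonzero form tau (om _), so the two are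
    proportional; nondegeneracy carries this over to [a] and [om]. *)
Lemma annih_r_scalar om a : (forall x, tau (om * x) = 0 -> filtration (r%:Z - 1) x) ->
  om <> 0 -> annih (- r%:Z) a -> exists b : K, a = b *: om.
Proof.
move=> hom om0 /annih_r ha.
have [y hy] : exists y, tau (om * y) <> 0.
  by apply/existsNP => h; apply/om0/tau_nd.
have tZ (k : K) x : tau (k *: x) = k * tau x :> K by rewrite linearZ.
have tB x z : tau (x - z) = tau x - tau z :> K by rewrite raddfB.
pose T x : K := tau x.
have yU : T (om * y) != 0 by apply/eqP.
exists (T (a * y) / T (om * y)); apply/eqP; rewrite -subr_eq0; apply/eqP/tau_nd => z.
pose k : K := T (om * z) / T (om * y).
have sM (u v : S) (b : K) : u * (b *: v) = b *: (u * v) by rewrite !scale0E mulrCA.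
have ez : T (a * z) = k * T (a * y).
  apply/eqP; rewrite -subr_eq0 /T -tZ -tB -sM -mulrBr; apply/eqP/ha/hom.
  by rewrite mulrBr tB sM tZ -/(T _) -/(T _) /k divfK ?subrr.
have sM' (u v : S) (b : K) : (b *: v) * u = b *: (v * u) by rewrite !scale0E mulrA.
rewrite mulrBl tB sM' tZ -/(T _) -/(T (om * z)) ez /k.
by apply/eqP; rewrite subr_eq0; apply/eqP; rewrite mulrAC [RHS]mulrAC; congr (_ / _); exact: mulrC.
Qed.

Section Generator.
Variables (w w' : S).
Hypotheses (ww' : w * w' = 1) (hw : annih (- r%:Z) w).
Let c0 : Q := x0z (- r%:Z) * val w.
Let c1 : Q := x0z r%:Z * val w'.

Let c01 : c0 * c1 = 1.
Proof. by rewrite /c0 /c1 mulrACA x0zNK // mul1r -rmorphM ww' rmorph1. Qed.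

Let c0_cancel q q' : q * c0 = q' * c0 -> q = q'.
Proof.
have E u : u = u * c0 * c1 by rewrite -mulrA c01 mulr1.
by move=> e; rewrite (E q) (E q') e.
Qed.

Let c0_compl : compl c0.
Proof. exact/(complementary_homog rI hsigma tauE). Qed.

(** The conductor of C into R c_0. It contains m iff m kills C / R c_0, and division by c_0 turns
    its elements into homomorphisms from C to R. *)
Definition conductor f : Prop := forall c, compl c -> exists h, lc f * c = lc h * c0.

Lemma conductorD f h : conductor f -> conductor h -> conductor (f + h).
Proof.
move=> hf hh c hc; have [u eu] := hf c hc; have [v ev] := hh c hc.
by exists (u + v); rewrite !rmorphD /= !mulrDl eu ev.
Qed.

Lemma conductorM f h : conductor h -> conductor (f * h).
Proof.
move=> hh c hc; have [u eu] := hh c hc; exists (f * u).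
by rewrite !lcM -!mulrA eu.
Qed.

Lemma conductor0 : conductor 0.
Proof. by move=> c _; exists 0; rewrite !rmorph0 !mul0r. Qed.

Lemma conductor_irrelevant : (forall k : 'I_n.+1, conductor (coord I 'X_k)) ->
  forall f, irrelevant f -> conductor f.
Proof.
move=> hX _ [F F0 ->].
have hm m : conductor (coord I (F@_m *: 'X_[m])).
  have [->|m0] := eqVneq m 0%MM; first by rewrite F0 scale0r coord0; apply: conductor0.
  have [k mk] : exists k, m k != 0%N.
    apply: contrapT => /forallNP nk; case/eqP: m0; apply/mnmP => k.
    by rewrite mnm0E; apply/eqP/negPn/negP/nk.
  have -> : m = (U_(k) + (m - U_(k)))%MM.
    by apply/mnmP => l; rewrite !(mnmDE, mnmBE, mnm1E); case: eqP => [<-|]; lia.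
  rewrite -mul_mpolyC mpolyXD mulrCA mulrC coordM; apply: conductorM; exact: hX.
rewrite [F]mpolyE; elim: (msupp F) => [|m l IH].
  by rewrite big_nil coord0; apply: conductor0.
by rewrite big_cons coordD; apply: conductorD.
Qed.

(** C has rank one: some x_0^N c equals h c_0 with h in R, and applying the linear map psi to this
    equality exchanges c and c_0. *)
Let psi_swap d (psi : Q -> R^o) c : homog_hom (fun _ => True) (gC sigma) (gR I) d psi ->
  compl c -> lc (psi c) * c0 = lc (psi c0) * c.
Proof.
move=> [[_ _ psiZ] _] hc; have [h [N e]] := Qh_repr rI (c * c1).
have eN : lc (x0 I ^+ N) * c = lc h * c0.
  apply: (x0z_inj rI (i := - N%:Z)); rewrite mulrA -x0z_nat -x0zD // addNr mul1r.
  by rewrite mulrA [_ * lc h]mulrC -e -mulrA [c1 * c0]mulrC c01 mulr1.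
have E : x0 I ^+ N * psi c = h * psi c0.
  have e1 := psiZ (x0 I ^+ N) c Logic.I hc; have e2 := psiZ h c0 Logic.I c0_compl.
  by rewrite -[LHS]/(x0 I ^+ N *: psi c) -e1 scaleQE eN -scaleQE e2.
apply: (x0z_inj rI (i := N)); rewrite x0z_nat mulrA -lcM E lcM mulrAC -eN.
by rewrite -mulrA [c * _]mulrC.
Qed.

Let hom_sum d (psi : Q -> R^o) (T : Type) (l : seq T) (F : T -> Q) :
  homog_hom (fun _ => True) (gC sigma) (gR I) d psi -> (forall z, compl (F z)) ->
  psi (\sum_(z <- l) F z) = \sum_(z <- l) psi (F z).
Proof.
move=> [[_ psiD psiZ] _] hF.
have psi0 : psi 0 = 0.
  have := psiZ 0 0 Logic.I (complementary0 rI hsigma tauE).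
  by rewrite scaleQE mulr0 scale0r.
have hl l' : compl (\sum_(z <- l') F z).
  elim: l' => [|z l' IH]; rewrite ?big_nil ?big_cons; first exact: (complementary0 rI hsigma tauE).
  exact: (complementaryD rI hsigma tauE riesz full).
elim: l => [|z l IH]; first by rewrite !big_nil.
by rewrite !big_cons -IH; apply: psiD; [exact: hF|exact: hl].
Qed.

(* Only the values of degree 1 matter, and they come from psi (c_0) up to scalars. *)
Lemma conductor_of_nearly_gorenstein :
  (forall a, annih (- r%:Z) a -> exists b : K, a = b *: w) ->
  nearly_gorenstein sigma -> forall f, irrelevant f -> conductor f.
Proof.
move=> hscal hn; apply: conductor_irrelevant => l; set f := coord I 'X_l.
have hf : coord_deg 1 f by exists 'X_l; rewrite //= dhomogX /=; apply/eqP/mdeg1.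
have f_irr : irrelevant f.
  by exists 'X_l; rewrite // mcoeffX; case: eqP => // /(congr1 mdeg); rewrite mdeg1 mdeg0.
have cond_c0 d psi : homog_hom (fun _ => True) (gC sigma) (gR I) d psi -> conductor (psi c0).
  by move=> hpsi c hc; exists (psi c); rewrite (psi_swap hpsi hc).
have key d psi e a : homog_hom (fun _ => True) (gC sigma) (gR I) d psi -> annih e a ->
    conductor (prj 1 (psi (x0z e * val a))).
  move=> hpsi ha; set c := x0z e * val a.
  have hc : compl c by apply/(complementary_homog rI hsigma tauE).
  have hce : Qh_deg e c by apply/(Qh_degP0 rI); exists a.
  have deg : coord_deg (e + d) (psi c) by apply: hpsi.2.
  have deg0 : coord_deg (- r%:Z + d) (psi c0).
    by apply: hpsi.2 => //; split=> //; apply/(Qh_degP0 rI); exists w.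
  have [ed|ne] := eqVneq (e + d) 1; last first.
    by rewrite (prj_ne Ihom deg) //; apply: conductor0.
  rewrite prj_id //; last by move: deg; rewrite ed.
  have swap := psi_swap hpsi hc.
  have [lt|] := boolP (e < - r%:Z).
    have c00 : c = 0 by rewrite /c (annih_small lt ha) rmorph0 mulr0.
    have -> : psi c = 0; last exact: conductor0.
    by apply/locmap_inj/c0_cancel; rewrite swap c00 mulr0 rmorph0 mul0r.
  move=> nlt; have [er|ner] := eqVneq e (- r%:Z).
    rewrite er in ha; have [b eb] := hscal a ha.
    have -> : psi c = const I b * psi c0; last by apply: conductorM; apply: cond_c0 hpsi.
    have ec : c = lc (const I b) * c0 by rewrite /c /c0 er eb val_scale0 mulrCA.
    by apply/locmap_inj/c0_cancel; rewrite swap lcM ec mulrCA mulrA.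
  (* Here e > -r and e + d = 1, so psi (c_0) has degree at most 0 and is a constant. If it is
     nonzero, 1 lies in the conductor; if it is zero, psi c = 0 by [psi_swap]. *)
  have : - r%:Z + d <= 0 by move: nlt ner ed; lia.
  case e' : (- r%:Z + d) deg0 => [k|k] deg0 le0; last first.
    have -> : psi c = 0; last exact: conductor0.
    apply/locmap_inj/c0_cancel; rewrite swap (iffLR (coord_deg_neg _ _) deg0).
    by rewrite !rmorph0 !mul0r.
  have k0 : k = 0%N by move: le0; lia.
  rewrite k0 in deg0; have [F F0 eF] := deg0.
  have [b eb] : exists u : K, psi c0 = const I u.
    exists F@_0%MM; rewrite eF /const; congr coord; apply/mpolyP => m.
    rewrite mcoeffC; have [->|m0] := eqVneq m 0%MM; first by rewrite mulr1.
    by rewrite mulr0; apply: (dhomog_nemf_coeff F0); rewrite mdeg_eq0.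
  have [b0|b0] := eqVneq b 0.
    have -> : psi c = 0; last exact: conductor0.
    by apply/locmap_inj/c0_cancel; rewrite swap eb b0 !rmorph0 !mul0r.
  have c1' : conductor 1.
    have := conductorM (const I b^-1) (cond_c0 _ _ hpsi).
    by rewrite eb -rmorphM mulVf // rmorph1.
  by have := conductorM (psi c) c1'; rewrite mulr1.
have [m [phi [c [hphi hc ef]]]] := hn f f_irr.
rewrite -(prj_id Ihom hf) ef prj_sum //; elim/big_ind: _ => [||k _].
- exact: conductor0.
- exact: conductorD.
have [m' [d [psi [hpsi epsi]]]] := hphi k.
rewrite (epsi _ (hc k)) prj_sum //; elim/big_ind: _ => [||k' _].
- exact: conductor0.
- exact: conductorD.
have [z [hz ez]] := complementary_span rI hsigma tauE riesz full (hc k).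
pose y (u : 'I_(size z)) := nth (0, 0) z u.
have hy u : annih (y u).1 (y u).2 by apply/hz/mem_nth.
rewrite ez (big_nth (0, 0)) big_mkord.
rewrite (hom_sum _ (F := fun u => x0z (y u).1 * val (y u).2) (hpsi k')); last first.
  by move=> u; apply/(complementary_homog rI hsigma tauE)/hy.
rewrite prj_sum //; elim/big_ind: _ => [||u _].
- exact: conductor0.
- exact: conductorD.
exact: key (hpsi k') (hy u).
Qed.

(** For the part f_e of f of degree e, multiplication by f_e / c_0 is a homomorphism from C to R,
    homogeneous of degree e + r, with value f_e at c_0; these values add up to f. *)
Lemma nearly_gorenstein_of_conductor :
  (forall f, irrelevant f -> conductor f) -> nearly_gorenstein sigma.
Proof.
move=> hcond f [F F0 ef]; have [N /(_ N (leqnn _)) eN] := sum_prj Ihom f.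
have irr e : irrelevant (prj e f).
  exists (pihomog mdeg e F); last by rewrite ef prj_coord.
  rewrite pihomogE raddf_sum big1 //= => m _; rewrite mcoeffZ mcoeffX.
  by case: eqP => [->|]; rewrite ?F0 ?mul0r ?mulr0.
have /choice[phi hphi] : forall u : nat * Q, exists h,
    compl u.2 -> lc (prj u.1 f) * u.2 = lc h * c0.
  move=> [e c]; have [hc|nc] := pselect (compl c); last by exists 0.
  by have [h hh] := hcond _ (irr e) c hc; exists h.
have E e c : compl c -> lc (phi (e, c)) * c0 = lc (prj e f) * c.
  by move=> hc; rewrite (hphi (e, c)).
have hom e : homog_hom (fun _ => True) (gC sigma) (gR I) (e%:Z + r%:Z) (fun c => phi (e, c) : R^o).
  split; first split=> // [c c' hc hc'|h c _ hc].
  - apply/locmap_inj/c0_cancel.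
    rewrite (E e _ (complementaryD rI hsigma tauE riesz full hc hc')).
    by rewrite mulrDr -(E e c hc) -(E e c' hc') -mulrDl rmorphD.
  - apply/locmap_inj/c0_cancel.
    rewrite scaleQE (E e _ (complementaryM rI hsigma tauE riesz full h hc)).
    by rewrite mulrCA -(E e c hc) mulrA -lcM.
  move=> i c hc [_ hi]; apply: (coord_deg_of_Qh rI).
  have -> : lc (phi (e, c)) = lc (prj e f) * c * c1 by rewrite -E // -mulrA c01 mulr1.
  rewrite (_ : i + (e%:Z + r%:Z) = e%:Z + i + r%:Z); last by lia.
  apply: (Qh_degM rI); last by apply/(Qh_degP0 rI); exists w'.
  by apply: (Qh_degM rI) => //; apply/(Qh_deg_locmap rI)/prj_deg.
exists N, (fun (e : 'I_N) c => phi (e : nat, c) : R^o), (fun=> c0); split=> //.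
  move=> e; exists 1%N, (fun=> (e : nat)%:Z + r%:Z), (fun _ c => phi (e : nat, c) : R^o).
  by split=> [_|c _]; [apply: hom|rewrite big_ord1].
rewrite eN; apply: eq_bigr => e _; apply/esym/locmap_inj/c0_cancel.
by rewrite E // -eN.
Qed.

End Generator.

(** The embedding is multiplication by theta(1) = w x_0^(-r), and its injectivity makes w a
    non-zerodivisor. For f in m, the element f c is in the kernel of pi, hence in the image R
    theta(1). *)
Lemma conductor_of_almost_gorenstein : almost_gorenstein sigma r ->
  exists w, [/\ annih (- r%:Z) w, forall x, w * x = 0 -> x = 0 &
    forall f, irrelevant f -> conductor w f].
Proof.
move=> [M [g [theta [pi [_ [[[thC thD thZ] thd] [[piM piD piZ] _]] thinj [hex _] hann]]]]].
have [hcompl] : complementary sigma (theta 1) /\ Qh_deg (0 + 0 + - r%:Z) (theta 1).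
  exact: (thd 0 1 Logic.I (coord_deg1 I)).
rewrite !add0r => /(Qh_degP0 rI)[w ew]; exists w.
have thE f : theta f = lc f * theta 1.
  have := thZ f 1 Logic.I Logic.I; rewrite scaleQE => <-; congr theta.
  exact: esym (mulr1 f).
rewrite ew in hcompl; split.
- exact/(complementary_homog rI hsigma tauE).
- move=> x wx; have [N /(_ N (leqnn _))[f hf]] := dehom_repr rI x.
  have : theta f = theta 0.
    rewrite (thE f) (thE 0) rmorph0 mul0r ew hf.2 mulrACA [val x * _]mulrC -rmorphM wx.
    by rewrite rmorph0 mulr0.
  by move=> /thinj f0; apply: (dehom0_eq rI (i := N)); rewrite -f0.
move=> f hf c hc; have hfc : compl (lc f * c).
  exact: (complementaryM rI hsigma tauE riesz full).
have : pi (lc f * c) = 0 by have := piZ f c Logic.I hc; rewrite scaleQE => ->; apply: hann.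
by move=> /(iffLR (hex _ hfc))[h eh]; exists h; rewrite -eh thE ew.
Qed.

End TraceCriterion.

(** * Subquotient modules given by predicates *)

Section QuotientModule.
Variables (A : pzRingType) (U : lmodType A) (B : U -> Prop).
Hypotheses (B0 : B 0) (BD : forall u v, B u -> B v -> B (u + v))
  (BZ : forall a u, B u -> B (a *: u)).

Definition submod_pred : {pred U} := fun u => `[< B u >].

Fact submod_pred_zmod : zmod_closed submod_pred.
Proof.
split; first exact/asboolP.
move=> u v /asboolP hu /asboolP hv; apply/asboolP; apply: BD => //.
by rewrite -scaleN1r; apply: BZ.
Qed.
HB.instance Definition _ := GRing.isZmodClosed.Build U submod_pred submod_pred_zmod.

Definition quotmod := Quotient.quot submod_pred.
HB.instance Definition _ := GRing.Zmodule.on quotmod.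
Definition quotmod_pi (u : U) : quotmod := \pi_(Quotient.quot submod_pred)%qT u.

Lemma quotmod_piP u v : quotmod_pi u = quotmod_pi v <-> B (u - v).
Proof.
split=> [/eqP|h]; first by rewrite -Quotient.idealrBE => /asboolP.
by apply/eqP; rewrite -Quotient.idealrBE; apply/asboolP.
Qed.

Lemma quotmod_piD u v : quotmod_pi (u + v) = quotmod_pi u + quotmod_pi v.
Proof. exact: raddfD. Qed.

Lemma quotmod_surj (x : quotmod) : exists u, quotmod_pi u = x.
Proof. by exists (repr x); rewrite /quotmod_pi reprK. Qed.

Definition quotmod_scale (a : A) (x : quotmod) : quotmod := quotmod_pi (a *: repr x).

Lemma quotmod_scaleE a u : quotmod_scale a (quotmod_pi u) = quotmod_pi (a *: u).
Proof.
apply/quotmod_piP; rewrite -scalerBr; apply: BZ; apply/quotmod_piP.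
by rewrite /quotmod_pi reprK.
Qed.

Fact quotmod_scaleA a b x : quotmod_scale a (quotmod_scale b x) = quotmod_scale (a * b) x.
Proof. by have [u <-] := quotmod_surj x; rewrite !quotmod_scaleE scalerA. Qed.
Fact quotmod_scale1 : left_id 1 quotmod_scale.
Proof. by move=> x; have [u <-] := quotmod_surj x; rewrite quotmod_scaleE scale1r. Qed.
Fact quotmod_scaleDr : right_distributive quotmod_scale +%R.
Proof.
move=> a x y; have [u <-] := quotmod_surj x; have [v <-] := quotmod_surj y.
by rewrite -quotmod_piD !quotmod_scaleE scalerDr quotmod_piD.
Qed.
Fact quotmod_scaleDl x : {morph quotmod_scale^~ x : a b / a + b}.
Proof.
move=> a b; have [u <-] := quotmod_surj x.
by rewrite !quotmod_scaleE scalerDl quotmod_piD.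
Qed.
HB.instance Definition _ := GRing.Zmodule_isLmodule.Build A quotmod
  quotmod_scaleA quotmod_scale1 quotmod_scaleDr quotmod_scaleDl.

Variable C : U -> Prop.
Hypotheses (C0 : C 0) (CD : forall u v, C u -> C v -> C (u + v))
  (CZ : forall a u, C u -> C (a *: u)).

Definition subquot_pred : {pred quotmod} := fun x => `[< exists u, C u /\ quotmod_pi u = x >].

Fact subquot_closed : submod_closed subquot_pred.
Proof.
split; first by apply/asboolP; exists 0; split=> //; exact: raddf0.
move=> a x y /asboolP[u [hu <-]] /asboolP[v [hv <-]]; apply/asboolP.
exists (a *: u + v); split; first by apply: CD => //; apply: CZ.
by rewrite quotmod_piD -quotmod_scaleE.
Qed.
HB.instance Definition _ := GRing.isSubmodClosed.Build A quotmod subquot_pred subquot_closed.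

Definition subquot := {x : quotmod | x \in subquot_pred}.
HB.instance Definition _ := SubChoice.on subquot.
HB.instance Definition _ := GRing.SubChoice_isSubLmodule.Build A quotmod subquot_pred subquot
  subquot_closed.

(** [M] is the image of C in U / B. The map [pi] has the default value 0 where the class does not
    come from C, hence its properties are stated on C. *)
Lemma subquotient_exists : exists (M : lmodType A) (pi : U -> M),
  [/\ forall u v, C u -> C v -> pi (u + v) = pi u + pi v,
      forall a u, C u -> pi (a *: u) = a *: pi u,
      forall m, exists u, C u /\ pi u = m &
      forall u, C u -> pi u = 0 <-> B u].
Proof.
pose pi (u : U) : subquot := insubd 0 (quotmod_pi u).
have piE u : C u -> val (pi u) = quotmod_pi u.
  by move=> hu; rewrite insubdK //; apply/asboolP; exists u.
exists subquot, pi; split.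
- move=> u v hu hv; apply: val_inj; have vD (x y : subquot) : val (x + y) = val x + val y.
    exact: raddfD.
  by rewrite vD (piE _ hu) (piE _ hv) (piE _ (CD hu hv)) quotmod_piD.
- move=> a u hu; apply: val_inj; have vZ (x : subquot) : val (a *: x) = a *: val x.
    exact: linearZ.
  by rewrite vZ (piE _ hu) (piE _ (CZ a hu)) -quotmod_scaleE.
- move=> m; have /asboolP[u [hu e]] := valP m; exists u; split=> //.
  by apply: val_inj; rewrite piE.
- move=> u hu; rewrite -[X in B X]subr0 -quotmod_piP.
  have pi0 : quotmod_pi 0 = 0 by exact: raddf0.
  split=> [e|e]; first by rewrite pi0 -(piE u hu) e.
  by apply: val_inj; rewrite (piE u hu) e pi0.
Qed.

End QuotientModule.

Section AlmostGorenstein.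
Variables (K : fieldType) (n : nat) (I : ideal {mpoly K[n.+1]}).
Local Notation R := (coord_ring I).
Local Notation Q := (Qh I).
Local Notation S := (degree0 I).
Implicit Types (f h : R) (q c : Q) (i : int).
Hypothesis rI : x0_regular I.
Let Ihom := reg_homog rI.
Local Notation lc := (@locmap R (@homog_nzd K n I)).
Local Notation x0z := (x0z I).

Let lcM f h : lc (f * h) = lc f * lc h. Proof. exact: rmorphM. Qed.

(** With a common denominator x_0^N the summands become forms, the k-th being a homogeneous part of
    x_0^N h, which is x_0^N times a part of h or zero. This is what makes the grading of C / R c_0
    direct. *)
Lemma homogeneous_sum_in_ring m (d : 'I_m -> int) (u : 'I_m -> Q) h : injective d ->
  (forall k, Qh_deg (d k) (u k)) -> \sum_k u k = lc h -> forall k, exists f, u k = lc f.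
Proof.
move=> dinj hu uh k; have [N0 hN0] := choice (fun k => Qh_deg_clear rI (hu k)).
pose N := (\sum_k N0 k)%N.
have hN l : (N0 l <= N)%N by rewrite /N (bigD1 l) //= leq_addr.
have {hN0 hN} /choice[e /choice[f hf]] := fun l => hN0 l N (hN l).
have fh : \sum_k f k = x0 I ^+ N * h.
  apply: locmap_inj; rewrite lcM -uh rmorph_sum mulr_sumr /=.
  by apply: eq_bigr => l _; have [_ _ <-] := hf l; rewrite -x0z_nat mulrC.
have fk : f k = prj (e k) (x0 I ^+ N * h).
  rewrite -fh prj_sum // (bigD1 k) //= big1 ?addr0 => [|l lk].
    by have [_ hk _] := hf k; rewrite prj_id.
  have [el hl _] := hf l; apply: (prj_ne Ihom hl); rewrite el.
  by have [-> _ _] := hf k; apply: contraNneq lk => /addIr/dinj ->; rewrite eqxx.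
rewrite (prjMl Ihom _ _ (coord_deg_x0 I N)) in fk.
exists (if (N <= e k)%N then prj (e k - N) h else 0).
apply: (x0z_inj rI (i := N)); have [_ _ eu] := hf k; rewrite mulrC eu fk x0z_nat -lcM.
by congr lc; case: ifP; rewrite ?mulr0.
Qed.

Variable sigma : Q -> Q.
Hypothesis hsigma : trace_map sigma.
Variable tau : {linear S -> K^o}.
Hypothesis tauE : forall i (a : S), sigma (x0z i * val a) = constQ I (tau a) * x0z i.
Hypothesis riesz : forall lam : {linear S -> K^o}, exists a : S, forall x, lam x = tau (a * x).
Variable r : nat.
Hypothesis full : forall N, (r <= N)%N -> forall x : S, filtration N x.
Local Notation compl := (complementary sigma).
Variables (w w' : S).
Hypotheses (ww' : w * w' = 1) (hw : annihilates tau (- r%:Z) w).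
Let c0 : Q := x0z (- r%:Z) * val w.
Let c1 : Q := x0z r%:Z * val w'.

Let c01 : c0 * c1 = 1.
Proof. by rewrite /c0 /c1 mulrACA x0zNK // mul1r -rmorphM ww' rmorph1. Qed.

Let c0_compl : compl c0.
Proof. exact/(complementary_homog rI hsigma tauE). Qed.

Let c0_deg : Qh_deg (- r%:Z) c0.
Proof. by apply/(Qh_degP0 rI); exists w. Qed.

Let c1_deg : Qh_deg r%:Z c1.
Proof. by apply/(Qh_degP0 rI); exists w'. Qed.

Let mulK q : q = q * c1 * c0.
Proof. by rewrite -mulrA [c1 * c0]mulrC c01 mulr1. Qed.

Let complD := complementaryD rI hsigma tauE riesz full.
Let complM := complementaryM rI hsigma tauE riesz full.
Let compl0 := complementary0 rI hsigma tauE.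

Lemma almost_gorenstein_of_conductor :
  (forall f, irrelevant f -> conductor sigma r w f) -> almost_gorenstein sigma r.
Proof.
move=> hcond; pose B q := exists f, q = lc f * c0.
have [||||||M [pi [piD piZ pi_surj pi0]]] := @subquotient_exists R Q B _ _ _ compl.
- by exists 0; rewrite rmorph0 mul0r.
- by move=> _ _ [f ->] [h ->]; exists (f + h); rewrite rmorphD /= mulrDl.
- by move=> f _ [h ->]; exists (f * h); rewrite lcM -mulrA.
- exact: compl0.
- exact: complD.
- by move=> f c; apply: complM.
pose g i (u : M) := exists c, [/\ compl c, Qh_deg (i - r%:Z) c & pi c = u].
have piN c : compl c -> pi (- c) = - pi c.
  by move=> hc; have := piZ (-1) c hc; rewrite !scaleN1r.
have complN c : compl c -> compl (- c).
  by move=> /(complM (-1)); rewrite rmorphN1 mulN1r.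
have pi00 : pi 0 = 0 by apply/(pi0 _ compl0); exists 0; rewrite rmorph0 mul0r.
have pi_sum (T : Type) (l : seq T) (F : T -> Q) : (forall z, compl (F z)) ->
    compl (\sum_(z <- l) F z) /\ pi (\sum_(z <- l) F z) = \sum_(z <- l) pi (F z).
  move=> hF; elim: l => [|z l [hl IH]]; first by rewrite !big_nil.
  by rewrite !big_cons; split; [apply: complD|rewrite piD // IH].
exists M, g, (fun f => lc f * c0), pi; split.
- split.
  + move=> i; split; first by exists 0; split=> //; apply: (Qh_deg0 rI).
    move=> _ _ [c [hc dc <-]] [c' [hc' dc' <-]]; exists (c - c'); split.
    * by apply: complD => //; apply: complN.
    * by apply: (Qh_degD rI) => //; apply: (Qh_degN rI).
    * by rewrite piD ?piN //; apply: complN.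
  + move=> i j f _ hf [c [hc dc <-]]; exists (f *: c); split.
    * exact: complM.
    * by rewrite -addrA; apply: (Qh_degM rI) => //; apply: (Qh_deg_locmap rI).
    * exact: piZ.
  + move=> u; have [c [hc <-]] := pi_surj u.
    have [z [hz ez]] := complementary_span rI hsigma tauE riesz full hc.
    pose y (k : 'I_(size z)) := nth (0, 0) z k.
    have hy k : compl (x0z (y k).1 * val (y k).2).
      by apply/(complementary_homog rI hsigma tauE)/hz/mem_nth.
    exists (size z), (fun k => (y k).1 + r%:Z), (fun k => pi (x0z (y k).1 * val (y k).2)).
    split=> [k|].
      exists (x0z (y k).1 * val (y k).2); split=> //.
      by rewrite addrK; apply/(Qh_degP0 rI); exists (y k).2.
    by rewrite ez (big_nth (0, 0)) big_mkord; have [_ <-] := pi_sum _ (index_enum _) _ hy.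
  + move=> m d v dinj hv v0 k.
    have /choice[c hc] := hv; have hcc l : compl (c l) by have [] := hc l.
    have [cs] := pi_sum _ (index_enum _) _ hcc.
    rewrite (eq_bigr v) => [|l _]; last by have [_ _ ->] := hc l.
    rewrite v0 => /(pi0 _ cs)[h eh].
    have [_ _ <-] := hc k; apply/(pi0 _ (hcc k)).
    (* Multiplication by c_1 = 1 / c_0 has degree r and carries R c_0 to R, so the sum becomes an
       element of R split into the pairwise distinct degrees [d l]. *)
    have [||f ef] := @homogeneous_sum_in_ring m d (fun l => c l * c1) h dinj _ _ k.
    * move=> l; have [_ dl _] := hc l.
      by rewrite -[d l](subrK r%:Z); apply: (Qh_degM rI).
    * by rewrite -mulr_suml eh -mulrA c01 mulr1.
    * by exists f; rewrite -ef; apply: mulK.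
- split; split.
  + split=> [f _|f h _ _|f h _ _].
    * exact: complM.
    * by rewrite rmorphD /= mulrDl.
    * by rewrite -[f *: h]/(f * h) lcM -mulrA.
  + move=> i f _ hf; split; first exact: complM.
    rewrite /= addr0; apply: (Qh_degM rI) => //; exact: (Qh_deg_locmap rI).
  + by split=> [||a u _]; [|exact: piD|exact: piZ].
  + by move=> i c hc [_ dc]; exists c; split; rewrite ?addr0.
- move=> f h /= e; apply: locmap_inj.
  have E u : u = u * c0 * c1 by rewrite -mulrA c01 mulr1.
  by rewrite (E (lc f)) e -E.
- split=> [c hc|u].
    by rewrite (pi0 _ hc); split=> -[f e]; exists f.
  by have [c [hc e]] := pi_surj u; exists c.
- move=> f u hf; have [c [hc <-]] := pi_surj u.
  rewrite -piZ //; apply/pi0; first exact: complM.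
  by have [h eh] := hcond f hf c hc; exists h.
Qed.

End AlmostGorenstein.

Theorem proposition6p8 (K : fieldType) (n : nat) (I : ideal {mpoly K[n.+1]})
  (hI : subscheme_ideal I) (hdim : zero_dimensional I)
  (s : nat) (p : 'I_s -> prime_idealr {mpoly K[n.+1]})
  (hp : support_enum I p)
  (hX0 : forall j : 'I_s, 'X_ord0 \notin p j)
  (hGor : forall j : 'I_s, gorenstein_local (stalk I (p j)))
  (sigma : Qh I -> Qh I) (hsigma : trace_map sigma)
  (hDelta : Delta I p = 1) :
  almost_gorenstein sigma (reg_index I p) <->
  nearly_gorenstein sigma /\ cayley_bacharach I p.
Proof.
have rI := x0_regularP hI hdim hp hX0.
have hloc j : local_ring (stalk I (p j)) by have [] := hGor j.
have [tau tauE] := trace_form_exists rI hsigma.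
have tau_nd := tau_nondeg rI hsigma tauE.
have [m [Phi Phi_inj]] := degree0_finite_dim rI hsigma tauE.
have [D [ax]] := vector_axiom_of_injection Phi_inj.
have full N : (reg_index I p <= N)%N -> forall x : degree0 I, filtration N x.
  by move=> hN x; apply: (filtration_reg ax rI hdim hp hX0 hloc).
have riesz := tau_riesz ax tau_nd.
have [om hom] := filtration_hyperplane ax rI hdim hp hX0 hloc tau_nd hDelta.
split=> [hA|[hN hCB]].
  (* This [w] takes the place of [om]: as a non-zerodivisor whose form tau (w _) vanishes on
     F_(r-1), it yields the Cayley-Bacharach property directly. *)
  have [w [hw nzw hcond]] := conductor_of_almost_gorenstein rI hsigma tauE riesz full hA.
  have [w' ww'] := degree0_nzd_unit rI nzw; split.
    exact: (nearly_gorenstein_of_conductor rI hsigma tauE riesz full ww' hw hcond).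
  apply: (cayley_bacharach_of_nzd ax rI hdim hp hX0 hloc tau_nd _ nzw).
  exact/(annih_r rI).
(* Cayley-Bacharach makes [om] a unit, so [conductor] can be formed with c_0 = om / x_0^r. *)
have nz : forall x, om * x = 0 -> x = 0.
  by apply: (nzd_of_cayley_bacharach ax rI hdim hp hX0 hloc _ hCB) => x /hom.
have [w' ww'] := degree0_nzd_unit rI nz.
have hw : annihilates tau (- (reg_index I p)%:Z) om by apply/(annih_r rI) => x /hom.
apply: (almost_gorenstein_of_conductor rI hsigma tauE riesz full ww' hw).
apply: (conductor_of_nearly_gorenstein rI hsigma tauE tau_nd riesz full ww' hw) => // a.
apply: (annih_r_scalar rI tau_nd) => [x /hom//|om0].
by apply: (degree0_one rI); rewrite -ww' om0 mul0r.
Qed.
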